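(* Let $q$ be an integral power of a prime $p>2$ and let $\chi$ be a class function on $B_n$. Then for each $n\ge1$, $$\sum_{f\in\mathcal{Y}_n(\mathbb{F}_q)}\chi(f)=\sum_{d=0}^{n}(-1)^d q^{n-d}\big\langle\chi, H^d(\mathcal{M}_{BC_n}(\mathbb{C});\mathbb{C})\big\rangle_{B_n}.$$
   Context: $\mathcal{Y}_n(\mathbb{F}_q)$ is the set of monic squarefree polynomials $f\in\mathbb{F}_q[T]$ of degree $n$ with $f(0)\ne0$. $B_n$ is the group of permutations $\sigma$ of $\{\pm1,\dots,\pm n\}$ with $\sigma(-a)=-\sigma(a)$. For $f\in\mathcal{Y}_n(\mathbb{F}_q)$ let $SQ(f)=\{x\in\overline{\mathbb{F}}_q: f(x^2)=0\}=\{\pm x_1,\dots,\pm x_n\}$ (a set of $2n$ distinct elements). The Frobenius $x\mapsto x^q$ permutes $SQ(f)$ commuting with negation; after labelling $x_1,\dots,x_n$ this defines a signed permutation $\sigma_f\in B_n$, well defined up to conjugacy, and $\chi(f):=\chi(\sigma_f)$. $\mathcal{M}_{BC_n}(\mathbb{C})=\{(z_1,\dots,z_n)\in\mathbb{C}^n: z_i\ne\pm z_j \text{ for } i\neq j,\ z_i\ne0\}$, with $B_n$ acting by signed permutation matrices, hence on its cohomology; $\langle\cdot,\cdot\rangle_{B_n}$ is the standard inner product of class functions (a representation standing for its character). *)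

(* Defs.v *)
From HB Require Import structures.
From mathcomp Require Import all_boot all_order all_algebra all_fingroup all_field.
From mathcomp Require Import all_classical all_reals all_analysis.
From mathcomp Require Import complex qpoly.

Set Implicit Arguments.
Unset Strict Implicit.
Unset Printing Implicit Defensive.

Import Order.TTheory GRing.Theory Num.Theory numFieldNormedType.Exports.

Local Open Scope ring_scope.

(* {±1, …, ±n}: (i, false) stands for +(i+1) and (i, true) for -(i+1). *)
Notation signed_idx n := ('I_n * bool)%type.

Definition sopp n (a : signed_idx n) : signed_idx n := (a.1, ~~ a.2).

Definition hyperoct n : {set {perm (signed_idx n)}} :=
  finset (fun s : {perm (signed_idx n)} =>
            [forall a, s (sopp a) == sopp (s a)]).

Lemma hyperoctP n (s : {perm (signed_idx n)}) :
  reflect (forall a, s (sopp a) = sopp (s a)) (s \in hyperoct n).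
Proof. by rewrite inE; apply: 'forall_eqP. Qed.

Lemma hyperoct_group_set n : group_set (hyperoct n).
Proof.
apply/group_setP; split; first by apply/hyperoctP => a; rewrite !perm1.
move=> s t /hyperoctP hs /hyperoctP ht; apply/hyperoctP => a.
by rewrite !permM hs ht.
Qed.

Canonical hyperoct_group n := Group (hyperoct_group_set n).

Notation "''B_' n" := [subg (hyperoct_group n)]
  (at level 8, n at level 2, format "''B_' n") : type_scope.

Definition is_class_fun (gT : finGroupType) (T : Type) (chi : gT -> T) :=
  forall s t : gT, chi (s ^ t)%g = chi s.

Definition class_inner (gT : finGroupType) (C : numClosedFieldType)
    (chi psi : gT -> C) : C :=
  #|gT|%:R^-1 * \sum_(s : gT) chi s * (psi s)^*.

Definition scoord (A : zmodType) n (z : 'rV[A]_n) (a : signed_idx n) : A :=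
  if a.2 then - z 0 a.1 else z 0 a.1.

Definition squarefree_poly (F : fieldType) (f : {poly F}) : Prop :=
  forall g : {poly F}, g ^+ 2 %| f -> (size g <= 1)%N.

Definition Y (F : fieldType) (n : nat) : set {poly F} :=
  [set f | [/\ f \is monic, size f = n.+1, squarefree_poly f
             & f.[0] != 0]]%classic.
Arguments Y F n _ : clear implicits.

Section Frobenius.
Variables (F : finFieldType) (L : closedFieldType) (iota : {rmorphism F -> L}).

Definition SQ (f : {poly F}) : set L :=
  [set x | root (map_poly iota f) (x ^+ 2)]%classic.

Definition is_frob_perm n (f : {poly F}) (s : 'B_n) : Prop :=
  exists x : 'rV[L]_n,
    [/\ injective (scoord x),
        SQ f = range (scoord x)
      & forall a, scoord x a ^+ #|F| = scoord x (sgval s a)].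

(* The labelling, hence the signed permutation, is only defined up to
   conjugacy: classical choice picks one (the default 1%g is used only when
   there is none). *)
Definition frob_perm n (f : {poly F}) : 'B_n :=
  xget 1%g [set s | is_frob_perm f s]%classic.

Definition chi_poly n (T : Type) (chi : 'B_n -> T) (f : {poly F}) : T :=
  chi (frob_perm n f).

End Frobenius.

Lemma mx_continuous (T U : topologicalType) m n (f : T -> 'M[U]_(m, n)) :
  (forall i j, continuous (fun x => f x i j)) -> continuous f.
Proof.
move=> fc x A [P Pnbhs PA].
have : \forall y \near x, forall i j, P i j (f y i j).
  apply: filter_forall => i; apply: filter_forall => j.
  exact: fc (Pnbhs i j).
by apply: filterS => y Py; apply: PA => i j; exact: Py.
Qed.

Lemma mx_coord_continuous (U : topologicalType) m n i j :
  continuous (fun M : 'M[U]_(m, n) => M i j).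
Proof.
move=> M A nA; exists (fun k l => if (k == i) && (l == j) then A else setT).
  by move=> k l; case: ifP => [/andP[/eqP-> /eqP->] //|_]; exact: filterT.
by move=> N /= /(_ i j); rewrite !eqxx.
Qed.

Lemma set_val_coord_continuous (U : topologicalType) m n
    (A : set 'M[U]_(m, n)) i j :
  continuous (fun x : A => (set_val x : 'M[U]_(m, n)) i j).
Proof.
move=> x; apply: (@continuous_comp A _ _ (@set_val _ A)
  (fun M : 'M[U]_(m, n) => M i j)); last exact: mx_coord_continuous.
exact: initial_continuous.
Qed.

Section Simplex.
Variable R : realType.

Definition stdsimplex (d : nat) : set 'rV[R]_d.+1 :=
  [set t | (forall i, 0 <= t 0 i) /\ \sum_i t 0 i = 1]%classic.
Arguments stdsimplex d _ : clear implicits.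

(* The i-th coface Δ^d -> Δ^(d+1), inserting 0 in position i. *)
Definition coface_row d (i : 'I_d.+2) (t : 'rV[R]_d.+1) : 'rV[R]_d.+2 :=
  \row_j oapp (t 0) 0 (unlift i j).

Lemma coface_row_subproof d (i : 'I_d.+2) (t : stdsimplex d) :
  coface_row i (set_val t) \in stdsimplex d.+1.
Proof.
case: t => t tP; have [t0 t1] := set_mem tP; apply/mem_set; split => [j|].
  by rewrite mxE /=; case: unliftP => [k _|_] //=.
rewrite (bigD1_ord i) //= mxE unlift_none /= add0r -[RHS]t1.
by apply: eq_bigr => j _; rewrite mxE liftK.
Qed.

Definition coface d (i : 'I_d.+2) (t : stdsimplex d) : stdsimplex d.+1 :=
  exist (fun u => u \in stdsimplex d.+1) _ (coface_row_subproof i t).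

Lemma coface_continuous d (i : 'I_d.+2) : continuous (@coface d i).
Proof.
apply: continuous_comp_initial; apply: mx_continuous => k j.
rewrite (_ : (fun x => _) =
  (fun x : stdsimplex d => oapp (set_val x 0) 0 (unlift i j))); last first.
  by apply/funext => x; rewrite /= mxE.
case: unliftP => [l _|_] /=; last exact: cst_continuous.
exact: set_val_coord_continuous.
Qed.

HB.instance Definition _ d i :=
  isContinuous.Build _ _ (@coface d i) (@coface_continuous d i).

Section Cohomology.
Variables (K : fieldType) (X : topologicalType).

Definition sing_simplex (d : nat) : Type := continuousType (stdsimplex d) X.

Definition face d (i : 'I_d.+2) (s : sing_simplex d.+1) : sing_simplex d :=
  s \o coface i.

Definition cochain (d : nat) : lmodType K := sing_simplex d -> K^o.

Definition coboundary d (c : cochain d) : cochain d.+1 :=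
  fun s => \sum_(i < d.+2) (-1) ^+ i * c (face i s).

Definition cocycles d : set (cochain d) :=
  [set c | coboundary c = 0]%classic.
Arguments cocycles d _ : clear implicits.

Definition coboundaries d : set (cochain d) :=
  match d with
  | 0 => [set 0]%classic
  | d'.+1 => range (@coboundary d')
  end.
Arguments coboundaries d _ : clear implicits.

Definition pullback (f : continuousType X X) d (c : cochain d) : cochain d :=
  fun s => c (f \o s).

End Cohomology.
End Simplex.

Arguments stdsimplex R d _ : clear implicits.
Arguments cocycles R K X d _ : clear implicits.
Arguments coboundaries R K X d _ : clear implicits.

(* Trace of the endomorphism of Z / B induced by f, where B <= Z are subspaces
   of V stable under f and Z / B is finite dimensional: e is a family of
   representatives of a basis of Z / B, and A is the matrix of f in it.
   The trace does not depend on the basis; trace_mod is 0 by convention when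
   Z / B is infinite dimensional. *)
Section SubquotientTrace.
Variables (K : fieldType) (V : lmodType K) (Z B : set V).

Definition basis_mod m (e : 'I_m -> V) : Prop :=
  (forall i, Z (e i)) /\
  (forall z, Z z -> exists! a : 'rV[K]_m, B (z - \sum_i a 0 i *: e i)).

Definition is_trace_mod (f : V -> V) (t : K) : Prop :=
  exists m (e : 'I_m -> V) (A : 'M[K]_m),
    [/\ basis_mod e,
        forall j, B (f (e j) - \sum_i A i j *: e i)
      & t = \tr A].

Definition trace_mod (f : V -> V) : K :=
  xget 0 [set t | is_trace_mod f t]%classic.

End SubquotientTrace.

Definition cohomology_trace (R : realType) (K : fieldType)
    (X : topologicalType) (f : continuousType X X) (d : nat) : K :=
  trace_mod (cocycles R K X d) (coboundaries R K X d) (pullback f (d := d)).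

Section Arrangement.
Variables (R : realType) (n : nat).

(* The alias ^o carries the topology given by the complex modulus. *)
Definition MBC : set 'rV[R[i]^o]_n :=
  [set z | (forall i j, i != j -> z 0 i != z 0 j /\ z 0 i != - z 0 j) /\
           (forall i, z 0 i != 0)]%classic.

(* z |-> \sum_i z_i e_{s(i)}, with e_{-a} = - e_a *)
Definition act_row (s : 'B_n) (z : 'rV[R[i]^o]_n) : 'rV[R[i]^o]_n :=
  \row_j scoord z ((sgval s)^-1%g (j, false)).

Lemma scoord_opp (z : 'rV[R[i]^o]_n) a : scoord z (sopp a) = - scoord z a.
Proof. by case: a => i []; rewrite /scoord /= ?opprK. Qed.

Lemma scoord_act s z a : scoord (act_row s z) a = scoord z ((sgval s)^-1%g a).
Proof.
case: a => i []; rewrite {1}/scoord /= mxE //.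
have /hyperoctP hs : (sgval s)^-1%g \in hyperoct n by rewrite groupV subgP.
by rewrite -scoord_opp -hs.
Qed.

Lemma MBCP z : MBC z <-> injective (scoord z).
Proof.
split=> [[zij z0] [i b] [j c]|inj].
  rewrite /scoord /= => E; have ij : i = j.
    apply/eqP/negPn/negP => /zij[/eqP zN /eqP zNN].
    case: b c E => [] [] E; [| | |by []].
    - by apply: zN; exact: oppr_inj.
    - by apply: zNN; rewrite -E opprK.
    - by [].
  move: E; rewrite ij.
  have zj : z 0 j != - z 0 j.
    by rewrite -subr_eq0 opprK -mulr2n mulrn_eq0 negb_or z0.
  by case: b; case: c => // /eqP; rewrite ?(negPf zj) // eq_sym (negPf zj).
have sne a b : a != b -> scoord z a != scoord z b.
  by apply: contra_neq; exact: inj.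
split=> [i j ij|i].
  split; first by apply: (sne (i, false) (j, false)); apply: contra ij => /eqP[->].
  by apply: (sne (i, false) (j, true)); apply/eqP => -[].
have /sne : (i, false) != (i, true) :> signed_idx n by apply/eqP => -[].
by apply: contra_neq => zi0; rewrite /scoord /= zi0 oppr0.
Qed.

Lemma act_subproof (s : 'B_n) (z : MBC) : act_row s (set_val z) \in MBC.
Proof.
have /MBCP zinj : MBC (set_val z) := set_valP z.
apply/mem_set/MBCP => a b.
by rewrite !scoord_act => /zinj; exact: perm_inj.
Qed.

Definition act (s : 'B_n) (z : MBC) : MBC :=
  exist (fun w => w \in MBC) _ (act_subproof s z).

Lemma act_continuous (s : 'B_n) : continuous (act s).
Proof.
apply: continuous_comp_initial; apply: mx_continuous => k j.
rewrite (_ : (fun x => _) =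
  (fun x : MBC => scoord (set_val x) ((sgval s)^-1%g (j, false)))); last first.
  by apply/funext => x; rewrite /= mxE.
case: ((sgval s)^-1%g (j, false)) => l b x.
have c : {for x, continuous (fun x : MBC => set_val x 0 l)}.
  exact: set_val_coord_continuous.
case: b; rewrite /scoord /=; last exact: c.
exact: (@continuousN R[i] (R[i]^o) _ _ _ c).
Qed.

HB.instance Definition _ s :=
  isContinuous.Build _ _ (act s) (@act_continuous s).

(* The character of H^d(MBC; C), on which s acts by (s^-1)^*. *)
Definition cohomology_char (d : nat) (s : 'B_n) : R[i] :=
  @cohomology_trace R R[i] MBC (act s^-1%g) d.

End Arrangement.

(* Main.v *)
(** Both sides are computed as sums over the sets [J] of hyperplanes
    [z_a = z_b] (with [a], [b] signed indices) which are stable under a signed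
    permutation [s], weighted by [(-1)^#|J|], by the sign of [s] on [J] and by a
    power of [q] depending on the codimension of the flat cut out by [J].

    Over the finite field, averaging over labellings of the roots turns the left
    side into a sum over [s] of the numbers of points [x] with distinct signed
    coordinates such that [x_a ^ q = x_(s a)].  Inclusion-exclusion is replaced
    by the vanishing of the supertrace of [s] on the Koszul complex of the set of
    hyperplanes through [x].  On the flat of [J] there are [q^(n - rk J)] such
    points: functions on the classes of signed indices split, in odd
    characteristic, into an even and an odd part, and the functions without
    symmetry condition are counted orbit by orbit.  The rank of [J] is the same
    over [F] and over the complex numbers because the closure operator of the
    arrangement is combinatorial.

    On the topological side, let [P_J] be the singular simplices missing some
    hyperplane of [J], and [P_0] those of the complement of the arrangement.  The
    total complex of the cochains on all [P_J] is acyclic.  By excision [P_J] has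
    the cohomology of the complement of a flat of complex codimension [rk J],
    that is of a sphere, and a linear map acts trivially on its class because
    [GL_c(C)] is connected.  Filtering by rank, the cohomology of the complement
    in degree [d] becomes the homology, at the independent sets, of the complex
    of sets of rank [d], which is exact elsewhere by deletion and contraction, so
    that the trace of [s] is again a supertrace over stable sets. *)

Require Import Defs.
From HB Require Import structures.
From mathcomp Require Import all_boot all_order all_algebra all_fingroup all_field.
From mathcomp Require cyclic mxabelem.
From mathcomp Require Import complex qpoly.
From mathcomp Require Import ring zify.

Set Implicit Arguments.
Unset Strict Implicit.
Unset Printing Implicit Defensive.

Import Order.TTheory GRing.Theory Num.Theory.

Local Open Scope ring_scope.

(** * Koszul complexes of sets and matroids *)

Section Koszul.
Variables (K : numFieldType) (I : finType).
Implicit Types (J L : {set I}) (a b : {set I} -> K).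

Definition rless (j h : I) : bool := (enum_rank j < enum_rank h)%N.

Lemma rless_total j h : j != h -> rless h j = ~~ rless j h.
Proof.
move=> jh; rewrite /rless -leqNgt ltn_neqAle; case: eqP => // /ord_inj /enum_rank_inj E.
by rewrite E eqxx in jh.
Qed.

Definition eps h J : K := (-1) ^+ #|[set j in J | rless j h]|.

Lemma epsU h k J : k \notin J -> eps h (k |: J) = (-1) ^+ rless k h * eps h J.
Proof.
move=> kJ; rewrite /eps; case kh : (rless k h).
  rewrite (_ : [set j in k |: J | rless j h] = k |: [set j in J | rless j h]).
    by rewrite cardsU1 inE (negPf kJ) /= add1n exprS expr1.
  by apply/setP => j; rewrite !inE; case: eqP => // ->; rewrite kh.
rewrite expr0 mul1r; congr (_ ^+ #|pred_of_set _|); apply/setP => j; rewrite !inE.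
by case: (j =P k) => // ->; rewrite kh !andbF.
Qed.

Lemma eps_sq h J : eps h J * eps h J = 1.
Proof. by rewrite -expr2 sqrr_sign. Qed.

Lemma eps_swap h k J : h != k -> h \notin J -> k \notin J ->
  eps k (h |: J) * eps h J = - (eps h (k |: J) * eps k J).
Proof.
move=> hk hJ kJ; rewrite !epsU // (rless_total hk).
case: (rless h k); rewrite ?expr0 ?expr1 /=; ring.
Qed.

Definition dK a J : K := \sum_(h | h \notin J) eps h J * a (h |: J).

Definition kap h a J : K := if h \in J then eps h (J :\ h) * a (J :\ h) else 0.

Lemma dKD a b J : dK (fun L => a L + b L) J = dK a J + dK b J.
Proof. by rewrite /dK -big_split; apply: eq_bigr => h _; rewrite mulrDr. Qed.

Lemma dKN a J : dK (fun L => - a L) J = - dK a J.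
Proof. by rewrite /dK -sumrN; apply: eq_bigr => h _; rewrite mulrN. Qed.

Lemma dKB a b J : dK (fun L => a L - b L) J = dK a J - dK b J.
Proof. by rewrite dKD dKN. Qed.

Lemma dKZ x a J : dK (fun L => x * a L) J = x * dK a J.
Proof. by rewrite /dK mulr_sumr; apply: eq_bigr => h _; rewrite mulrCA. Qed.

Lemma dK_local a b J : (forall h, h \notin J -> a (h |: J) = b (h |: J)) ->
  dK a J = dK b J.
Proof. by move=> ab; apply: eq_bigr => h hJ; rewrite ab. Qed.

Lemma dK_kap h a J : dK (kap h a) J + kap h (dK a) J = a J.
Proof.
case hJ : (h \in J); last first.
  rewrite {2}/kap hJ addr0 /dK (bigD1 h) ?hJ //= big1 ?addr0.
    by rewrite /kap setU11 setU1K ?hJ // mulrA eps_sq mul1r.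
  move=> k /andP [_ kh]; rewrite /kap !inE (negPf (_ : h != k)) ?hJ ?mulr0 //.
  by rewrite eq_sym.
have hn : h \notin J :\ h by rewrite !inE eqxx.
rewrite {2}/kap hJ /dK [X in _ + _ * X](bigD1 h) //= mulrDr mulrA eps_sq mul1r setD1K //.
rewrite addrCA -[RHS]addr0; congr (_ + _).
rewrite mulr_sumr [X in _ + X](_ : _ = \sum_(k | k \notin J) eps h (J :\ h) * (eps k (J :\ h) * a (k |: J :\ h))).
  rewrite -big_split /= big1 // => k kJ.
  have kh : h != k by apply: contraNneq kJ => <-.
  have kn : k \notin J :\ h by rewrite !inE (negPf kJ) andbF.
  have E : (k |: J) :\ h = k |: J :\ h.
    by apply/setP => j; rewrite !inE; case: (j =P k) => [->|//]; rewrite eq_sym kh.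
  rewrite /kap !inE hJ orbT E !mulrA -{1}(setD1K hJ).
  rewrite -mulrDl [eps k _ * _](_ : _ = - (eps h (J :\ h) * eps k (J :\ h))) ?addNr ?mul0r //.
  have -> : eps k (h |: J :\ h) = - (eps h (k |: J :\ h) * eps k (J :\ h)) * eps h (J :\ h).
    by rewrite -eps_swap // -mulrA eps_sq mulr1.
  rewrite -[X in _ = - X]mul1r -(eps_sq h (k |: J :\ h)); ring.
apply: eq_bigl => k; rewrite !inE negb_and negbK.
case: (eqVneq k h) => [->|]; first by rewrite hJ.
by rewrite /= andbT.
Qed.

Lemma dK_dK a J : dK (dK a) J = 0.
Proof.
have D b h L : dK (kap h b) L = b L - kap h (dK b) L by rewrite -[b L](dK_kap h) addrK.
rewrite /dK; under eq_bigr => h hJ do rewrite mulr_sumr.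
rewrite (exchange_big_dep xpredT) //=.
set S := (LHS).
have SN : S = - S.
  rewrite /S; rewrite -sumrN [LHS](exchange_big_dep xpredT) //=.
  apply: eq_bigr => k _; rewrite -sumrN; apply: eq_big => h.
    rewrite !inE; case: (eqVneq h k) => [->|hk]; first by rewrite !andbF.
    by rewrite /= andbC.
  rewrite !inE negb_or => /andP [hJ /andP [kh kJ]].
  rewrite !mulrA setUCA -mulNr; congr (_ * _).
  have kh' : k != h by rewrite eq_sym.
  rewrite GRing.mulrC (eps_swap kh') //; congr (- _); exact: GRing.mulrC.
by apply/eqP; move/eqP: SN; rewrite -subr_eq0 opprK -mulr2n mulrn_eq0.
Qed.

Lemma kap_support h a (P Q : pred {set I}) :
  (forall J, h \notin J -> P J -> Q (h |: J)) ->
  (forall J, ~~ P J -> a J = 0) -> forall J, ~~ Q J -> kap h a J = 0.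
Proof.
move=> PQ aP J; apply: contraNeq; rewrite /kap; case: ifPn => [hJ|]; last by rewrite eqxx.
move=> nz; rewrite -(setD1K hJ); apply: PQ; first by rewrite !inE eqxx.
by apply: contraNT nz => /aP ->; rewrite mulr0.
Qed.

Section PermSign.
Variable p : {perm I}.

Definition inv_sign i j : K := (-1) ^+ (rless i j && rless (p j) (p i)).

(* The sign with which [p] reorders the elements of [J]. *)
Definition psgn J : K := \prod_(i in J) \prod_(j in J) inv_sign i j.

Lemma psgn0 : psgn set0 = 1.
Proof. by rewrite /psgn big_set0. Qed.

Lemma eps_prod h J : eps h J = \prod_(j in J) (-1) ^+ rless j h.
Proof.
rewrite /eps -prodr_const big_mkcond [RHS]big_mkcond; apply: eq_bigr => j _.
by rewrite !inE; case: (j \in J) => //=; case: rless.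
Qed.

Lemma psgnU h J : h \notin J ->
  psgn (h |: J) = psgn J * (eps h J * eps (p h) (p @: J)).
Proof.
move=> hJ; rewrite /psgn big_setU1 //= big_setU1 //=.
have -> : inv_sign h h = 1 by rewrite /inv_sign /rless ltnn expr0.
rewrite mul1r.
under [X in _ * X = _]eq_bigr => i iJ do rewrite big_setU1 //=.
rewrite big_split /= [LHS]mulrA [LHS]mulrC; congr (_ * _).
rewrite !eps_prod big_imset /=; last by move=> i j _ _; exact: perm_inj.
rewrite -!big_split /=; apply: eq_bigr => i iJ.
have ih : i != h by apply: contraNneq hJ => <-.
have pih : p i != p h by rewrite (inj_eq perm_inj).
rewrite /inv_sign (rless_total ih) (rless_total pih).
by case: rless; case: rless; rewrite /= ?expr0 ?expr1 ?mulrNN ?mulr1 ?mul1r.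
Qed.

Lemma dK_psgn a J :
  dK (fun L => psgn L * a (p @: L)) J = psgn J * dK a (p @: J).
Proof.
rewrite /dK mulr_sumr [RHS](reindex_inj (@perm_inj _ p)) /=.
apply: eq_big => h; first by rewrite mem_imset //; exact: perm_inj.
move=> hJ; rewrite psgnU // imsetU1 mulrA [RHS]mulrA; congr (_ * _).
by rewrite mulrCA; congr (_ * _); rewrite mulrA eps_sq mul1r.
Qed.

End PermSign.
End Koszul.

Section Matroid.
Variables (K : numFieldType) (I : finType) (rk : {set I} -> nat).
Hypothesis rk_mono : forall h J, (rk J <= rk (h |: J))%N.
Hypothesis rk_unit : forall h J, (rk (h |: J) <= (rk J).+1)%N.
Hypothesis rk_loop : forall h (L L' : {set I}), L \subset L' ->
  rk (h |: L) = rk L -> rk (h |: L') = rk L'.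

Lemma rk_card (J L : {set I}) : (rk (J :|: L) <= #|J| + rk L)%N.
Proof.
have [m] := ubnP #|J|; elim: m J => // m IH J; rewrite ltnS => Jm.
have [->|[h hJ]] := set_0Vmem J; first by rewrite cards0 set0U.
rewrite -(setD1K hJ) -setUA cardsU1 !inE eqxx /= add1n.
apply: leq_trans (rk_unit _ _) _; rewrite addSn ltnS; apply: IH.
by rewrite (leq_trans _ Jm) // [#|J|](cardsD1 h) hJ.
Qed.

Definition fam (A L : {set I}) c (J : {set I}) := (J \subset A) && (rk (J :|: L) == c).

Lemma fam_between (A L : {set I}) c h (J : {set I}) k : (k \in A) -> fam A L c J ->
  fam A L c (h |: (k |: J)) -> fam A L c (k |: J).
Proof.
move=> kA /andP [JA /eqP Jc] /andP [_ /eqP hc]; apply/andP; split.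
  by rewrite subUset sub1set kA.
rewrite eqn_leq; apply/andP; split; first by rewrite -hc -[h |: _ :|: _]setUA rk_mono.
by rewrite -Jc -setUA rk_mono.
Qed.

(* The complex of subsets of a fixed rank c of a contraction of a matroid is
   exact except at the independent sets; by deletion and contraction. *)
Lemma matroid_exact (A L : {set I}) c (a : {set I} -> K) :
  (forall J, ~~ fam A L c J -> a J = 0) ->
  (forall J, fam A L c J -> dK a J = 0) ->
  exists b, (forall J, ~~ fam A L c J -> b J = 0) /\
    forall J, fam A L c J -> (#|J| + rk L)%N != c -> a J = dK b J.
Proof.
have [m] := ubnP #|A|; elim: m A L a => // m IH A L a; rewrite ltnS => Am aF da.
have [A0|[h hA]] := set_0Vmem A.
  exists (fun=> 0); split=> // J /andP [].
  rewrite A0 subset0 => /eqP ->.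
  by rewrite set0U cards0 add0n => ->.
pose A' := A :\ h.
have A'm : (#|A'| < m)%N by rewrite (leq_trans _ Am) // [#|A|](cardsD1 h) hA.
have famD (J : {set I}) : h \in J -> fam A L c J -> J :\ h \subset A'.
  by move=> hJ /andP [JA _]; apply: setSD.
have hJA' (J : {set I}) : J \subset A' -> h \notin J.
  by move=> /subsetP JA; apply/negP => /JA; rewrite !inE eqxx.
have famh (J : {set I}) : h \notin J -> fam A L c J = fam A' L c J.
  by move=> hJ; rewrite /fam subsetD1 hJ andbT.
have [lo|nlo] := eqVneq (rk (h |: L)) (rk L).
  have famU (J : {set I}) : fam A L c (h |: J) = fam A L c J.
    rewrite /fam subUset sub1set hA /= -setUA (rk_loop _ lo) //.
    exact: subsetUr.
  exists (kap h a); split.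
    by apply: (kap_support (P := fam A L c)) => // J _; rewrite famU.
  move=> J JF _; rewrite -[LHS](dK_kap h) /kap.
  case: ifP => hJ; last by rewrite addr0.
  by rewrite da ?mulr0 ?addr0 // -famU setD1K.
have rkh : rk (h |: L) = (rk L).+1.
  by apply/eqP; rewrite eqn_leq rk_unit ltn_neqAle eq_sym nlo rk_mono.
pose a1 (J : {set I}) : K := if J \subset A' then eps K h J * a (h |: J) else 0.
have fam1 (J : {set I}) : J \subset A' -> fam A' (h |: L) c J = fam A L c (h |: J).
  move=> JA; rewrite /fam JA setUA [J :|: [set h]]setUC -setUA /=.
  by rewrite subUset sub1set hA (subset_trans JA) ?subD1set //= setUA.
have [||b1 [b1F b1E]] := IH A' (h |: L) a1 A'm.
- move=> J; rewrite /a1; case: ifP => // JA; rewrite fam1 // => /aF ->.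
  by rewrite mulr0.
- move=> J; case JA : (J \subset A'); last by rewrite /fam JA.
  rewrite fam1 // => JF; have hJ := hJA' J JA.
  have E : dK a (h |: J) = - eps K h J * dK a1 J.
    rewrite /dK [in RHS](bigD1 h) //= {1}/a1 subUset sub1set !inE eqxx /= mulr0 add0r.
    rewrite mulr_sumr; apply: eq_big => [k|k]; rewrite !inE negb_or 1?andbC // => /andP [kJ kh].
    rewrite /a1 subUset JA andbT sub1set !inE kh /=.
    case: ifPn => kA; last first.
      rewrite !mulr0 aF ?mulr0 //; apply: contra kA => /andP [+ _].
      by rewrite subUset sub1set => /andP [].
    rewrite setUCA !mulrA; congr (_ * _).
    have hk : h != k by rewrite eq_sym.
    have -> : eps K k (h |: J) = - (eps K h (k |: J) * eps K k J) * eps K h J.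
      by rewrite -eps_swap // -mulrA eps_sq mulr1.
    by ring.
  have : - eps K h J * dK a1 J = 0 by rewrite -E da.
  by move/eqP; rewrite mulf_eq0 oppr_eq0 signr_eq0 /= => /eqP.
have kapF J : ~~ fam A L c J -> kap h b1 J = 0.
  apply: (kap_support (P := fam A' (h |: L) c)) => //.
  by move=> {}J _ JF; rewrite -fam1 //; case/andP: JF.
pose a' (J : {set I}) : K := if fam A L c J then a J + dK (kap h b1) J else 0.
have a'F J : ~~ fam A L c J -> a' J = 0 by rewrite /a' => /negPf ->.
have da' J : fam A L c J -> dK a' J = 0.
  move=> JF; rewrite -[RHS](addr0 0) -{1}(da J JF) -(dK_dK (kap h b1) J) -dKD.
  apply: dK_local => k kJ; rewrite /a'; case: ifPn => // kF.
  rewrite aF // add0r; apply/esym/big1 => l lkJ.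
  rewrite kapF ?mulr0 //; apply: contra kF => lF; apply: (fam_between _ JF lF).
  by case/andP: lF; rewrite !subUset !sub1set => /and3P [].
have a'h (J : {set I}) : h \in J -> (#|J| + rk L)%N != c -> a' J = 0.
  move=> hJ Jc; rewrite /a'; case: ifPn => // JF.
  have JA' := famD J hJ JF.
  have hn : h \notin J :\ h by rewrite !inE eqxx.
  have -> : dK (kap h b1) J = b1 J - kap h (dK b1) J by rewrite -[b1 J](dK_kap h) addrK.
  rewrite b1F ?sub0r; last by rewrite /fam subsetD1 hJ andbF.
  rewrite /kap hJ -b1E; first last.
  - by rewrite rkh addnS -addSn -[_.+1]add1n -{1}[1%N]/(nat_of_bool true) -hJ -cardsD1.
  - by rewrite fam1 // setD1K.
  by rewrite /a1 JA' setD1K // mulrA eps_sq mul1r subrr.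
pose a0 (J : {set I}) : K := if J \subset A' then a' J else 0.
have a0F J : ~~ fam A' L c J -> a0 J = 0.
  rewrite /a0; case: ifPn => // JA JF; apply: a'F.
  by rewrite famh // hJA'.
have [|b0 [b0F b0E]] := IH A' L a0 A'm a0F.
  move=> J JF; have JA : J \subset A' by case/andP: JF.
  have hJ := hJA' _ JA; rewrite -[RHS](da' J) ?famh //.
  apply: dK_local => k kJ; rewrite /a0; case: ifPn => // kA.
  case: (eqVneq k h) => [->|kh]; last first.
    apply/esym/a'F; apply: contra kA => /andP [kA _].
    by rewrite subsetD1 kA !inE negb_or eq_sym kh.
  apply/esym; have [|/a'F //] := boolP (fam A L c (h |: J)).
  move=> hF; apply: a'h; rewrite ?setU11 // cardsU1 hJ add1n.
  case/andP: JF => _ /eqP Jc; have := rk_card J L; rewrite Jc => cJ.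
  by apply/eqP => E; move: cJ; rewrite -E addSn ltnn.
exists (fun J => b0 J - kap h b1 J); split=> [J JF|J JF Jc].
  rewrite kapF // b0F ?subr0 //; apply: contra JF => /andP [JA /eqP Jc].
  by rewrite /fam Jc eqxx (subset_trans JA) ?subD1set.
rewrite dKB; have -> : a J = a' J - dK (kap h b1) J by rewrite /a' JF addrK.
congr (_ - _); case hJ : (h \in J).
  rewrite a'h // /dK big1 // => k kJ; rewrite b0F ?mulr0 //.
  by rewrite /fam subsetD1 !inE hJ orbT andbF.
have JA : J \subset A' by rewrite subsetD1 hJ; case/andP: JF => ->.
by rewrite -b0E // ?/a0 ?JA // -famh ?hJ.
Qed.

End Matroid.

(** * Supertraces *)

Section Supertrace.
Variables (K : fieldType) (N : nat).
Implicit Types D G E C H : 'M[K]_N.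

Lemma supertrace_homotopy D G E H : D *m E = - (E *m D) -> G *m D = D *m G ->
  \tr (G *m E *m (D *m H + H *m D)) = 0.
Proof.
move=> DE GD; rewrite mulmxDr mxtraceD !mulmxA.
rewrite [\tr (_ *m D)]mxtrace_mulC !mulmxA -GD -[G *m D *m E]mulmxA DE mulmxN mulNmx.
by rewrite linearN /= !mulmxA subrr.
Qed.

(* The trace on homology of a complex exact except in one degree, cut out by C. *)
Lemma supertrace D G E C (s : K) :
  D *m D = 0 -> D *m E = - (E *m D) -> G *m D = D *m G ->
  C *m C = C -> C *m G = G *m C -> G *m E = E *m G -> C *m E = s *: C -> s * s = 1 -> C *m D = 0 ->
  (forall v : 'rV_N, v *m D = 0 -> exists u w : 'rV_N, v = u *m D + w *m C) ->
  exists m (e : 'M[K]_(m, N)) (A : 'M[K]_m),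
    [/\ e *m C = e,
        (forall v : 'rV_N, v *m C = v ->
           exists c : 'rV_m, (exists u, v - c *m e = u *m D) /\
             forall c', (exists u, v - c' *m e = u *m D) -> c' = c),
        (exists u, e *m G - A *m e = u *m D)
      & \tr A = s * \tr (G *m E)].
Proof.
move=> DD DE GD CC CG GE CE ss CD ex.
have [t DtD] : exists t, D *m t *m D = D by exists (pinvmx D); rewrite mulmxKpV.
pose h := t - D *m t *m t.
pose P := 1%:M - (D *m h + h *m D).
have hD : h *m D = t *m D - D *m t *m t *m D by rewrite /h mulmxBl.
have Dh : D *m h = D *m t by rewrite /h mulmxBr !mulmxA DD !mul0mx subr0.
have tDtD : t *m D *m (t *m D) = t *m D by rewrite -mulmxA [D *m (t *m D)]mulmxA DtD.
have PE : P = (1%:M - D *m t) *m (1%:M - t *m D).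
  rewrite /P Dh hD mulmxBl mul1mx mulmxBr mulmx1 [D *m t *m (t *m D)]mulmxA.
  by apply/matrixP => i j; rewrite !mxE; ring.
have PD : P *m D = 0.
  have E0 : (1%:M - t *m D) *m D = D by rewrite mulmxBl mul1mx -mulmxA DD mulmx0 subr0.
  by rewrite PE -mulmxA E0 mulmxBl mul1mx DtD subrr.
have DP : D *m P = 0.
  have E0 : D *m (1%:M - D *m t) = D by rewrite mulmxBr mulmx1 mulmxA DD mul0mx subr0.
  by rewrite PE mulmxA E0 mulmxBr mulmx1 mulmxA DtD subrr.
have PP : P *m P = P.
  rewrite {2}/P mulmxBr mulmx1 mulmxDr mulmxA PD mul0mx add0r hD mulmxBr.
  rewrite [P *m (D *m t *m t *m D)]mulmxA [P *m (D *m t *m t)]mulmxA [P *m (D *m t)]mulmxA PD !mul0mx subr0.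
  have E0 : (1%:M - t *m D) *m (t *m D) = 0 by rewrite mulmxBl mul1mx tDtD subrr.
  by rewrite PE -mulmxA E0 mulmx0 subr0.
have CP : C *m P = C *m (1%:M - t *m D).
  have E0 : C *m (1%:M - D *m t) = C by rewrite mulmxBr mulmx1 mulmxA CD mul0mx subr0.
  by rewrite PE mulmxA E0.
have [W PW] : exists W, P = W *m C *m P.
  have : (1%:M - D *m t <= D + C)%MS.
    apply/row_subP => i; have [|u [w ->]] := ex (row i (1%:M - D *m t)).
      by rewrite -row_mul mulmxBl mul1mx DtD subrr row0.
    by rewrite addmx_sub_adds // submxMl.
  case/sub_addsmxP => -[U W] /= UW; exists W.
  rewrite -mulmxA CP mulmxA {1}PE UW mulmxDl -[U *m D *m _]mulmxA mulmxBr mulmx1.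
  by rewrite [D *m (t *m D)]mulmxA DtD subrr mulmx0 add0r.
have str : \tr (G *m E) = \tr (G *m E *m P).
  rewrite /P mulmxBr mulmx1 linearB /= supertrace_homotopy ?subr0 //.
have [m [f [u [r [fP Pu fr]]]]] : exists m (f : 'M_(m, N)) (u r : 'M_(N, m)),
    [/\ f *m P = f, P = u *m f & f *m r = 1%:M].
  have [u Pu] : exists u, P = u *m row_base P by apply/submxP; rewrite eq_row_base.
  have /row_freeP [r fr] := row_base_free P.
  exists (\rank P), (row_base P), u, r; split=> //.
  have /submxP [Z ->] : (row_base P <= P)%MS by rewrite eq_row_base.
  by rewrite -mulmxA PP.
have fu : f *m u = 1%:M.
  by rewrite -[LHS]mulmx1 -fr mulmxA -[f *m u *m _]mulmxA -Pu fP fr.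
have Du : D *m u = 0.
  by rewrite -[LHS]mulmx1 -fr mulmxA -[D *m u *m _]mulmxA -Pu DP mul0mx.
have [e0 fe] : exists e0, f = e0 *m C *m P.
  by exists (f *m W); rewrite -[LHS]fP {1}PW !mulmxA.
pose e := e0 *m C.
have eC : e *m C = e by rewrite /e -mulmxA CC.
have eP : e *m P = f by [].
have imP (k : nat) (w : 'M_(k, N)) : w *m C = w -> w *m P = 0 -> exists y, w = y *m D.
  move=> wC wP; exists (w *m h).
  have wD : w *m D = 0 by rewrite -wC -mulmxA CD mulmx0.
  by rewrite -[LHS]subr0 -wP /P mulmxBr mulmx1 mulmxDr mulmxA wD mul0mx add0r subKr mulmxA.
exists m, e, (e *m G *m u); split=> //.
- move=> v vC; exists (v *m u); split.
    apply: imP; first by rewrite mulmxBl -[v *m u *m e *m C]mulmxA eC vC.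
    by rewrite mulmxBl -[v *m u *m e *m P]mulmxA eP -mulmxA -Pu subrr.
  move=> c' [y yE]; have : (v - c' *m e) *m P = 0 by rewrite yE -mulmxA DP mulmx0.
  rewrite mulmxBl -[c' *m e *m P]mulmxA eP => /eqP; rewrite subr_eq0 => /eqP vP.
  have : v *m P *m u = c' by rewrite vP -mulmxA fu mulmx1.
  by rewrite Pu -!mulmxA fu mulmx1.
- apply: imP.
    by rewrite mulmxBl -[e *m G *m C]mulmxA -CG mulmxA eC -[e *m G *m u *m e *m C]mulmxA eC.
  by rewrite mulmxBl -[e *m G *m u *m e *m P]mulmxA eP -[e *m G *m u *m f]mulmxA -Pu subrr.
have eD : e *m D = 0 by rewrite -eC -mulmxA CD mulmx0.
have eE : e *m E = s *: e.
  by rewrite -{1}eC -mulmxA CE -scalemxAr eC.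
have DGEu : D *m (G *m (E *m u)) = 0.
  by rewrite !mulmxA -GD -[G *m D *m E]mulmxA DE mulmxN mulNmx !mulmxA -mulmxA Du mulmx0 oppr0.
have -> : \tr (G *m E) = \tr (e *m (G *m E *m u)).
  have -> : \tr (G *m E) = \tr (f *m (G *m E *m u)) by rewrite str Pu mulmxA mxtrace_mulC.
  suff -> : f *m (G *m E *m u) = e *m (G *m E *m u) by [].
  have PX : P *m (G *m E *m u) = G *m E *m u - D *m (h *m (G *m E *m u)).
    rewrite {1}/P mulmxBl mul1mx mulmxDl -[h *m D *m _]mulmxA.
    rewrite (_ : D *m (G *m E *m u) = 0) ?mulmx0 ?addr0 -?[D *m h *m _]mulmxA //.
    by rewrite -DGEu !mulmxA.
  by rewrite -eP -[e *m P *m _]mulmxA PX mulmxBr [e *m (D *m _)]mulmxA eD mul0mx subr0.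
by rewrite GE !mulmxA eE -!scalemxAl linearZ /= mulrA ss mul1r.
Qed.

End Supertrace.

Section FamilyMatrix.
Variables (K : numFieldType) (I : finType) (S : {set {set I}}).
Local Notation N := #|S|.
Implicit Types (J : {set I}) (a b : {set I} -> K).

Definition fsupp (Q : {set {set I}}) a := forall J, J \notin Q -> a J = 0.

Definition vec a : 'rV[K]_N := \row_k a (enum_val k).

Definition fn (v : 'rV[K]_N) J : K := \sum_k (enum_val k == J)%:R * v 0 k.

Lemma fnE v k : fn v (enum_val k) = v 0 k.
Proof.
rewrite /fn (bigD1 k) //= eqxx mul1r big1 ?addr0 // => l lk.
by rewrite (inj_eq enum_val_inj) (negPf lk) mul0r.
Qed.

Lemma vec_fn v : vec (fn v) = v.
Proof. by apply/rowP => k; rewrite mxE fnE. Qed.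

Lemma fn_supp v : fsupp S (fn v).
Proof.
move=> J JS; rewrite /fn big1 // => k _.
by case: eqP => [E|_]; rewrite ?mul0r //; move: JS; rewrite -E enum_valP.
Qed.

Lemma fn_vec a : fsupp S a -> fn (vec a) =1 a.
Proof.
move=> sa J; have [JS|JS] := boolP (J \in S); last by rewrite sa // fn_supp.
by rewrite -(enum_rankK_in JS JS) fnE mxE.
Qed.

Lemma vec_eq a b : (forall J, J \in S -> a J = b J) -> vec a = vec b.
Proof. by move=> ab; apply/rowP => k; rewrite !mxE ab // enum_valP. Qed.

Definition linear_op (T : ({set I} -> K) -> {set I} -> K) :=
  (forall a b, a =1 b -> T a =1 T b) /\
  forall s a b J, T (fun L => s * a L + b L) J = s * T a J + T b J.

Definition mxop (T : ({set I} -> K) -> {set I} -> K) : 'M[K]_N :=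
  \matrix_(k, l) T (fn (delta_mx 0 k)) (enum_val l).

Lemma mul_mxop T v : linear_op T -> v *m mxop T = vec (T (fn v)).
Proof.
move=> [Text Tlin]; apply/rowP => l; rewrite !mxE.
under eq_bigr => k _ do rewrite mxE.
have T0 J : T (fun=> 0) J = 0.
  transitivity (T (fun=> -1 * 0 + 0) J); first by apply: Text => L; rewrite mulr0 addr0.
  by rewrite (Tlin (-1) (fun=> 0) (fun=> 0)) mulN1r addNr.
have Tsum (r : seq 'I_N) J : T (fun L => \sum_(k <- r) v 0 k * fn (delta_mx 0 k) L) J =
    \sum_(k <- r) v 0 k * T (fn (delta_mx 0 k)) J.
  elim: r => [|k r IH]; first by rewrite big_nil -[RHS](T0 J); apply: Text => L; rewrite big_nil.
  by rewrite big_cons -IH -Tlin; apply: Text => L; rewrite big_cons.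
rewrite -Tsum; apply: Text => J; rewrite /fn.
under eq_bigr => k _ do rewrite mulr_sumr.
rewrite exchange_big /=; apply: eq_bigr => k _.
rewrite (bigD1 k) //= big1 ?addr0; first by rewrite mxE !eqxx mulr1 mulrC.
by move=> j jk; rewrite mxE eqxx (negPf (_ : k != j)) ?mulr0 // eq_sym.
Qed.

Lemma mx_row_eq m n (A B : 'M[K]_(m, n)) : (forall v : 'rV_m, v *m A = v *m B) -> A = B.
Proof. by move=> AB; apply/row_matrixP => i; rewrite !rowE AB. Qed.

Lemma linear_op_dK : linear_op (@dK K I).
Proof.
split=> [a b ab J|s a b J]; first by apply: dK_local => h _; rewrite ab.
by rewrite dKD dKZ.
Qed.

Definition scale_op (f : {set I} -> K) a J := f J * a J.

Lemma linear_op_scale f : linear_op (scale_op f).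
Proof.
split=> [a b ab J|s a b J]; first by rewrite /scale_op ab.
by rewrite /scale_op; ring.
Qed.

Definition csign J : K := (-1) ^+ #|J|.

Section PermTrace.
Variable p : {perm I}.
Hypothesis S_p : forall J, (p @: J \in S) = (J \in S).

Definition pact a J : K := psgn K p J * a (p @: J).

Lemma linear_op_pact : linear_op pact.
Proof.
split=> [a b ab J|s a b J]; first by rewrite /pact ab.
by rewrite /pact; ring.
Qed.

Lemma pact_supp a : fsupp S a -> fsupp S (pact a).
Proof. by move=> sa J JS; rewrite /pact sa ?mulr0 // S_p. Qed.

Lemma scale_supp f a : fsupp S a -> fsupp S (scale_op f a).
Proof. by move=> sa J JS; rewrite /scale_op sa ?mulr0. Qed.

Lemma card_perm_imset J : #|p @: J| = #|J|.
Proof. by rewrite card_imset //; exact: perm_inj. Qed.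

Lemma dK_pact a J : dK (pact a) J = pact (dK a) J.
Proof. exact: dK_psgn. Qed.

Let D := mxop (@dK K I).
Let G := mxop pact.
Let E := mxop (scale_op csign).

Lemma mxop_comp T T' v : linear_op T -> linear_op T' -> fsupp S (T (fn v)) ->
  v *m mxop T *m mxop T' = vec (T' (T (fn v))).
Proof.
move=> lT lT' sT; rewrite !mul_mxop //; apply: vec_eq => J _.
by apply: (proj1 lT'); exact: fn_vec.
Qed.

Lemma dK_csign a J : dK (scale_op csign a) J = - scale_op csign (dK a) J.
Proof.
rewrite /scale_op -mulNr /csign -dKZ; apply: dK_local => h hJ.
by rewrite cardsU1 hJ exprS mulN1r.
Qed.

Lemma mxop_DE : D *m E = - (E *m D).
Proof.
apply: mx_row_eq => v; rewrite mulmxN !mulmxA (mxop_comp (linear_op_scale _) linear_op_dK); last first.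
  exact: scale_supp (fn_supp v).
rewrite (mul_mxop _ linear_op_dK) (mul_mxop _ (linear_op_scale _)).
apply/rowP => k; rewrite !mxE dK_csign opprK /scale_op.
by rewrite fnE mxE.
Qed.

Lemma mxop_GD : G *m D = D *m G.
Proof.
apply: mx_row_eq => v; rewrite !mulmxA (mxop_comp linear_op_pact linear_op_dK); last first.
  exact: pact_supp (fn_supp v).
rewrite (mul_mxop _ linear_op_dK) (mul_mxop _ linear_op_pact).
apply/rowP => k; rewrite !mxE dK_pact /pact; congr (_ * _).
have kS : p @: enum_val k \in S by rewrite S_p enum_valP.
by rewrite -{2}(enum_rankK_in kS kS) fnE mxE enum_rankK_in.
Qed.

Lemma mxop_GE : G *m E = E *m G.
Proof.
apply: mx_row_eq => v; rewrite !mulmxA (mxop_comp linear_op_pact (linear_op_scale _)).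
  rewrite (mxop_comp (linear_op_scale _) linear_op_pact).
  - by apply: vec_eq => J _; rewrite /pact /scale_op /csign card_perm_imset mulrCA.
  - exact: scale_supp (fn_supp v).
- exact: pact_supp (fn_supp v).
Qed.

Lemma trace_GE : \tr (G *m E) =
  \sum_(J in S | p @: J == J) (-1) ^+ #|J| * psgn K p J.
Proof.
rewrite /mxtrace big_mkcondr /= [RHS]big_enum_val /=; apply: eq_bigr => k _.
have -> : (G *m E) k k = (delta_mx 0 k *m G *m E) (0 : 'I_1) k.
  by rewrite -(mulmxA (delta_mx 0 k)) -rowE [RHS]mxE.
rewrite (mxop_comp linear_op_pact (linear_op_scale _)); last exact: pact_supp (fn_supp _).
rewrite mxE /scale_op /pact /csign; case: eqP => [pk|npk].
  by rewrite pk fnE mxE !eqxx mulr1.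
rewrite [fn _ _](_ : _ = 0) ?mulr0 // /fn big1 // => l _.
case: eqP => [lk|_]; last by rewrite mul0r.
rewrite mxE eqxx; case: eqP => [lk'|_]; last by rewrite mulr0.
by subst l; case: npk.
Qed.

Lemma stable_sum_eq0 h :
  (forall J, h \notin J -> (h |: J \in S) = (J \in S)) ->
  \sum_(J in S | p @: J == J) (-1) ^+ #|J| * psgn K p J = 0.
Proof.
move=> hS; rewrite -trace_GE.
have lk : linear_op (@kap K I h).
  split=> [a b ab J|s a b J]; rewrite /kap; case: ifP => _; rewrite ?ab //.
    by ring.
  by rewrite mulr0 addr0.
have DH : D *m mxop (kap h) + mxop (kap h) *m D = 1%:M.
  apply: mx_row_eq => v; rewrite mulmx1 mulmxDr !mulmxA (mxop_comp lk linear_op_dK); last first.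
    apply: (@kap_support K I h (fn v) (mem S) (mem S)).
      by move=> J hJ JS; rewrite /= hS.
    exact: fn_supp.
  rewrite (mul_mxop _ linear_op_dK) (mul_mxop _ lk).
  apply/rowP => k; rewrite -[in RHS](vec_fn v) !mxE addrC -[RHS](dK_kap h); congr (_ + _).
  rewrite /kap; case: ifP => // hk; congr (_ * _).
  have kS : enum_val k :\ h \in S by rewrite -hS ?setD1K ?enum_valP // !inE eqxx.
  by rewrite -{1}(enum_rankK_in kS kS) fnE mxE enum_rankK_in.
by rewrite -[G *m E]mulmx1 -DH supertrace_homotopy //; [exact: mxop_DE|exact: mxop_GD].
Qed.

Section Bottom.
Variable c : nat.
Hypothesis S_between : forall J h k, J \in S -> k |: (h |: J) \in S -> h |: J \in S.
Let B : {set {set I}} := [set J in S | #|J| == c].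
Hypothesis bottom : forall a J, fsupp B a -> J \in S -> dK a J = 0.
Hypothesis exactness : forall a, fsupp S a -> (forall J, J \in S -> dK a J = 0) ->
  exists b, fsupp S b /\ forall J, J \in S -> #|J| != c -> a J = dK b J.

Definition bim a := exists b, fsupp S b /\ forall J, J \in B -> a J = dK b J.

Lemma bottom_trace : exists m (e : 'I_m -> {set I} -> K) (A : 'M[K]_m),
  [/\ forall i, fsupp B (e i),
      forall a, fsupp B a -> exists c : 'rV[K]_m, bim (fun J => a J - \sum_i c 0 i * e i J) /\
         forall c' : 'rV[K]_m, bim (fun J => a J - \sum_i c' 0 i * e i J) -> c' = c,
      forall j, bim (fun J => pact (e j) J - \sum_i A i j * e i J)
    & \tr A = (-1) ^+ c * \sum_(J in S | p @: J == J) (-1) ^+ #|J| * psgn K p J].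
Proof.
pose C := mxop (scale_op (fun J => (#|J| == c)%:R)).
have BS a : fsupp B a -> fsupp S a.
  by move=> sa J JS; apply: sa; rewrite inE (negPf JS).
have Bsc a : fsupp S a -> fsupp B (scale_op (fun J => (#|J| == c)%:R) a).
  move=> sa J; rewrite inE negb_and /scale_op => /orP [JS|/negPf ->]; last by rewrite mul0r.
  by rewrite sa ?mulr0.
have Bfix a J : fsupp B a -> scale_op (fun J => (#|J| == c)%:R) a J = a J.
  move=> sa; rewrite /scale_op; case: eqP => cJ; first by rewrite mul1r.
  by rewrite mul0r sa // inE negb_and orbC; move/eqP: cJ => ->.
have lC := linear_op_scale (fun J => (#|J| == c)%:R).
have lE := linear_op_scale csign.
have CD : C *m D = 0.
  apply: mx_row_eq => v; rewrite mulmx0 mulmxA (mxop_comp lC linear_op_dK); last first.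
    exact: scale_supp (fn_supp v).
  apply/rowP => k; rewrite !mxE bottom ?enum_valP //; exact: Bsc (fn_supp v).
have [||||||||||m [e [A [eC ebas [u eG] trA]]]] := @supertrace K N D G E C ((-1) ^+ c).
- apply: mx_row_eq => v; rewrite mulmx0 mulmxA !(mul_mxop _ linear_op_dK).
  apply/rowP => k; rewrite !mxE -[RHS](dK_dK (fn v) (enum_val k)); apply: dK_local => h hk.
  have [hS|hS] := boolP (h |: enum_val k \in S).
    by rewrite -{1}(enum_rankK_in hS hS) fnE mxE enum_rankK_in.
  rewrite fn_supp // /dK big1 // => l lk; rewrite fn_supp ?mulr0 //.
  by apply: contra hS; apply: S_between; exact: enum_valP.
- exact: mxop_DE.
- exact: mxop_GD.
- apply: mx_row_eq => v; rewrite !mulmxA (mxop_comp lC lC); last exact: scale_supp (fn_supp v).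
  by rewrite (mul_mxop _ lC); apply: vec_eq => J _; rewrite Bfix //; exact: Bsc (fn_supp v).
- apply: mx_row_eq => v; rewrite !mulmxA (mxop_comp linear_op_pact lC); last exact: pact_supp (fn_supp v).
  rewrite (mxop_comp lC linear_op_pact); last exact: scale_supp (fn_supp v).
  by apply: vec_eq => J _; rewrite /pact /scale_op card_perm_imset mulrCA.
- exact: mxop_GE.
- apply: mx_row_eq => v; rewrite mulmxA (mxop_comp lC lE); last exact: scale_supp (fn_supp v).
  rewrite -scalemxAr (mul_mxop _ lC); apply/rowP => k; rewrite !mxE /scale_op /csign.
  by case: eqP => [->|_]; rewrite ?mul0r ?mulr0.
- by rewrite -expr2 sqrr_sign.
- exact: CD.
- move=> v; rewrite (mul_mxop _ linear_op_dK) => vD.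
  have [|b [sb vb]] := exactness (fn_supp v).
    move=> J JS; move/rowP/(_ (enum_rank_in JS J)): vD.
    by rewrite !mxE enum_rankK_in.
  exists (vec b), (v - vec b *m D).
  apply/rowP => k; rewrite (mul_mxop _ lC) (mul_mxop _ linear_op_dK) !mxE /scale_op.
  have -> : dK (fn (vec b)) (enum_val k) = dK b (enum_val k).
    by apply: (proj1 linear_op_dK); exact: fn_vec.
  rewrite fnE !mxE; case: (_ =P c) => ck.
    rewrite mul1r (proj1 linear_op_dK _ b (fn_vec sb)); by rewrite addrC subrK.
  by rewrite mul0r addr0 -vb ?enum_valP ?fnE //; apply/eqP.
have eB i : fsupp B (fn (row i e)).
  have -> : row i e = row i e *m C by rewrite -row_mul eC.
  rewrite (mul_mxop _ lC) => J JB; rewrite fn_vec; first by apply: Bsc => //; exact: fn_supp.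
  exact: scale_supp (fn_supp _).
have bimE (w : 'rV[K]_N) a : fsupp B a -> w = vec a -> bim a <-> exists u, w = u *m D.
  move=> sa ->; split=> [[b [sb ab]]|[y yE]]; last first.
    exists (fn y); split; first exact: fn_supp.
    move=> J; rewrite inE => /andP [JS _].
    move/rowP/(_ (enum_rank_in JS J)): yE; rewrite (mul_mxop _ linear_op_dK) !mxE.
    by rewrite enum_rankK_in.
  pose b' J : K := if #|J| == c.+1 then b J else 0.
  have sb' : fsupp S b' by move=> J JS; rewrite /b' sb // if_same.
  exists (vec b'); rewrite (mul_mxop _ linear_op_dK); apply: vec_eq => J JS.
  rewrite (proj1 linear_op_dK _ b' (fn_vec sb')).
  have [cJ|cJ] := eqVneq #|J| c.
    rewrite ab ?inE ?JS ?cJ ?eqxx //; apply: dK_local => h hJ.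
    by rewrite /b' cardsU1 hJ cJ add1n eqxx.
  rewrite sa ?inE ?JS //= /dK big1 // => h hJ.
  by rewrite /b' cardsU1 hJ add1n eqSS (negPf cJ) mulr0.
have comb (a : {set I} -> K) (x : 'rV[K]_m) : fsupp S a ->
    vec (fun J => a J - \sum_i x 0 i * fn (row i e) J) = vec a - x *m e.
  move=> sa; apply/rowP => k; rewrite !mxE; congr (_ - _); apply: eq_bigr => i _.
  by rewrite fnE mxE.
have combB a (x : 'rV[K]_m) : fsupp B a -> fsupp B (fun J => a J - \sum_i x 0 i * fn (row i e) J).
  move=> sa J JB; rewrite sa // big1 ?subr0 // => i _; by rewrite eB ?mulr0.
exists m, (fun i => fn (row i e)), A^T; split=> //.
- move=> a sa; have [|x [xu xuniq]] := ebas (vec a).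
    rewrite (mul_mxop _ lC); apply: vec_eq => J _.
    by rewrite -[RHS](Bfix _ _ sa) /scale_op fn_vec //; exact: BS.
  exists x; split.
    by apply/(bimE (vec a - x *m e)) => //; [exact: combB|rewrite comb //; exact: BS].
  move=> x' /(bimE (vec a - x' *m e)) H; apply: xuniq; apply: H; first exact: combB.
  by rewrite comb //; exact: BS.
- move=> j; have sp : fsupp B (pact (fn (row j e))).
    by move=> J JB; rewrite /pact eB ?mulr0 //; move: JB; rewrite !inE S_p card_perm_imset.
  have : bim (fun J => pact (fn (row j e)) J - \sum_i (row j A) 0 i * fn (row i e) J).
    apply/(bimE (row j e *m G - row j A *m e)); first exact: combB.
      by rewrite comb ?(mul_mxop _ linear_op_pact) //; exact: BS.
    by exists (row j u); rewrite -!row_mul -eG !linearB.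
  move=> [b [sb bE]]; exists b; split=> // J JB; rewrite -bE //.
  by congr (_ - _); apply: eq_bigr => i _; rewrite !mxE.
by rewrite mxtrace_tr trA trace_GE.
Qed.

End Bottom.
End PermTrace.
End FamilyMatrix.

(** * Forms of the arrangement *)

Notation pair_idx n :=
  {h : signed_idx n * signed_idx n | h.1 != h.2}.

Section Forms.
Variables (K : fieldType) (n : nat).
Local Notation W := (signed_idx n).
Implicit Types (a b : W) (J : {set pair_idx n}) (h : pair_idx n).

Definition sform a : 'rV[K]_n := (-1) ^+ a.2 *: delta_mx 0 a.1.

Lemma sform_scoord m (Z : 'M[K]_(m, n)) a (i : 'I_m) : (Z *m (sform a)^T) i 0 = scoord (row i Z) a.
Proof.
rewrite /sform linearZ /= -scalemxAr trmx_delta -colE !mxE /scoord !mxE.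
by case: a.2; rewrite ?expr1 ?mulN1r ?expr0 ?mul1r.
Qed.

Lemma scoordE (z : 'rV[K]_n) a : scoord z a = (z *m (sform a)^T) 0 0.
Proof. by rewrite sform_scoord row_id. Qed.

Definition pform h : 'rV[K]_n := sform (val h).1 - sform (val h).2.

Lemma pform_scoord (z : 'rV[K]_n) h :
  (z *m (pform h)^T == 0) = (scoord z (val h).1 == scoord z (val h).2).
Proof.
rewrite /pform linearB mulmxBr subr_eq0 !scoordE; apply/eqP/eqP => [->//|E].
by apply/rowP => i; rewrite ord1.
Qed.

Definition span J : 'M[K]_n := (\sum_(h in J) <<pform h>>)%MS.

Lemma span_sub J m (B : 'M[K]_(m, n)) :
  (span J <= B)%MS = [forall h in J, (pform h <= B)%MS].
Proof.
apply/sumsmx_subP/forall_inP => sJ h /sJ; by rewrite genmxE.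
Qed.

Lemma pform_sub h J : h \in J -> (pform h <= span J)%MS.
Proof. by move=> hJ; apply: submx_trans (sumsmx_sup h _ (submx_refl _)) => //; rewrite genmxE. Qed.

Lemma span_mono (J L : {set pair_idx n}) : J \subset L -> (span J <= span L)%MS.
Proof.
by move=> /subsetP JL; rewrite span_sub; apply/forall_inP => h /JL; exact: pform_sub.
Qed.

Lemma spanU h J : (span (h |: J) :=: pform h + span J)%MS.
Proof.
apply/eqmxP/andP; split.
  rewrite span_sub; apply/forall_inP => k; rewrite !inE => /orP [/eqP ->|kJ].
    exact: addsmxSl.
  exact: submx_trans (pform_sub kJ) (addsmxSr _ _).
by rewrite addsmx_sub pform_sub ?setU11 ?span_mono // subsetUr.
Qed.

Definition vanishes J (z : 'rV[K]_n) :=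
  [forall h in J, scoord z (val h).1 == scoord z (val h).2].

Lemma span_vanishes (z : 'rV[K]_n) J : (z *m (span J)^T == 0) = vanishes J z.
Proof.
have E m (B : 'M[K]_(m, n)) : (z *m B^T == 0) = (B <= kermx z^T)%MS.
  apply/eqP/sub_kermxP => H; last by rewrite -[z]trmxK -trmx_mul H trmx0.
  by rewrite -[B]trmxK -trmx_mul H trmx0.
by rewrite E span_sub; apply: eq_forallb_in => h _; rewrite -E pform_scoord.
Qed.

Lemma mulmx_tr_sub m l (z : 'rV[K]_n) (A : 'M[K]_(m, n)) (B : 'M[K]_(l, n)) :
  (A <= B)%MS -> z *m B^T = 0 -> z *m A^T = 0.
Proof. by case/submxP => D -> zB; rewrite trmx_mul mulmxA zB mul0mx. Qed.

Lemma genspan_vanishes (z : 'rV[K]_n) J : (z *m (<<span J>>%MS)^T == 0) = vanishes J z.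
Proof.
by rewrite -span_vanishes; apply/eqP/eqP; apply: mulmx_tr_sub; rewrite genmxE.
Qed.

Lemma genspan_scoord (z : 'rV[K]_n) h J : h \in J -> z *m (<<span J>>%MS)^T = 0 ->
  scoord z (val h).1 = scoord z (val h).2.
Proof.
move=> hJ /eqP; rewrite genspan_vanishes => /forall_inP /(_ h hJ) /eqP //.
Qed.

Lemma genspan_flat h J : \rank (span (h |: J)) = \rank (span J) ->
  <<span (h |: J)>>%MS = <<span J>>%MS.
Proof.
move=> rJ; apply/eq_genmx/eqmx_sym/eqmxP.
by rewrite -(mxrank_leqif_eq (span_mono (subsetUr _ _))) rJ.
Qed.

Definition rkf J := \rank (span J).

Lemma rkf_mono h J : (rkf J <= rkf (h |: J))%N.
Proof. by apply: mxrankS; rewrite spanU addsmxSr. Qed.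

Lemma rkf_unit h J : (rkf (h |: J) <= (rkf J).+1)%N.
Proof.
rewrite /rkf spanU; apply: leq_trans (leq_of_leqif (mxrank_adds_leqif _ _)) _.
by rewrite -(add1n (\rank (span J))) leq_add2r rank_leq_row.
Qed.

Lemma rkfU h J : rkf (h |: J) = ((~~ (pform h <= span J)%MS) + rkf J)%N.
Proof.
have [hJ|hJ] := boolP (pform h <= span J)%MS.
  by rewrite /rkf spanU; apply: eqmx_rank; apply/eqmxP/addsmx_idPr.
apply/eqP; rewrite eqn_leq rkf_unit /= add1n /rkf spanU.
by rewrite ltn_neqAle mxrankS ?addsmxSr // andbT (mxrank_leqif_sup (addsmxSr _ _)) addsmx_sub submx_refl andbT.
Qed.

Lemma rkf_loop h (J L : {set pair_idx n}) : J \subset L ->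
  rkf (h |: J) = rkf J -> rkf (h |: L) = rkf L.
Proof.
move=> JL; rewrite !rkfU; case: (boolP (pform h <= span J)%MS) => [hJ _|_].
  by rewrite (submx_trans hJ) ?span_mono.
by move/eqP; rewrite -[X in _ == X]add0n eqn_add2r.
Qed.

Lemma rkf0 : rkf set0 = 0%N.
Proof. by rewrite /rkf /span big_set0 mxrank0. Qed.

Lemma rkf_leq J : (rkf J <= n)%N.
Proof. exact: rank_leq_row. Qed.

Hypothesis char_neq2 : 2%:R != 0 :> K.

Lemma pform_neq0 h : pform h != 0.
Proof.
case: h => [[[i b] [j c]] /= ab]; rewrite /pform /sform /= subr_eq0.
apply: contra ab => /eqP/rowP E.
have N1 : -1 != 1 :> K by rewrite -subr_eq0 -opprD oppr_eq0 -mulr2n.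
have ij : i = j.
  apply/eqP; move: (E i); rewrite !mxE !eqxx /= eq_sym.
  by case: eqP => // _ /eqP; rewrite mulr0 mulr1 signr_eq0.
move: (E i); rewrite ij !mxE !eqxx !mulr1.
by case: b {E}; case: c => //= /eqP; rewrite ?(negPf N1) // eq_sym (negPf N1).
Qed.

Lemma rkf_gt0 J : J != set0 -> (0 < rkf J)%N.
Proof.
case/set0Pn => h hJ; rewrite lt0n mxrank_eq0; apply: contra (pform_neq0 h) => /eqP S0.
by have := pform_sub hJ; rewrite S0 submx0.
Qed.

End Forms.

Section PairPerm.
Variable n : nat.
Implicit Types (u : {perm (signed_idx n)}) (J : {set pair_idx n}) (h : pair_idx n).

Lemma pair_act_subproof u h : (u (val h).1, u (val h).2).1 != (u (val h).1, u (val h).2).2.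
Proof. by case: h => [[a b] /=]; rewrite (inj_eq perm_inj). Qed.

Definition pair_act u h : pair_idx n := Sub (u (val h).1, u (val h).2) (pair_act_subproof u h).

Lemma pair_act_inj u : injective (pair_act u).
Proof.
move=> [[a b] ab] [[c d] cd] /(congr1 val) /= [/perm_inj ac /perm_inj bd].
by apply: val_inj; rewrite /= ac bd.
Qed.

Definition pair_perm u : {perm pair_idx n} := perm (@pair_act_inj u).

Lemma pair_permE u h : val (pair_perm u h) = (u (val h).1, u (val h).2).
Proof. by rewrite permE. Qed.

Lemma pair_permK u h : pair_perm u^-1 (pair_perm u h) = h.
Proof. by apply: val_inj; rewrite !pair_permE /= !permK; case: (val h). Qed.

Variable K : fieldType.
Local Notation sform := (@sform K n).
Local Notation pform := (@pform K n).
Local Notation span := (@span K n).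

Definition hmx u : 'M[K]_n := \matrix_(j, i) sform (u (j, false)) 0 i.

Lemma sform_opp a : sform (sopp a) = - sform a.
Proof.
rewrite /sform /sopp /= -scaleNr; congr (_ *: _).
by case: a.2; rewrite /= ?expr0 ?expr1 ?opprK.
Qed.

Lemma sform_hmx u a : u \in hyperoct n -> sform a *m hmx u = sform (u a).
Proof.
move=> /hyperoctP hu; have E j : sform (j, false) *m hmx u = sform (u (j, false)).
  by rewrite /sform expr0 scale1r -rowE; apply/rowP => i; rewrite !mxE.
case: a => j [] //; have -> : (j, true) = sopp (j, false) by [].
by rewrite hu !sform_opp mulNmx E.
Qed.

Lemma hmxM u v : u \in hyperoct n -> v \in hyperoct n -> hmx u *m hmx v = hmx (u * v)%g.
Proof.
move=> hu hv; apply/row_matrixP => j.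
have E w : row j (hmx w) = sform (w (j, false)) by apply/rowP => i; rewrite !mxE.
by rewrite row_mul !E sform_hmx // permM.
Qed.

Lemma hmx1 : hmx 1%g = 1%:M.
Proof.
apply/row_matrixP => j; apply/rowP => i.
by rewrite !mxE perm1 /sform /= expr0 mul1r [in RHS]eq_sym.
Qed.

Lemma hmx_mulV u : u \in hyperoct n -> hmx u *m hmx u^-1%g = 1%:M.
Proof. by move=> hu; rewrite hmxM ?groupV // mulgV hmx1. Qed.

Lemma hmx_unit u : u \in hyperoct n -> hmx u \in unitmx.
Proof. by move=> /hmx_mulV /mulmx1_unit []. Qed.

Lemma scoord_hmx u (z : 'rV[K]_n) a : u \in hyperoct n ->
  scoord (z *m (hmx u)^T) a = scoord z (u a).
Proof. by move=> hu; rewrite !scoordE -mulmxA -trmx_mul sform_hmx. Qed.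

Lemma pform_hmx u h : u \in hyperoct n -> pform h *m hmx u = pform (pair_perm u h).
Proof. by move=> hu; rewrite /pform mulmxBl !sform_hmx // pair_permE. Qed.

Lemma span_perm u J : u \in hyperoct n ->
  (span (pair_perm u @: J) :=: span J *m hmx u)%MS.
Proof.
move=> hu; apply/eqmxP/andP; split.
  rewrite span_sub; apply/forall_inP => _ /imsetP [h hJ ->].
  by rewrite -pform_hmx // submxMr // pform_sub.
rewrite -[X in (_ <= X)%MS]mulmx1 -(hmx_mulV (groupVr hu)) invgK mulmxA submxMr //.
rewrite span_sub; apply/forall_inP => h hJ.
rewrite -(pair_permK u h) -pform_hmx ?groupV // submxMr // pform_sub //.
exact: imset_f.
Qed.

Lemma rkf_perm u J : u \in hyperoct n -> rkf K (pair_perm u @: J) = rkf K J.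
Proof.
by move=> hu; rewrite /rkf (span_perm _ hu) mxrankMfree // row_free_unit hmx_unit.
Qed.

End PairPerm.

(** * Fixed points of Frobenius *)

Section FrobeniusRoots.
Variables (L : closedFieldType) (q : nat).
Hypothesis q_gt1 : (1 < q)%N.
Hypothesis q_pchar : [pchar L].-nat q.

Lemma exprD_q l (x y : L) : (x + y) ^+ (q ^ l) = x ^+ (q ^ l) + y ^+ (q ^ l).
Proof. by apply: exprDn_pchar; rewrite pnatX q_pchar. Qed.

Lemma exprN_q l (x : L) : (- x) ^+ (q ^ l) = - x ^+ (q ^ l).
Proof. by apply: exprNn_pchar; rewrite pnatX q_pchar. Qed.

Lemma q_eq0 : q%:R = 0 :> L.
Proof.
case/andP: q_pchar => q0 /allP /(_ (pdiv q)); rewrite mem_primes pdiv_prime // q0 pdiv_dvd.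
by move=> /(_ isT) pL; apply/eqP; rewrite -(dvdn_pcharf pL) pdiv_dvd.
Qed.

Lemma frob_rootsP l : (0 < l)%N ->
  exists rs : seq L, [/\ uniq rs, size rs = (q ^ l)%N & forall x, (x \in rs) = (x ^+ (q ^ l) == x)].
Proof.
move=> l0; pose m := (q ^ l)%N.
have m1 : (1 < m)%N by rewrite -(expn0 q) ltn_exp2l.
have [rs] := closed_field_poly_normal ('X^m - 'X : {poly L}).
have sm : size ('X^m - 'X : {poly L}) = m.+1.
  by rewrite size_polyDl size_polyXn // size_polyN size_polyX ltnS.
have -> : lead_coef ('X^m - 'X : {poly L}) = 1.
  by rewrite lead_coefDl ?lead_coefXn // size_polyN size_polyX size_polyXn ltnS.
rewrite scale1r => E; exists rs; split.
- rewrite -separable_prod_XsubC -E separable_poly.unlock.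
  have -> : ('X^m - 'X : {poly L})^`() = -1.
    rewrite derivB derivXn derivX (_ : _ *+ m = 0) ?sub0r //.
    rewrite -mulr_natl -polyC_natr (_ : m%:R = 0) ?mul0r // /m.
    by case: l l0 {m m1 sm E} => // l _; rewrite expnS natrM q_eq0 mul0r.
  by rewrite -[-1]scaleN1r coprimepZr ?oppr_eq0 ?oner_eq0 // coprimep1.
- by have := size_prod_XsubC rs id; rewrite -E sm => -[].
move=> x; rewrite -root_prod_XsubC -E /root !hornerE subr_eq0.
by rewrite -[in LHS]hornerXn !hornerE.
Qed.

End FrobeniusRoots.

Section OrbitCount.
Variables (L : closedFieldType) (q N : nat).
Hypothesis q_gt1 : (1 < q)%N.
Hypothesis q_pchar : [pchar L].-nat q.
Hypothesis N_gt0 : (0 < N)%N.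
Variable rs : seq L.
Hypothesis rsP : forall x, (x \in rs) = (x ^+ (q ^ N) == x).
Local Notation E := (seq_sub rs).

Lemma ssval_inj : injective (@ssval L rs).
Proof. exact: val_inj. Qed.

Lemma rs0 : 0 \in rs.
Proof. by rewrite rsP expr0n expn_eq0; case: q q_gt1. Qed.

Definition toE (x : L) : E := insubd (SeqSub rs0) x.

Lemma toEK x : x \in rs -> ssval (toE x) = x.
Proof. by move=> xr; rewrite -[LHS]/(val (toE x)) insubdK. Qed.

Lemma rs_frobX x k : x \in rs -> x ^+ (q ^ k) \in rs.
Proof. by rewrite !rsP => /eqP xx; rewrite exprAC xx. Qed.

Lemma frob_mod (x : L) l k : x ^+ (q ^ l) = x -> x ^+ (q ^ k) = x ^+ (q ^ (k %% l)).
Proof.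
move=> xl; rewrite {1}(divn_eq k l) expnD exprM; congr (_ ^+ _).
elim: (k %/ l)%N => [|m IH]; first by rewrite mul0n expn0 expr1.
by rewrite mulSn expnD exprM xl.
Qed.

Lemma card_frob_fixed l : (0 < l)%N -> (l %| N)%N ->
  #|[pred e : E | ssval e ^+ (q ^ l) == ssval e]| = (q ^ l)%N.
Proof.
move=> l0 lN; have [rl [url srl rlP]] := frob_rootsP q_gt1 q_pchar l0.
set A := [pred e : E | _]; rewrite -srl -(size_image (@ssval L rs) A).
apply: perm_size; apply: uniq_perm => //.
  by rewrite map_inj_uniq ?enum_uniq //; exact: ssval_inj.
move=> x; rewrite rlP; apply/imageP/idP => [[e eA ->]|xl]; first exact: eA.
have xr : x \in rs by rewrite rsP (frob_mod N (eqP xl)) (eqP lN) expn0 expr1.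
by exists (toE x); rewrite ?inE toEK.
Qed.

Section Orbits.
Variables (C : finType) (t : C -> C).
Hypothesis t_inj : injective t.
Hypothesis tN : forall c, iter N t c = c.

Lemma iter_mod_order k c : iter k t c = iter (k %% fingraph.order t c) t c.
Proof.
rewrite {1}(divn_eq k (fingraph.order t c)) addnC iterD; congr (iter _ _ _).
elim: (k %/ fingraph.order t c)%N => // m IH.
by rewrite mulSn iterD IH iter_order //; exact: t_inj.
Qed.

Lemma order_dvd c : (fingraph.order t c %| N)%N.
Proof.
have lt : (N %% fingraph.order t c < fingraph.order t c)%N by rewrite ltn_mod fingraph.order_gt0.
by apply/eqP; have := findex_iter lt; rewrite -iter_mod_order tN findex0.
Qed.

Definition frob_fun := [set y : {ffun C -> E} | [forall c, ssval (y c) ^+ q == ssval (y (t c))]].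

Lemma frob_iter y k c : y \in frob_fun -> ssval (y (iter k t c)) = ssval (y c) ^+ (q ^ k).
Proof.
rewrite inE => /forallP yf; elim: k => [|k IH]; first by rewrite expn0 expr1.
by rewrite iterS -(eqP (yf _)) IH -exprM -expnSr.
Qed.

Lemma card_frob_fun : #|frob_fun| = (q ^ #|C|)%N.
Proof.
pose e0 : E := toE 0.
pose fam c : pred E := if froot t c == c then [pred e : E | ssval e ^+ (q ^ fingraph.order t c) == ssval e]
  else pred1 e0.
pose T := [set z : {ffun C -> E} | z \in family fam].
pose ix c := findex t (froot t c) c.
have ixK c : iter (ix c) t (froot t c) = c.
  by apply: iter_findex; rewrite (fconnect_sym t_inj) connect_root.
have rtE c : froot t (t c) = froot t c.
  by apply/esym/(fingraph.rootP (fconnect_sym t_inj)); exact: fconnect1.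
have rr c : froot t (froot t c) = froot t c by apply: root_root; exact: fconnect_sym t_inj.
pose psi (z : {ffun C -> E}) : {ffun C -> E} :=
  [ffun c => toE (ssval (z (froot t c)) ^+ (q ^ ix c))].
have psiE z c : ssval (psi z c) = ssval (z (froot t c)) ^+ (q ^ ix c).
  by rewrite ffunE toEK // rs_frobX //; exact: ssvalP.
have Tr z c : z \in T -> ssval (z (froot t c)) ^+ (q ^ fingraph.order t (froot t c)) = ssval (z (froot t c)).
  by rewrite inE => /familyP /(_ (froot t c)); rewrite /fam rr eqxx inE => /eqP.
have Tn z c : z \in T -> froot t c != c -> z c = e0.
  by rewrite inE => /familyP /(_ c); rewrite /fam => zc /negPf rc; move: zc; rewrite rc inE => /eqP.
have -> : frob_fun = psi @: T.
  apply/setP => y; apply/idP/imsetP => [yf|[z zT ->]].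
    exists [ffun c => if froot t c == c then y c else e0].
      rewrite inE; apply/familyP => c; rewrite ffunE /fam; case: eqP => rc; rewrite !inE //.
      by rewrite -frob_iter // iter_order.
    apply/ffunP => c; apply: ssval_inj; rewrite psiE ffunE rr eqxx.
    by rewrite -frob_iter // ixK.
  rewrite inE; apply/forallP => c; rewrite !psiE rtE -exprM -expnSr.
  rewrite (frob_mod _ (Tr _ _ zT)); apply/eqP; congr (_ ^+ (q ^ _)).
  have -> : ix (t c) = findex t (froot t c) (iter (ix c).+1 t (froot t c)).
    by rewrite iterS ixK /ix rtE.
  by rewrite iter_mod_order findex_iter // ltn_mod fingraph.order_gt0.
rewrite card_in_imset => [|z z' zT z'T zz]; last first.
  apply/ffunP => c; have [rc|rc] := eqVneq (froot t c) c; last by rewrite !Tn.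
  apply: ssval_inj; have := congr1 (fun y : {ffun C -> E} => ssval (y c)) zz.
  by rewrite !psiE /ix rc findex0 expn0 !expr1.
rewrite cardsE card_family foldrE big_image /=.
transitivity (\prod_(c | froot t c == c) q ^ fingraph.order t c)%N.
  rewrite [RHS]big_mkcond; apply: eq_bigr => c _; rewrite /fam; case: eqP => _.
    by rewrite card_frob_fixed ?fingraph.order_gt0 ?order_dvd.
  exact: card1.
rewrite -expn_sum; congr (_ ^ _)%N.
rewrite -[RHS]sum1_card [RHS](partition_big (froot t) (fun c => froot t c == c)) /=; last first.
  by move=> c _; rewrite rr.
apply: eq_bigr => r /eqP rr'; rewrite sum1_card /fingraph.order; apply: eq_card => c.
rewrite !inE -[in RHS]rr' [RHS]root_connect; last exact: fconnect_sym t_inj.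
by rewrite fconnect_sym.
Qed.

End Orbits.

Section Classes.
Variables (W : finType) (s : W -> W) (e : rel W).
Hypothesis sN : forall w, iter N s w = w.
Hypothesis e_sym : symmetric e.
Hypothesis e_s : forall a b, e (s a) (s b) = e a b.

Definition inv_fun (y : {ffun W -> E}) := [forall a, forall b, e a b ==> (y a == y b)].

Lemma inv_funP (y : {ffun W -> E}) : reflect (forall a b, e a b -> y a = y b) (inv_fun y).
Proof.
apply: (iffP forallP) => [H a b ab|H a]; first by apply/eqP/(implyP (forallP (H a) b)).
by apply/forallP => b; apply/implyP => /H ->.
Qed.

Lemma e_csym : connect_sym e.
Proof. exact: sym_connect_sym. Qed.

Lemma connect_inv y a b : inv_fun y -> connect e a b -> y a = y b.
Proof.
move=> /inv_funP yi /connectP [l el ->]; elim: l a el => //= c l IH a /andP [ac cl].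
by rewrite (yi _ _ ac); exact: IH.
Qed.

Lemma connect_s a b : connect e (s a) (s b) = connect e a b.
Proof.
have hom f c d : (forall a b, e (f a) (f b) = e a b) -> connect e c d -> connect e (f c) (f d).
  move=> ef /connectP [l el ->]; elim: l c el => //= x l IH c /andP [cx xl].
  by apply: connect_trans (IH _ xl); apply: connect1; rewrite ef.
apply/idP/idP; last exact: hom.
have iN k w : iter k s (s w) = iter k.+1 s w by rewrite -iterSr.
move=> /(hom (iter N.-1 s)); rewrite !iN prednK // !sN; apply.
by move=> {}a {}b; elim: N.-1 => //= k IH; rewrite e_s.
Qed.

Lemma card_class_fun :
  #|[set y in frob_fun s | inv_fun y]| = (q ^ #|[set w | fingraph.root e w == w]|)%N.
Proof.
pose D := {w | fingraph.root e w == w}.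
have rr w : fingraph.root e (fingraph.root e w) == fingraph.root e w by rewrite (root_root e_csym).
pose r w : D := exist (fun w => fingraph.root e w == w) (fingraph.root e w) (rr w).
pose s' (c : D) : D := r (s (val c)).
have rE a b : connect e a b -> r a = r b.
  by move=> ab; apply: val_inj => /=; apply/eqP; rewrite (root_connect e_csym).
have rK (c : D) : r (val c) = c by apply: val_inj; exact: (eqP (valP c)).
have rc w : connect e (val (r w)) w by rewrite e_csym connect_root.
have rs' w : s' (r w) = r (s w) by apply: rE; rewrite connect_s.
have s'_inj : injective s'.
  move=> c c' /(congr1 val) /= /eqP; rewrite (root_connect e_csym) connect_s => /rE.
  by rewrite !rK.
have s'N c : iter N s' c = c.
  have E k w : iter k s' (r w) = r (iter k s w) by elim: k => //= k ->.
  by rewrite -[c]rK E sN.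
have -> : #|[set w | fingraph.root e w == w]| = #|{: D}|.
  by rewrite card_sig; apply: eq_card => w; rewrite !inE.
rewrite -(card_frob_fun s'_inj s'N).
pose ps (z : {ffun D -> E}) : {ffun W -> E} := [ffun w => z (r w)].
have psI : injective ps.
  move=> z z' /ffunP zz; apply/ffunP => c.
  by have := zz (val c); rewrite !ffunE rK.
rewrite -(card_imset _ psI); apply: eq_card => y; rewrite !inE; apply/andP/imsetP.
  move=> [/forallP yf yi]; exists [ffun c => y (val c)].
    rewrite inE; apply/forallP => c; rewrite !ffunE (eqP (yf _)).
    by apply/eqP; congr ssval; apply: connect_inv yi _; rewrite e_csym rc.
  by apply/ffunP => w; rewrite !ffunE; apply: connect_inv yi _; rewrite e_csym rc.
move=> [z]; rewrite inE => /forallP zf ->; split.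
  by apply/forallP => w; rewrite !ffunE (eqP (zf _)) rs'.
by apply/inv_funP => a b ab; rewrite !ffunE (rE a b) // connect1.
Qed.

End Classes.

Section EvenOdd.
Variables (W : finType) (nu : W -> W) (e : rel W).
Hypothesis two_neq0 : 2%:R != 0 :> L.
Hypothesis nuK : involutive nu.
Hypothesis e_sym : symmetric e.
Hypothesis e_nu : forall a b, e (nu a) (nu b) = e a b.

Definition e_even : rel W := fun a b => e a b || (b == nu a).

Lemma e_even_sym : symmetric e_even.
Proof.
by move=> a b; rewrite /e_even e_sym; congr (_ || _); apply/eqP/eqP => ->; rewrite nuK.
Qed.

Definition odd_fun (y : {ffun W -> E}) := [forall a, ssval (y (nu a)) == - ssval (y a)].

Lemma rsD x y : x \in rs -> y \in rs -> x + y \in rs.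
Proof. by rewrite !rsP (exprD_q q_pchar) => /eqP -> /eqP ->. Qed.

Lemma rsN x : x \in rs -> - x \in rs.
Proof. by rewrite !rsP (exprN_q q_pchar) => /eqP ->. Qed.

Lemma frob_nat m : m%:R ^+ q = m%:R :> L.
Proof.
elim: m => [|m IH]; first by rewrite expr0n; case: q q_gt1.
by rewrite -natr1 -{1}(expn1 q) (exprD_q q_pchar) expn1 IH expr1n.
Qed.

Lemma frobD (x y : L) : (x + y) ^+ q = x ^+ q + y ^+ q.
Proof. by have := exprD_q q_pchar 1 x y; rewrite expn1. Qed.

Lemma frobN (x : L) : (- x) ^+ q = - x ^+ q.
Proof. by have := exprN_q q_pchar 1 x; rewrite expn1. Qed.

Lemma half_frob (x : L) : (x / 2%:R) ^+ q = x ^+ q / 2%:R.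
Proof. by rewrite exprMn exprVn frob_nat. Qed.

Lemma rs_half x : x \in rs -> x / 2%:R \in rs.
Proof.
rewrite !rsP => /eqP xr; rewrite exprMn exprVn xr (_ : 2%:R ^+ _ = 2%:R) //.
by elim: N => [|k IH]; rewrite ?expn0 ?expr1 // expnSr exprM IH frob_nat.
Qed.

Lemma card_odd_fun (s : W -> W) : injective s -> (forall w, iter N s w = w) ->
  (forall a b, e (s a) (s b) = e a b) -> (forall w, s (nu w) = nu (s w)) ->
  (#|[set y in frob_fun s | inv_fun e y && odd_fun y]| * q ^ #|[set w | fingraph.root e_even w == w]|)%N =
  (q ^ #|[set w | fingraph.root e w == w]|)%N.
Proof.
move=> s_inj sN e_s s_nu.
have ee_s a b : e_even (s a) (s b) = e_even a b by rewrite /e_even e_s -s_nu (inj_eq s_inj).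
set Odd := [set y in _ | _].
pose All := [set y in frob_fun s | inv_fun e y].
pose Even := [set y in frob_fun s | inv_fun e_even y].
have cA : #|All| = _ := card_class_fun sN e_sym e_s.
have cE : #|Even| = _ := card_class_fun sN e_even_sym ee_s.
rewrite -cA -cE -cardsX.
pose f (yz : {ffun W -> E} * {ffun W -> E}) : {ffun W -> E} :=
  [ffun w => toE (ssval (yz.1 w) + ssval (yz.2 w))].
have fE yz w : ssval (f yz w) = ssval (yz.1 w) + ssval (yz.2 w).
  by rewrite ffunE toEK // rsD //; exact: ssvalP.
have OddP y : y \in Odd -> forall w, ssval (y (nu w)) = - ssval (y w).
  by rewrite inE => /and3P [_ _ /forallP oy] w; exact/eqP.
have EvenP y : y \in Even -> forall w, y (nu w) = y w.
  by rewrite inE => /andP [_ /inv_funP ey] w; apply/esym/ey; rewrite /e_even eqxx orbT.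
have finj : {in setX Odd Even &, injective f}.
  move=> [y z] [y' z'] /setXP [/OddP oy /EvenP ez] /setXP [/OddP oy' /EvenP ez'] E0.
  have E1 w := congr1 (fun h : {ffun W -> E} => ssval (h w)) E0.
  have E2 w : ssval (y w) = ssval (y' w).
    have := E1 w; have := E1 (nu w); rewrite !fE /= oy oy' ez ez' => A1 A2.
    have : 2%:R * ssval (y w) = 2%:R * ssval (y' w).
      have -> : 2%:R * ssval (y w) = (ssval (y w) + ssval (z w)) - (- ssval (y w) + ssval (z w)) by ring.
      by rewrite A2 A1; ring.
    exact: mulfI.
  congr (_, _); apply/ffunP => w; apply: ssval_inj; first exact: E2.
  by have := E1 w; rewrite !fE /= E2 => /addrI.
rewrite -(card_in_imset finj); apply: eq_card => y; apply/imsetP/idP.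
  move=> [[o z] /setXP [oO zE] ->]; move: (oO) (zE); rewrite !inE.
  move=> /and3P [/forallP of' /inv_funP oi _] /andP [/forallP zf /inv_funP zi]; apply/andP; split.
    by apply/forallP => w; rewrite !fE frobD /= (eqP (of' _)) (eqP (zf _)).
  apply/inv_funP => a b ab; apply: ssval_inj; rewrite !fE /= (oi _ _ ab) (zi a b) //.
  by rewrite /e_even ab.
rewrite !inE => /andP [/forallP yf /inv_funP yi].
have yr w : ssval (y w) \in rs by exact: ssvalP.
pose o : {ffun W -> E} := [ffun w => toE ((ssval (y w) - ssval (y (nu w))) / 2%:R)].
pose z : {ffun W -> E} := [ffun w => toE ((ssval (y w) + ssval (y (nu w))) / 2%:R)].
have oE w : ssval (o w) = (ssval (y w) - ssval (y (nu w))) / 2%:R.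
  by rewrite ffunE toEK // rs_half // rsD // rsN.
have zE w : ssval (z w) = (ssval (y w) + ssval (y (nu w))) / 2%:R.
  by rewrite ffunE toEK // rs_half // rsD.
exists (o, z).
  rewrite !inE /=; apply/andP; split; [apply/and3P; split|apply/andP; split].
  - apply/forallP => w; rewrite !oE half_frob frobD frobN.
    by rewrite !(eqP (yf _)) s_nu.
  - by apply/inv_funP => a b ab; apply: ssval_inj; rewrite !oE (yi _ _ ab) (yi (nu a) (nu b)) ?e_nu.
  - by apply/forallP => w; rewrite !oE nuK -mulNr opprB.
  - apply/forallP => w; rewrite !zE half_frob frobD.
    by rewrite !(eqP (yf _)) s_nu.
  - apply/inv_funP => a b; rewrite /e_even => /orP [ab|/eqP ->]; apply: ssval_inj; rewrite !zE.
      by rewrite (yi _ _ ab) (yi (nu a) (nu b)) ?e_nu.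
    by rewrite nuK addrC.
apply/ffunP => w; apply: ssval_inj; rewrite fE /= oE zE.
by field.
Qed.

End EvenOdd.

End OrbitCount.

(** * Points on the flats *)

Section JointRelation.
Variable n : nat.
Local Notation W := (signed_idx n).
Implicit Types (J : {set pair_idx n}) (h : pair_idx n) (a b : W).

Lemma soppK : involutive (@sopp n).
Proof. by case=> i c; rewrite /sopp /= negbK. Qed.

Definition glue J : rel W := fun a b => [exists h in J,
  [|| val h == (a, b), val h == (b, a), val h == (sopp a, sopp b) | val h == (sopp b, sopp a)]].

Lemma glue_sym J : symmetric (glue J).
Proof.
move=> a b; apply: eq_existsb => h; congr (_ && _).
by case: (_ == (a, b)); case: (_ == (b, a)); case: (_ == (sopp a, _)); case: (_ == (sopp b, _)).
Qed.

Lemma glue_sopp J a b : glue J (sopp a) (sopp b) = glue J a b.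
Proof.
apply: eq_existsb => h; congr (_ && _); rewrite !soppK.
by case: (_ == (a, b)); case: (_ == (b, a)); case: (_ == (sopp a, _)); case: (_ == (sopp b, _)).
Qed.

Lemma glue_perm_sub u J a b : u \in hyperoct n -> pair_perm u @: J = J ->
  glue J a b -> glue J (u a) (u b).
Proof.
move=> /hyperoctP hu uJ /existsP [h /andP [hJ hab]]; apply/existsP; exists (pair_perm u h).
rewrite -{1}uJ imset_f //= pair_permE -!hu.
by case/or4P: hab => /eqP -> /=; rewrite ?hu eqxx ?orbT.
Qed.

Lemma pair_perm_stableV u J : pair_perm u @: J = J -> pair_perm u^-1 @: J = J.
Proof.
move=> uJ; rewrite -{1}uJ -imset_comp -[RHS]imset_id; apply: eq_imset => h /=.
exact: pair_permK.
Qed.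

Lemma glue_perm u J a b : u \in hyperoct n -> pair_perm u @: J = J ->
  glue J (u a) (u b) = glue J a b.
Proof.
move=> hu uJ; apply/idP/idP; last exact: glue_perm_sub.
move=> /(glue_perm_sub (groupVr hu) (pair_perm_stableV uJ)).
by rewrite !permK.
Qed.

Lemma glue_connect_sym J : connect_sym (glue J).
Proof. exact: sym_connect_sym (glue_sym J). Qed.

Variable K : fieldType.
Hypothesis two_neq0 : 2%:R != 0 :> K.

Lemma scoord_sopp (z : 'rV[K]_n) a : scoord z (sopp a) = - scoord z a.
Proof. by case: a => i []; rewrite /scoord /= ?opprK. Qed.

Lemma vanishes_glue J (z : 'rV[K]_n) :
  vanishes J z <-> forall a b, glue J a b -> scoord z a = scoord z b.
Proof.
split=> [/forall_inP zJ a b /existsP [h /andP [/zJ /eqP zh]]|zJ].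
  by case/or4P => /eqP E; move: zh; rewrite E /= ?scoord_sopp // => /oppr_inj.
apply/forall_inP => h hJ; apply/eqP/zJ; apply/existsP; exists h.
by rewrite hJ; case: (val h) => a b; rewrite eqxx.
Qed.

Lemma vanishes_connect J (z : 'rV[K]_n) a b :
  vanishes J z -> connect (glue J) a b -> scoord z a = scoord z b.
Proof.
move=> /vanishes_glue zJ /connectP [l el ->]; elim: l a el => //= c l IH a /andP [ac cl].
by rewrite (zJ _ _ ac); exact: IH.
Qed.

Lemma pform_span h J : reflect
  (forall z : 'rV[K]_n, vanishes J z -> scoord z (val h).1 = scoord z (val h).2)
  (pform K h <= span K J)%MS.
Proof.
apply: (iffP idP) => [hJ z|zJ].
  rewrite -span_vanishes => /eqP zJ; apply/eqP; rewrite -pform_scoord; apply/eqP.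
  exact: mulmx_tr_sub hJ zJ.
rewrite submxE; apply/eqP/trmx_inj; rewrite trmx_mul trmx0; apply/row_matrixP => i.
rewrite row_mul row0; apply/eqP; rewrite pform_scoord; apply/eqP/zJ.
by rewrite -span_vanishes -row_mul -trmx_mul mulmx_coker trmx0 row0.
Qed.

Lemma bump_form J a b : ~~ connect (glue J) a b -> ~~ connect (glue J) a (sopp a) ->
  exists z : 'rV[K]_n, vanishes J z /\ scoord z a != scoord z b.
Proof.
move=> ab aa; pose c x : K := (connect (glue J) a x)%:R - (connect (glue J) a (sopp x))%:R.
exists (\row_i c (i, false)).
have zE x : scoord (\row_i c (i, false)) x = c x.
  by rewrite /scoord; case: x => i []; rewrite mxE //= /c opprB.
split.
  apply/vanishes_glue => x y xy; rewrite !zE /c.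
  have E v w : glue J v w -> connect (glue J) a v = connect (glue J) a w.
    by move=> vw; rewrite ![connect _ a _]glue_connect_sym; apply: same_connect1 => //; exact: glue_connect_sym.
  by rewrite (E x y) // (E (sopp x) (sopp y)) ?glue_sopp.
rewrite !zE /c connect0 (negPf aa) (negPf ab) subr0 sub0r.
case: connect; last by rewrite oppr0 oner_eq0.
by rewrite -subr_eq0 opprK -natrD.
Qed.

Lemma pform_span_connect h J : (pform K h <= span K J)%MS =
  connect (glue J) (val h).1 (val h).2 ||
  (connect (glue J) (val h).1 (sopp (val h).1) && connect (glue J) (val h).2 (sopp (val h).2)).
Proof.
case: (val h) (pform_span h J) => [a b] /= hP; apply/hP/idP => [zJ|].
  apply: contraTT isT; rewrite negb_or negb_and => /andP [ab /orP [aa|bb]].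
    by have [z [/zJ -> /eqP]] := bump_form ab aa.
  rewrite glue_connect_sym in ab.
  by have [z [/zJ -> /eqP]] := bump_form ab bb.
move=> ab z zJ; case/orP: ab => [ab|/andP [aa bb]]; first exact: vanishes_connect zJ ab.
have z0 x : connect (glue J) x (sopp x) -> scoord z x = 0.
  move=> /(vanishes_connect zJ); rewrite scoord_sopp => /eqP.
  by rewrite -subr_eq0 opprK -mulr2n -mulr_natl mulf_eq0 (negPf two_neq0) => /eqP.
by rewrite !z0.
Qed.

End JointRelation.

(* By [pform_span_connect], the field does not matter. *)
Lemma rkf_field n (K K' : fieldType) (J : {set pair_idx n}) :
  2%:R != 0 :> K -> 2%:R != 0 :> K' -> rkf K J = rkf K' J.
Proof.
move=> K2 K'2; have [m] := ubnP #|J|; elim: m J => // m IH J; rewrite ltnS => Jm.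
have [->|[h hJ]] := set_0Vmem J; first by rewrite !rkf0.
rewrite -(setD1K hJ) !rkfU !pform_span_connect // IH //.
by rewrite (leq_trans _ Jm) // [#|J|](cardsD1 h) hJ.
Qed.

Section FixedPoints.
Variables (F : finFieldType) (L : closedFieldType) (iota : {rmorphism F -> L}).
Local Notation q := #|F|.
Hypothesis q_pchar : [pchar L].-nat q.
Hypothesis F2 : 2%:R != 0 :> F.
Variables (N : nat) (rs : seq L).
Hypothesis N_gt0 : (0 < N)%N.
Hypothesis rsP : forall x, (x \in rs) = (x ^+ (q ^ N) == x).
Variable n : nat.
Local Notation W := (signed_idx n).
Local Notation E := (seq_sub rs).

Let q_gt1 : (1 < q)%N := finNzRing_gt1 F.
Local Notation toE := (toE q_gt1 rsP).

Lemma L2 : 2%:R != 0 :> L.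
Proof. by rewrite -(rmorph_nat iota) fmorph_eq0. Qed.

Definition pt (x : {ffun 'I_n -> E}) : 'rV[L]_n := \row_i ssval (x i).

Definition frob_pts (u : {perm W}) := [set x : {ffun 'I_n -> E} |
  [forall a, scoord (pt x) a ^+ q == scoord (pt x) (u a)]].

Lemma scoord_rs x a : scoord (pt x) a \in rs.
Proof. by rewrite /scoord !mxE; case: a.2; [apply: (rsN q_pchar rsP)|]; exact: ssvalP. Qed.

Lemma card_odd_pts u J : u \in hyperoct n ->
  #|[set x in frob_pts u | vanishes J (pt x)]| =
  #|[set y in frob_fun q rs u | inv_fun (glue J) y && odd_fun (@sopp n) y]|.
Proof.
move=> /hyperoctP hu.
pose f (x : {ffun 'I_n -> E}) : {ffun W -> E} := [ffun a => toE (scoord (pt x) a)].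
have fE x a : ssval (f x a) = scoord (pt x) a by rewrite ffunE toEK // scoord_rs.
have fI : injective f.
  move=> x x' /ffunP ff; apply/ffunP => i; apply: ssval_inj.
  by have := congr1 (@ssval _ _) (ff (i, false)); rewrite !fE /scoord /= !mxE.
rewrite -(card_imset _ fI); apply: eq_card => y; apply/imsetP/idP.
  move=> [x + ->]; rewrite !inE => /andP [/forallP xf /vanishes_glue xJ].
  apply/and3P; split; first by apply/forallP => a; rewrite !fE.
    by apply/inv_funP => a b ab; apply: ssval_inj; rewrite !fE; exact: xJ.
  by apply/forallP => a; rewrite !fE scoord_sopp.
rewrite !inE => /and3P [/forallP yf /inv_funP yJ /forallP yo].
pose x : {ffun 'I_n -> E} := [ffun i => y (i, false)].
have xE a : scoord (pt x) a = ssval (y a).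
  case: a => i []; rewrite /scoord /= mxE ffunE //.
  by have /eqP := yo (i, true); rewrite /sopp /= => ->; rewrite opprK.
exists x; last by apply/ffunP => a; apply: ssval_inj; rewrite fE xE.
rewrite !inE; apply/andP; split; first by apply/forallP => a; rewrite !xE.
by apply/vanishes_glue => a b ab; rewrite !xE (yJ _ _ ab).
Qed.

Lemma iota_frob x : x ^+ q = x -> exists y, x = iota y.
Proof.
move=> xq; have := congr1 (fun P => (map_poly iota P).[x]) (finField_genPoly F).
rewrite /= rmorphB /= map_polyXn map_polyX !hornerE xq subrr.
rewrite rmorph_prod horner_prod => /esym/eqP; rewrite prodf_seq_eq0 => /hasP [y _ /=].
by rewrite rmorphB /= map_polyX map_polyC !hornerE subr_eq0 => /eqP ->; exists y.
Qed.

Lemma iota_rs y : iota y \in rs.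
Proof.
rewrite rsP -rmorphXn; apply/eqP; congr (iota _).
by elim: N => [|k IH]; rewrite ?expn0 ?expr1 // expnSr exprM IH expf_card.
Qed.

Lemma card_rational_pts J :
  #|[set x in frob_pts 1%g | vanishes J (pt x)]| = (q ^ (n - rkf F J))%N.
Proof.
pose f (z : 'rV[F]_n) : {ffun 'I_n -> E} := [ffun i => toE (iota (z 0 i))].
have fE z i : ssval (f z i) = iota (z 0 i) by rewrite ffunE toEK // iota_rs.
have fI : injective f.
  move=> z z' /ffunP ff; apply/rowP => i.
  by apply: (fmorph_inj iota); rewrite -!fE ff.
have fs z a : scoord (pt (f z)) a = iota (scoord z a).
  by rewrite /scoord mxE fE; case: a.2; rewrite ?rmorphN.
have fv z : vanishes J (pt (f z)) = vanishes J z.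
  by apply: eq_forallb_in => h _; rewrite !fs (inj_eq (fmorph_inj iota)).
have -> : (n - rkf F J = \rank (kermx (span F J)^T))%N by rewrite mxrank_ker mxrank_tr.
rewrite -mxabelem.card_rowg -(card_imset _ fI); apply: eq_card => x; apply/idP/imsetP.
  rewrite !inE => /andP [/forallP xf xJ].
  have xi i : exists y, ssval (x i) = iota y.
    by apply: iota_frob; have := xf (i, false); rewrite perm1 /scoord /= !mxE => /eqP.
  have [z zE] := fin_all_exists xi; exists (\row_i z i).
    rewrite inE sub_kermx span_vanishes -fv; suff <- : x = f (\row_i z i) by [].
    by apply/ffunP => i; apply: ssval_inj; rewrite fE mxE.
  by apply/ffunP => i; apply: ssval_inj; rewrite fE mxE.
move=> [z]; rewrite !inE sub_kermx span_vanishes => zJ ->; rewrite fv zJ andbT.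
by apply/forallP => a; rewrite perm1 fs -rmorphXn expf_card.
Qed.

Lemma card_frob_pts u (J : {set pair_idx n}) : u \in hyperoct n -> (forall w, iter N u w = w) ->
  pair_perm u @: J = J ->
  #|[set x in frob_pts u | vanishes J (pt x)]| = (q ^ (n - rkf F J))%N.
Proof.
move=> hu uN uJ; rewrite -card_rational_pts !card_odd_pts ?group1 //.
have co (s : {perm W}) : (forall w, iter N s w = w) -> s \in hyperoct n ->
    (forall a b, glue J (s a) (s b) = glue J a b) -> _ :=
  fun sN hs sJ => card_odd_fun q_gt1 q_pchar N_gt0 rsP L2 (@soppK n) (@glue_sym n J)
    (@glue_sopp n J) (@perm_inj _ s) sN sJ (hyperoctP _ hs).
have := co u uN hu (fun a b => glue_perm a b hu uJ).
rewrite -(co 1%g) ?group1 //.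
- by move=> /eqP; rewrite eqn_pmul2r ?expn_gt0 ?(ltnW q_gt1) // => /eqP.
- by move=> w; elim: N => //= k ->; rewrite perm1.
- by move=> a b; rewrite !perm1.
Qed.

Definition labels u := [set x in frob_pts u | injectiveb (scoord (pt x))].

Lemma card_labels (K : numFieldType) u : u \in hyperoct n -> (forall w, iter N u w = w) ->
  (#|labels u|)%:R = \sum_(J : {set pair_idx n} | pair_perm u^-1 @: J == J)
    (-1) ^+ #|J| * psgn K (pair_perm u^-1) J * q%:R ^+ (n - rkf F J).
Proof.
move=> hu uN; set p := pair_perm u^-1.
pose I x : {set pair_idx n} := [set h | scoord (pt x) (val h).1 == scoord (pt x) (val h).2].
have vI x J : vanishes J (pt x) = (J \subset I x).
  by apply/forall_inP/subsetP => H h /H; rewrite inE.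
have I0 x : injectiveb (scoord (pt x)) = (I x == set0).
  apply/injectiveP/eqP => [xi|x0 a b ab].
    by apply/setP => h; rewrite !inE; apply/negbTE; apply: contra (valP h) => /eqP/xi ->.
  apply/eqP/negPn/negP => nab.
  have : (Sub (a, b) nab : pair_idx n) \in I x by rewrite inE /= ab.
  by rewrite x0 inE.
have Ip x h : x \in frob_pts u -> (p h \in I x) = (h \in I x).
  rewrite inE => /forallP xf.
  have up k : (k \in I x) -> pair_perm u k \in I x.
    by rewrite !inE pair_permE /= -!(eqP (xf _)) => /eqP ->.
  have := @card_in_imset _ _ (pair_perm u) (I x) (fun _ _ _ _ => @perm_inj _ _ _ _).
  move=> cI; have uI : pair_perm u @: I x = I x.
    apply/eqP; rewrite eqEcard cI leqnn andbT; apply/subsetP => _ /imsetP [k kI ->].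
    exact: up.
  by rewrite -{1}(pair_perm_stableV uI) mem_imset //; exact: perm_inj.
have point x : x \in frob_pts u -> (injectiveb (scoord (pt x)))%:R =
    \sum_(J : {set pair_idx n} | (p @: J == J) && vanishes J (pt x)) (-1) ^+ #|J| * psgn K p J.
  move=> xu; rewrite I0; have [x0|/set0Pn [h hI]] := eqVneq (I x) set0.
    rewrite (bigD1 set0) /=; last by rewrite imset0 eqxx vI sub0set.
    rewrite cards0 psgn0 mulr1 big1 ?addr0 // => J; rewrite vI x0 subset0.
    by case/andP => /andP [_ ->].
  rewrite -[LHS](@stable_sum_eq0 K _ (powerset (I x)) p _ h).
  - by apply: eq_bigl => J; rewrite vI inE andbC.
  - move=> J; rewrite !inE; apply/subsetP/subsetP => JI k.
      by move=> kJ; rewrite -(Ip _ _ xu); apply: JI; exact: imset_f.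
    by case/imsetP => l /JI lI ->; rewrite Ip.
  - by move=> J hJ; rewrite !inE subUset sub1set hI.
transitivity (\sum_(x in frob_pts u) (injectiveb (scoord (pt x)))%:R : K).
  rewrite -sum1_card natr_sum big_mkcond [RHS]big_mkcond; apply: eq_bigr => x _.
  by rewrite inE; case: (x \in _) => //=; case: injectiveb.
rewrite (eq_bigr _ point) (exchange_big_dep (fun J : {set pair_idx n} => p @: J == J)) /=; last first.
  by move=> x J _ /andP [].
apply: eq_bigr => J /[dup] pJ /eqP /pair_perm_stableV; rewrite invgK => uJ.
rewrite -natrX -(card_frob_pts hu uN uJ) mulr_natr -sumr_const; apply: eq_bigl => x.
by rewrite inE pJ.
Qed.

End FixedPoints.

(** * Labellings of the roots *)

Definition frobq (L : closedFieldType) (q : nat) (_ : [pchar L].-nat q) (x : L) : L := x ^+ q.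

Section FrobqMorphism.
Variables (L : closedFieldType) (q : nat) (qp : [pchar L].-nat q).

Lemma frobq_zmod_morphism : zmod_morphism (frobq qp).
Proof.
move=> x y; rewrite /frobq; have := exprD_q qp 1 x (- y).
by rewrite (exprN_q qp) !expn1.
Qed.

Lemma frobq_monoid_morphism : monoid_morphism (frobq qp).
Proof. by split=> [|x y]; rewrite /frobq ?expr1n ?exprMn. Qed.

HB.instance Definition _ := GRing.isZmodMorphism.Build L L (frobq qp) frobq_zmod_morphism.
HB.instance Definition _ := GRing.isMonoidMorphism.Build L L (frobq qp) frobq_monoid_morphism.

End FrobqMorphism.

Section Separable.
Variables (F : finFieldType) (p k : nat).
Hypotheses (p_prime : prime p) (k_gt0 : (0 < k)%N) (card_F : #|F| = (p ^ k)%N).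

Lemma poly_pth_root (u : {poly F}) : u^`() = 0 -> exists v, u = v ^+ p.
Proof.
move=> u0; have chF : p \in [pchar F] := card_finPcharP card_F p_prime.
have chP : p \in [pchar {poly F}] by rewrite pchar_poly.
have p0 := prime_gt0 p_prime.
have uz j : ~~ (p %| j)%N -> u`_j = 0.
  case: j => [|j]; first by rewrite dvdn0.
  move=> pj; have := congr1 (fun w : {poly F} => w`_j) u0; rewrite coef_deriv coef0 => /eqP.
  by rewrite -mulr_natr mulf_eq0 -(dvdn_pcharf chF) (negPf pj) orbF => /eqP.
exists (\poly_(i < size u) u`_(i * p) ^+ (p ^ k.-1)).
rewrite -(pFrobenius_autE chP) poly_def rmorph_sum; apply/polyP => j.
rewrite coef_sum.
have E (i : 'I_(size u)) : (pFrobenius_aut chP (u`_(i * p) ^+ (p ^ k.-1) *: 'X^i))`_j =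
    u`_(i * p) * (j == i * p)%N%:R.
  rewrite pFrobenius_autE -mul_polyC exprMn -rmorphXn -!exprM coefCM coefXn.
  by rewrite -expnSr prednK // -card_F expf_card.
rewrite (eq_bigr _ (fun i _ => E i)).
have [pj|pj] := boolP (p %| j)%N; last first.
  rewrite uz // big1 // => i _; case: eqP => [ji|_]; last by rewrite mulr0.
  by rewrite ji dvdn_mull in pj.
have jE : j = (j %/ p * p)%N by rewrite divnK.
have [jl|jl] := ltnP (j %/ p) (size u); last first.
  rewrite nth_default ?big1 // => [i _|].
    case: eqP => [ji|_]; last by rewrite mulr0.
    by move: (ltn_ord i); rewrite ltnNge; move: jl; rewrite ji mulnK // => ->.
  by rewrite (leq_trans jl) // leq_div.
rewrite (bigD1 (Ordinal jl)) //= -jE eqxx mulr1 big1 ?addr0 // => i ij.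
case: eqP => [ji|_]; last by rewrite mulr0.
by case/eqP: ij; apply: val_inj; rewrite /= ji mulnK.
Qed.

Lemma squarefree_separable (f : {poly F}) : f != 0 -> squarefree_poly f -> separable_poly f.
Proof.
move=> f0 sf; apply/separable_polyP; split.
  apply/poly_square_freeP => u u1; apply/negP => /[dup] uf /sf; rewrite leq_eqVlt (negPf u1) ltnS /=.
  rewrite leqn0 size_poly_eq0 => /eqP u0; move: uf.
  by rewrite u0 expr0n dvd0p (negPf f0).
move=> u uf u1; apply/eqP => /poly_pth_root [v uv].
have /sf v1 : v ^+ 2 %| f.
  apply: dvdp_trans uf; rewrite uv -(subnK (prime_gt1 p_prime)) exprD; exact: dvdp_mulIr.
have [c vc] : exists c, v = c%:P by exists v`_0; exact: size1_polyC.
by move: u1; rewrite uv vc -rmorphXn ltnNge size_polyC_leq1.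
Qed.

End Separable.

Section Labels.
Variables (F : finFieldType) (L : closedFieldType) (iota : {rmorphism F -> L}).
Local Notation q := #|F|.
Hypothesis q_pchar : [pchar L].-nat q.
Hypothesis F2 : 2%:R != 0 :> F.
Variable n : nat.
Local Notation W := (signed_idx n).

Let q_gt1 : (1 < q)%N := finNzRing_gt1 F.

Definition is_label (f : {poly F}) (x : 'rV[L]_n) : bool :=
  injectiveb (scoord x) && (map_poly iota f == \prod_i ('X - (x 0 i ^+ 2)%:P)).

Lemma scoord_sq (x : 'rV[L]_n) a : scoord x a ^+ 2 = x 0 a.1 ^+ 2.
Proof. by rewrite /scoord; case: a.2; rewrite ?sqrrN. Qed.

Lemma sq_scoord (x : 'rV[L]_n) z i : z ^+ 2 = x 0 i ^+ 2 -> exists a, z = scoord x a.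
Proof.
move/eqP; rewrite eqf_sqr => /orP [] /eqP ->.
  by exists (i, false).
by exists (i, true).
Qed.

Lemma label_root f x z : is_label f x ->
  root (map_poly iota f) (z ^+ 2) <-> exists a, z = scoord x a.
Proof.
move=> /andP [_ /eqP ->]; rewrite /root horner_prod prodf_seq_eq0.
split=> [/hasP [i _ /=]|[a ->]].
  by rewrite !hornerE subr_eq0 => /eqP; exact: sq_scoord.
by apply/hasP; exists a.1; rewrite ?mem_index_enum //= !hornerE scoord_sq subrr.
Qed.

Lemma relabel (x y : 'rV[L]_n) : injective (scoord x) -> injective (scoord y) ->
  (forall a, exists b, scoord y a = scoord x b) ->
  exists s : 'B_n, forall a, scoord y a = scoord x (sgval s a).
Proof.
move=> xi yi /fin_all_exists [f fE].
have fI : injective f by move=> a b ab; apply: yi; rewrite !fE ab.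
have hf : perm fI \in hyperoct n.
  by apply/hyperoctP => a; rewrite !permE; apply: xi; rewrite scoord_sopp -!fE scoord_sopp.
by exists (Subg hf) => a; rewrite /= permE.
Qed.

Lemma root_frob (f : {poly F}) (z : L) :
  root (map_poly iota f) z -> root (map_poly iota f) (z ^+ q).
Proof.
have -> : map_poly iota f = map_poly (frobq q_pchar) (map_poly iota f).
  apply/polyP => i; rewrite !coef_map /= /frobq -rmorphXn; congr (iota _).
  by rewrite expf_card.
move=> /rootP zf; apply/rootP; rewrite -[z ^+ q]/(frobq q_pchar z) horner_map.
suff -> : (map_poly iota f).[z] = 0 by rewrite rmorph0.
rewrite -zf; congr (_.[z]).
apply/polyP => i; rewrite !coef_map /= /frobq -rmorphXn; congr (iota _).
by rewrite expf_card.
Qed.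

Lemma frob_inj : injective (fun z : L => z ^+ q).
Proof. by move=> z w; exact: (fmorph_inj (frobq q_pchar)). Qed.

Lemma label_frob f x : is_label f x ->
  exists s : 'B_n, forall a, scoord x a ^+ q = scoord x (sgval s a).
Proof.
move=> xf; have /andP [/injectiveP xi _] := xf.
pose y : 'rV[L]_n := \row_i x 0 i ^+ q.
have yE a : scoord y a = scoord x a ^+ q.
  by rewrite /scoord mxE; case: a.2; rewrite ?(frobN q_pchar).
have [||s sE] := @relabel x y xi.
- by move=> a b; rewrite !yE => /frob_inj /xi.
- move=> a; rewrite yE; apply/(label_root _ xf); rewrite -exprM mulnC exprM.
  by apply: root_frob; apply/(label_root _ xf); exists a.
by exists s => a; rewrite -yE.
Qed.

Lemma label_exists (f : {poly F}) : f \is monic -> size f = n.+1 -> separable_poly f ->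
  f.[0] != 0 -> exists x, is_label f x.
Proof.
move=> fm fs fsep f0; have [rs] := closed_field_poly_normal (map_poly iota f).
have /monicP -> : map_poly iota f \is monic by rewrite map_monic.
rewrite scale1r => fE.
have rsu : uniq rs by rewrite -separable_prod_XsubC -fE separable_map.
have rss : size rs = n.
  by have := size_prod_XsubC rs id; rewrite -fE size_map_poly fs => -[].
have [x xE] : exists x : 'rV[L]_n, forall i, x 0 i ^+ 2 = rs`_i.
  have sq (i : 'I_n) : exists z : L, z ^+ 2 = rs`_i.
    have [z] := @solve_monicpoly L 2 (fun j => if j == 0%N then rs`_i else 0) isT.
    by rewrite !big_ord_recl big_ord0 /= mul0r !addr0 expr0 mulr1 => zE; exists z.
  have [g gE] := fin_all_exists sq; exists (\row_i g i) => i.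
  by rewrite mxE gE.
have x0 i : x 0 i != 0.
  apply: contraNneq f0 => xi0; rewrite -(fmorph_eq0 iota) -horner_map rmorph0 fE.
  rewrite -[_.[0] == 0]/(root _ 0) root_prod_XsubC.
  have <- : rs`_i = 0 by rewrite -xE xi0 expr0n.
  by rewrite mem_nth // rss.
exists x; apply/andP; split.
  apply/injectiveP => a b ab.
  have ij : a.1 = b.1.
    have := congr1 (fun z => z ^+ 2) ab; rewrite /= !scoord_sq !xE => /eqP.
    by rewrite nth_uniq ?rss // => /eqP/val_inj.
  move: a b ij ab => [i c] [j d] /= ->.
  have xx : x 0 j != - x 0 j.
    by rewrite -subr_eq0 opprK -mulr2n -mulr_natl mulf_neq0 ?(L2 iota F2).
  by rewrite /scoord; case: c; case: d => //= /eqP; rewrite ?(negPf xx) // eq_sym (negPf xx).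
rewrite fE (big_nth 0) rss big_mkord; apply/eqP; apply: eq_bigr => i _.
by rewrite xE.
Qed.

Lemma label_poly x (u : {perm W}) : u \in hyperoct n -> injective (scoord x) ->
  (forall a, scoord x a ^+ q = scoord x (u a)) ->
  exists f : {poly F}, [/\ is_label f x, f \is monic, size f = n.+1,
    separable_poly f & f.[0] != 0].
Proof.
move=> /hyperoctP hu xi xu; pose P : {poly L} := \prod_i ('X - (x 0 i ^+ 2)%:P).
have sP : size P = n.+1.
  by rewrite size_prod_XsubC -[X in X.+1 = _]sum1_size sum1_card card_ord.
pose pi i := (u (i, false)).1.
have piI : injective pi.
  move=> i j; rewrite /pi => ij.
  have : u (i, false) = u (j, false) \/ u (i, false) = sopp (u (j, false)).
    case: (u (i, false)) (u (j, false)) ij => [a c] [b d] /= ->; rewrite /sopp /=.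
    by case: c; case: d; [left|right|right|left].
  by rewrite -hu => -[] /perm_inj [].
have fP : map_poly (frobq q_pchar) P = P.
  rewrite rmorph_prod /P [RHS](reindex_inj piI); apply: eq_bigr => i _.
  rewrite rmorphB /= map_polyX map_polyC /= /frobq; congr ('X - _%:P).
  by rewrite -exprM mulnC exprM -[x 0 i]/(scoord x (i, false)) xu scoord_sq.
have cP i : exists c, P`_i = iota c.
  by apply: iota_frob; rewrite -{2}fP coef_map.
have [g gE] := fin_all_exists (fun i : 'I_n.+1 => cP i).
pose f : {poly F} := \poly_(i < n.+1) g (inord i).
have fE : map_poly iota f = P.
  apply/polyP => i; rewrite coef_map coef_poly; case: ltnP => ni; last first.
    by rewrite nth_default ?sP //; exact: rmorph0.
  by rewrite /= -gE inordK.
have x0 i : x 0 i != 0.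
  apply/eqP => xi0; have : (i, false) = (i, true) :> W by apply: xi; rewrite /scoord /= xi0 oppr0.
  by [].
exists f; split.
- by rewrite /is_label fE eqxx andbT; apply/injectiveP.
- by rewrite -(map_monic iota) fE monic_prod // => i _; exact: monicXsubC.
- by rewrite -(size_map_poly iota) fE.
- rewrite -(separable_map iota) fE /P -(big_map (fun i => x 0 i ^+ 2) xpredT (fun z => 'X - z%:P)).
  rewrite separable_prod_XsubC map_inj_uniq ?index_enum_uniq // => i j /eqP.
  rewrite eqf_sqr => /orP [] /eqP ij.
    by have [] : (i, false) = (j, false) :> W by apply: xi.
  by have [] : (i, false) = (j, true) :> W by apply: xi.
rewrite -(fmorph_eq0 iota) -horner_map rmorph0 fE horner_prod; apply/prodf_neq0 => i _.
by rewrite !hornerE oppr_eq0 expf_neq0.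
Qed.

Variables (N : nat) (rs : seq L).
Hypothesis rsP : forall x, (x \in rs) = (x ^+ (q ^ N) == x).
Hypothesis iterN : forall (s : 'B_n) w, iter N (sgval s) w = w.
Local Notation E := (seq_sub rs).
Local Notation toE := (toE q_gt1 rsP).

Lemma label_rs f x a : is_label f x -> scoord x a \in rs.
Proof.
move=> /label_frob [s sE]; rewrite rsP -{2}(iterN s a); apply/eqP.
elim: N => [|m IH]; first by rewrite expn0 expr1.
by rewrite expnSr exprM IH sE.
Qed.

Lemma ptK (x : 'rV[L]_n) : (forall i, x 0 i \in rs) -> pt [ffun i => toE (x 0 i)] = x.
Proof. by move=> xr; apply/rowP => i; rewrite mxE ffunE toEK. Qed.

Lemma card_relabel f x0 : is_label f x0 ->
  #|[set x : {ffun 'I_n -> E} | is_label f (pt x)]| = #|{: 'B_n}|.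
Proof.
move=> fx0; have /andP [/injectiveP xi /eqP fE] := fx0.
pose y (b : 'B_n) : 'rV[L]_n := \row_i scoord x0 (sgval b (i, false)).
have yE b a : scoord (y b) a = scoord x0 (sgval b a).
  have /hyperoctP hb : sgval b \in hyperoct n := subgP b.
  case: a => i []; rewrite /scoord /= mxE // -/(scoord _ _) -[LHS]scoord_sopp.
  by rewrite -hb.
have yi b : injective (scoord (y b)) by move=> a a'; rewrite !yE => /xi /perm_inj.
have yr b i : y b 0 i \in rs by rewrite mxE (label_rs _ fx0).
pose f' (b : 'B_n) : {ffun 'I_n -> E} := [ffun i => toE (y b 0 i)].
have f'E b : pt (f' b) = y b by apply: ptK.
have f'I : injective f'.
  move=> b b' bb; apply: val_inj; apply/permP => a; apply: xi.
  by rewrite -!yE -!f'E bb.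
rewrite -(card_imset _ f'I); apply: eq_card => x; rewrite inE; apply/idP/imsetP.
  move=> fx; have /andP [/injectiveP ptxi _] := fx.
  have [a|b bE] := relabel xi ptxi.
    by apply/(label_root _ fx0)/(label_root _ fx); exists a.
  exists b => //; apply/ffunP => i; apply: ssval_inj.
  rewrite ffunE toEK // -[LHS]/(ssval (x i)).
  by have := bE (i, false); rewrite {1}/scoord !mxE.
move=> [b _ ->]; rewrite f'E; apply/andP; split; first exact/injectiveP.
have /hyperoctP hb : sgval b \in hyperoct n := subgP b.
rewrite fE; pose pi i := (sgval b (i, false)).1.
have piI : injective pi.
  move=> i j; rewrite /pi => ij.
  have : scoord x0 (sgval b (i, false)) ^+ 2 = scoord x0 (sgval b (j, false)) ^+ 2.
    by rewrite !scoord_sq ij.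
  move=> /eqP; rewrite -!yE eqf_sqr -[- _]scoord_sopp.
  by case/orP => /eqP /yi [].
rewrite (reindex_inj piI); apply/eqP; apply: eq_bigr => i _.
by rewrite mxE scoord_sq.
Qed.

End Labels.

From mathcomp Require Import all_classical all_reals all_analysis.
Import numFieldNormedType.Exports.

(** * Cochains on lists of points *)

Section ListCochains.
Variables (K : comNzRingType) (W : Type).
Implicit Types (c e : seq W -> K) (v w : seq W) (x : W).

Definition lcone x c : seq W -> K := fun u => c (x :: u).

Fixpoint lcob c w : K :=
  if w is x :: w' then c w' - lcob (lcone x c) w' else 0.

Lemma lcob_cons c x w : lcob c (x :: w) = c w - lcob (lcone x c) w.
Proof. by []. Qed.

Definition ldel i w := take i w ++ drop i.+1 w.

Lemma size_ldel i w : (i < size w)%N -> size (ldel i w) = (size w).-1.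
Proof.
move=> iw; rewrite size_cat size_drop size_take iw.
by rewrite subnS -subn1 addnBA ?subn_gt0 // subnKC 1?ltnW // subn1.
Qed.

Lemma lcobE c w : lcob c w = \sum_(i < size w) (-1) ^+ i * c (ldel i w).
Proof.
elim: w c => [|x w IH] c /=; first by rewrite big_ord0.
rewrite big_ord_recl /= expr0 mul1r /ldel /= drop0 IH -sumrN.
by congr (_ + _); apply: eq_bigr => i _; rewrite exprS !mulNr mul1r.
Qed.

Lemma lcob_local c e w :
  (forall i, (i < size w)%N -> c (ldel i w) = e (ldel i w)) ->
  lcob c w = lcob e w.
Proof. by move=> ce; rewrite !lcobE; apply: eq_bigr => i _; rewrite ce. Qed.

Lemma lcobD c e w : lcob (fun u => c u + e u) w = lcob c w + lcob e w.
Proof. by rewrite !lcobE -big_split; apply: eq_bigr => i _; rewrite /= mulrDr. Qed.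

Lemma lcobN c w : lcob (fun u => - c u) w = - lcob c w.
Proof. by rewrite !lcobE -sumrN; apply: eq_bigr => i _; rewrite mulrN. Qed.

Lemma lcobB c e w : lcob (fun u => c u - e u) w = lcob c w - lcob e w.
Proof. by rewrite lcobD lcobN. Qed.

Lemma lcob_lcone x c u : lcone x (lcob c) u = c u - lcob (lcone x c) u.
Proof. by []. Qed.

Lemma lcob_lcob c w : lcob (lcob c) w = 0.
Proof.
elim: w c => //= x w IH c.
rewrite (_ : lcone x (lcob c) = fun u => c u - lcob (lcone x c) u) //.
by rewrite lcobB IH subr0 subrr.
Qed.

Local Arguments lcob : simpl never.

Section Subdivision.
Variable b : seq W -> W.

(* Barycentric subdivision [sd w = b w * sd (d w)] and its homotopy to the
   identity [h w = b w * (w - h (d w))], dualized to cochains. *)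
Fixpoint lsd_rec m c w : K :=
  if m is m'.+1 then
    if w is [::] then c [::] else lcob (lsd_rec m' (lcone (b w) c)) w
  else c [::].

Definition lsd c w := lsd_rec (size w) c w.

Lemma lsdE c w : (0 < size w)%N -> lsd c w = lcob (lsd (lcone (b w) c)) w.
Proof.
case: w => // x w _; rewrite /lsd [LHS]/=.
by apply: lcob_local => i iw; rewrite size_ldel.
Qed.

Fixpoint lsdh_rec m c w : K :=
  if m is m'.+1 then
    if w is [::] then 0
    else lcone (b w) c w - lcob (lsdh_rec m' (lcone (b w) c)) w
  else 0.

Definition lsdh c w := lsdh_rec (size w) c w.

Lemma lsdhE c w : (0 < size w)%N ->
  lsdh c w = lcone (b w) c w - lcob (lsdh (lcone (b w) c)) w.
Proof.
case: w => // x w _; rewrite {1}/lsdh [LHS]/=; congr (_ - _).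
by apply: lcob_local => i iw; rewrite /lsdh size_ldel.
Qed.

Lemma lsd_ext c e w : c =1 e -> lsd c w = lsd e w.
Proof. by move=> /funext ->. Qed.

Lemma lsdB c e w : lsd (fun u => c u - e u) w = lsd c w - lsd e w.
Proof.
have [m] := ubnP (size w); elim: m w c e => // m IH [|x w] c e //.
rewrite ltnS => wm; rewrite !lsdE // -lcobB; apply: lcob_local => i iw.
by rewrite -IH // size_ldel // (leq_trans _ wm).
Qed.

Lemma lsdhB c e w : lsdh (fun u => c u - e u) w = lsdh c w - lsdh e w.
Proof.
have [m] := ubnP (size w); elim: m w c e => // m IH [|x w] c e.
  by rewrite subrr.
rewrite ltnS => wm; rewrite !lsdhE //.
set e1 := lcone _ (fun u => _); set e2 := lcone _ c; set e3 := lcone _ e.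
have -> : lcob (lsdh e1) (x :: w) = lcob (lsdh e2) (x :: w) - lcob (lsdh e3) (x :: w).
  rewrite -lcobB; apply: lcob_local => i iw.
  by rewrite -IH // size_ldel // (leq_trans _ wm).
rewrite {1}/e1 /lcone -/(lcone _ c (x :: w)) -/(lcone _ e (x :: w)) -/e2 -/e3; ring.
Qed.

Lemma lsd_lcob c w : lsd (lcob c) w = lcob (lsd c) w.
Proof.
have [m] := ubnP (size w); elim: m w c => // m IH [|x w] c //.
rewrite ltnS => wm; rewrite lsdE //.
transitivity (lcob (fun u => lsd c u - lcob (lsd (lcone (b (x :: w)) c)) u) (x :: w)).
  apply: lcob_local => i iw; rewrite -IH -?lsdB //.
  by rewrite size_ldel // (leq_trans _ wm).
by rewrite lcobB lcob_lcob subr0.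
Qed.

Lemma lsdh_lcob c w : lsdh (lcob c) w = c w - lsd c w - lcob (lsdh c) w.
Proof.
have [m] := ubnP (size w); elim: m w c => // m IH [|x w] c.
  by rewrite /= !subrr.
rewrite ltnS => wm; rewrite lsdhE // lcob_lcone.
set e := lcone _ _.
have -> : lcob (lsdh (lcone (b (x :: w)) (lcob c))) (x :: w) =
    lcob (lsdh c) (x :: w) - (lcob e (x :: w) - lcob (lsd e) (x :: w)).
  rewrite -!lcobB -[RHS]addr0 -(lcob_lcob (lsdh e) (x :: w)) -lcobD.
  apply: lcob_local => i iw.
  transitivity (lsdh c (ldel i (x :: w)) - lsdh (lcob e) (ldel i (x :: w))).
    by rewrite -lsdhB.
  rewrite IH ?size_ldel // ?(leq_trans _ wm) //.
  by ring.
rewrite -lsdE //; ring.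
Qed.

Inductive sd_piece : seq W -> seq W -> Prop :=
| sd_piece_nil : sd_piece [::] [::]
| sd_piece_cons i v w : (i < size v)%N -> sd_piece (ldel i v) w ->
    sd_piece v (b v :: w).

Inductive sdh_piece : seq W -> seq W -> Prop :=
| sdh_piece_cone v : (0 < size v)%N -> sdh_piece v (b v :: v)
| sdh_piece_cons i v w : (i < size v)%N -> sdh_piece (ldel i v) w ->
    sdh_piece v (b v :: w).

Lemma lsd_local c e w : (forall u, sd_piece w u -> c u = e u) ->
  lsd c w = lsd e w.
Proof.
have [m] := ubnP (size w); elim: m w c e => // m IH [|x w] c e.
  by move=> _ ce; rewrite /lsd /=; apply: ce; constructor.
rewrite ltnS => wm ce; rewrite !lsdE //; apply: lcob_local => i iw.
apply: IH => [|u iu]; first by rewrite size_ldel // (leq_trans _ wm).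
by apply: ce; apply: sd_piece_cons iu.
Qed.

Lemma lsdh_local c e w : (forall u, sdh_piece w u -> c u = e u) ->
  lsdh c w = lsdh e w.
Proof.
have [m] := ubnP (size w); elim: m w c e => // m IH [|x w] c e.
  by move=> _ ce; rewrite /lsdh /=.
rewrite ltnS => wm ce; rewrite !lsdhE //; congr (_ - _).
  by apply: ce; constructor.
apply: lcob_local => i iw.
apply: IH => [|u iu]; first by rewrite size_ldel // (leq_trans _ wm).
by apply: ce; apply: sdh_piece_cons iu.
Qed.

End Subdivision.
End ListCochains.
Arguments lcob : simpl never.

Section ListMaps.
Variables (K : comNzRingType) (W W' : Type).

Lemma map_ldel (h : W -> W') i w : map h (ldel i w) = ldel i (map h w).
Proof. by rewrite /ldel map_cat map_take map_drop. Qed.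

Lemma lcob_map (h : W -> W') (c : seq W' -> K) w :
  lcob (c \o map h) w = lcob c (map h w).
Proof.
by rewrite !lcobE size_map; apply: eq_bigr => i _; rewrite /= map_ldel.
Qed.

Section Nat.
Variables (h : W -> W') (b : seq W -> W) (b' : seq W' -> W').
Hypothesis bh : forall w, b' (map h w) = h (b w).

Lemma lsd_map (c : seq W' -> K) w : lsd b (c \o map h) w = lsd b' c (map h w).
Proof.
have [m] := ubnP (size w); elim: m w c => // m IH [|x w] c //.
rewrite ltnS => wm; rewrite !lsdE // -lcob_map; apply: lcob_local => i iw /=.
rewrite -IH; last by rewrite size_ldel // (leq_trans _ wm).
by apply: lsd_ext => u; rewrite /lcone /= -bh.
Qed.

Lemma lsdh_map (c : seq W' -> K) w :
  lsdh b (c \o map h) w = lsdh b' c (map h w).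
Proof.
have [m] := ubnP (size w); elim: m w c => // m IH [|x w] c //.
rewrite ltnS => wm; rewrite !lsdhE //; congr (_ - _).
  by rewrite /lcone /= -bh.
rewrite -lcob_map; apply: lcob_local => i iw /=.
rewrite -IH; last by rewrite size_ldel // (leq_trans _ wm).
by congr lsdh; apply/funext => u; rewrite /lcone /= -bh.
Qed.
End Nat.

Section Prism.
Variables f0 f1 : W -> W'.

Fixpoint lprism (c : seq W' -> K) (w : seq W) : K :=
  if w is x :: w' then
    c (f0 x :: f1 x :: map f1 w') - lprism (lcone (f0 x) c) w'
  else 0.

Lemma lprismB c e w :
  lprism (fun u => c u - e u) w = lprism c w - lprism e w.
Proof.
elim: w c e => [|x w IH] c e /=; first by rewrite subrr.
rewrite (_ : lcone (f0 x) _ = fun u => lcone (f0 x) c u - lcone (f0 x) e u) //.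
by rewrite IH; ring.
Qed.

Lemma lprism_lcob c w :
  lprism (lcob c) w = c (map f1 w) - c (map f0 w) - lcob (lprism c) w.
Proof.
elim: w c => [|x w IH] c; first by rewrite /lcob /= !subrr.
have -> : lcob (lprism c) (x :: w) = lprism c w -
    (lcob (lcone (f1 x) (lcone (f0 x) c)) (map f1 w) - lcob (lprism (lcone (f0 x) c)) w).
  by rewrite lcob_cons -lcob_map -lcobB.
have -> : lprism (lcob c) (x :: w) = lcob c (f0 x :: f1 x :: map f1 w)
    - (lprism c w - lprism (lcob (lcone (f0 x) c)) w) by rewrite -lprismB.
by rewrite !lcob_cons IH /lcone /=; ring.
Qed.
End Prism.
End ListMaps.

(** * Affine simplices *)

Section ContinuousArith.
Variables (K : numFieldType) (T : topologicalType).
Implicit Types f g : T -> K.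

Lemma ctsD f g : continuous f -> continuous g -> continuous (fun x => f x + g x).
Proof. by move=> cf cg x; exact: (continuousD (cf x) (cg x)). Qed.

Lemma ctsB f g : continuous f -> continuous g -> continuous (fun x => f x - g x).
Proof. by move=> cf cg x; exact: (continuousB (cf x) (cg x)). Qed.

Lemma ctsM f g : continuous f -> continuous g -> continuous (fun x => f x * g x).
Proof. by move=> cf cg x; exact: (continuousM (cf x) (cg x)). Qed.

Lemma ctsV f : (forall x, f x != 0) -> continuous f ->
  continuous (fun x => (f x)^-1).
Proof. by move=> f0 cf x; exact: (continuousV (f0 x) (cf x)). Qed.

Lemma cts_cst (a : K) : continuous (fun _ : T => a).
Proof. by move=> x; exact: cst_continuous. Qed.

Lemma cts_norm f : continuous f -> continuous (fun x => `|f x|).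
Proof. by move=> cf x; exact: (continuous_comp (cf x) (@norm_continuous _ K _)). Qed.

Lemma continuous_sum (I : finType) (f : I -> T -> K) :
  (forall i, continuous (f i)) -> continuous (fun x => \sum_i f i x).
Proof.
by move=> fc; apply: continuous_big => [|i _]; [exact: add_continuous|exact: fc].
Qed.

End ContinuousArith.

Section Affine.
Variable R : realType.

Lemma sum_const_seq (V : lmodType R) (T : Type) (w : seq T) (x : V) :
  \sum_(i <- w) x = (size w)%:R *: x.
Proof. by rewrite scaler_nat big_const_seq count_predT iter_addr_0. Qed.

Definition vmx N d (w : seq 'rV[R]_N) : 'M[R]_(d.+1, N) :=
  \matrix_(i < d.+1) nth 0 w i.

Lemma mulmxr_continuous m N (A : 'M[R]_(m, N)) :
  continuous (mulmxr A : 'rV[R]_m -> 'rV[R]_N).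
Proof.
apply: mx_continuous => i j.
rewrite (_ : (fun x => _) = fun x : 'rV[R]_m => \sum_k x i k * A k j); last first.
  by apply/funext => x; rewrite /= mxE.
apply: continuous_sum => k; apply: ctsM; last exact: cts_cst.
exact: (@coord_continuous R).
Qed.

HB.instance Definition _ m N (A : 'M[R]_(m, N)) :=
  isContinuous.Build _ _ (mulmxr A : 'rV[R]_m -> 'rV[R]_N)
    (@mulmxr_continuous m N A).

Definition ret_row d (t : 'rV[R]_d.+1) : 'rV[R]_d.+1 :=
  let s := \sum_j `|t 0 j| in
  \row_i ((`|t 0 i| + (i == 0)%:R * `|1 - s|) / (s + `|1 - s|)).

Lemma ret_row_den d (t : 'rV[R]_d.+1) :
  0 < \sum_j `|t 0 j| + `|1 - \sum_j `|t 0 j| |.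
Proof.
apply: lt_le_trans (ltr01) _; rewrite -lerBlDl; exact: ler_norm.
Qed.

Lemma ret_row_in d (t : 'rV[R]_d.+1) : ret_row t \in stdsimplex R d.
Proof.
apply/mem_set; split=> [i|].
  rewrite mxE divr_ge0 // ?ltW ?ret_row_den // addr_ge0 // mulr_ge0 //.
transitivity ((\sum_i (`|t 0 i| + (i == 0)%:R * `|1 - \sum_j `|t 0 j| |)) /
   (\sum_j `|t 0 j| + `|1 - \sum_j `|t 0 j| |)).
  by rewrite mulr_suml; apply: eq_bigr => i _; rewrite mxE.
rewrite big_split /= -mulr_suml.
rewrite (_ : \sum_i (i == 0)%:R = 1 :> R) ?mul1r ?divff ?gt_eqF ?ret_row_den //.
rewrite (bigD1 0) //= big1 ?addr0 // => i /negPf -> //.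
Qed.

Lemma ret_row_id d (t : 'rV[R]_d.+1) : stdsimplex R d t -> ret_row t = t.
Proof.
move=> [t0 t1]; apply/rowP => i; rewrite mxE.
have -> : \sum_j `|t 0 j| = 1.
  by rewrite -[RHS]t1; apply: eq_bigr => j _; rewrite ger0_norm.
by rewrite subrr normr0 mulr0 !addr0 divr1 ger0_norm.
Qed.

Definition ret d (t : 'rV[R]_d.+1) : stdsimplex R d :=
  exist (fun u => u \in stdsimplex R d) _ (ret_row_in t).

Lemma set_val_ret d (t : 'rV[R]_d.+1) : set_val (ret t) = ret_row t.
Proof. by []. Qed.

Lemma ret_continuous d : continuous (@ret d).
Proof.
apply: continuous_comp_initial; apply: mx_continuous => k i.
have cn (j : 'I_d.+1) : continuous (fun t : 'rV[R]_d.+1 => `|t 0 j| : R).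
  by apply: cts_norm; exact: (@coord_continuous R).
have cs : continuous (fun t : 'rV[R]_d.+1 => \sum_j `|t 0 j| : R).
  exact: continuous_sum.
have c1 : continuous (fun t : 'rV[R]_d.+1 => `|1 - \sum_j `|t 0 j| | : R).
  by apply: cts_norm; apply: ctsB => //; exact: cts_cst.
rewrite (_ : (fun x => _) = fun t : 'rV[R]_d.+1 =>
  (`|t 0 i| + (i == 0)%:R * `|1 - \sum_j `|t 0 j| |) /
  (\sum_j `|t 0 j| + `|1 - \sum_j `|t 0 j| |)); last first.
  by apply/funext => t; rewrite /= mxE.
apply: ctsM; first by apply: ctsD => //; apply: ctsM => //; exact: cts_cst.
by apply: ctsV => [t|]; [rewrite gt_eqF // ret_row_den|exact: ctsD].
Qed.

HB.instance Definition _ d := isContinuous.Build _ _ (@ret d) (@ret_continuous d).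

Lemma set_val_simplex_continuous d :
  continuous (set_val : stdsimplex R d -> 'rV[R]_d.+1).
Proof. exact: initial_continuous. Qed.

Definition sval_simplex d (t : stdsimplex R d) : 'rV[R]_d.+1 := set_val t.

HB.instance Definition _ d :=
  isContinuous.Build _ _ (@sval_simplex d) (@set_val_simplex_continuous d).

Lemma ret_sval d (t : stdsimplex R d) : ret (sval_simplex t) = t.
Proof.
apply/val_inj; rewrite /= ret_row_id //.
by case: t => t tP; exact: (set_mem tP).
Qed.

Definition std_vertices d : seq 'rV[R]_d.+1 :=
  [seq delta_mx 0 i | i <- enum 'I_d.+1].

Lemma size_std_vertices d : size (std_vertices d) = d.+1.
Proof. by rewrite size_map size_enum_ord. Qed.

Lemma nth_std_vertices d (i : 'I_d.+1) : nth 0 (std_vertices d) i = delta_mx 0 i.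
Proof. by rewrite (nth_map i) ?size_enum_ord // nth_ord_enum. Qed.

Lemma vmx_std d : vmx d (std_vertices d) = 1%:M.
Proof. by apply/row_matrixP => i; rewrite rowK nth_std_vertices rowE mulmx1. Qed.

Definition bary N (w : seq 'rV[R]_N) : 'rV[R]_N :=
  (size w)%:R^-1 *: \sum_(x <- w) x.

Lemma bary_map N N' (A : 'M[R]_(N, N')) w :
  bary (map (mulmxr A) w) = mulmxr A (bary w).
Proof.
rewrite /bary size_map /= big_map -scalemxAl; congr (_ *: _).
by rewrite mulmx_suml.
Qed.

Definition bary_closed N (C : set 'rV[R]_N) :=
  forall w, (0 < size w)%N -> (forall x, x \in w -> C x) -> C (bary w).

Lemma stdsimplex_bary d : bary_closed (stdsimplex R d).
Proof.
move=> w w0 wC; split=> [i|].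
  rewrite mxE mulr_ge0 ?invr_ge0 // summxE big_seq sumr_ge0 // => x /wC [+ _].
  exact.
have E x : \sum_i (x : 'rV[R]_d.+1) 0 i = (x *m const_mx 1 : 'rV_1) 0 0.
  by rewrite mxE; apply: eq_bigr => i _; rewrite mxE mulr1.
rewrite E -scalemxAl mxE mulmx_suml summxE.
under eq_big_seq => x xw do rewrite -E (proj2 (wC _ xw)).
rewrite big_const_seq count_predT iter_addr_0 -mulr_natr mul1r mulVf //.
by rewrite pnatr_eq0 -lt0n.
Qed.

Lemma ball_bary N (b : 'rV[R]_N) r : bary_closed [set x | `|x - b| <= r]%classic.
Proof.
move=> w w0 wC /=.
have s0 : (size w)%:R != 0 :> R by rewrite pnatr_eq0 -lt0n.
have -> : bary w - b = (size w)%:R^-1 *: \sum_(x <- w) (x - b).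
  rewrite big_split /= scalerDr; congr (_ + _).
  rewrite sum_const_seq scalerA mulVf //.
  by rewrite scale1r.
rewrite normrZ ger0_norm ?invr_ge0 // ler_pdivrMl ?ltr0n //.
apply: le_trans (ler_norm_sum _ _ _) _.
rewrite mulr_natl -(scaler_nat _ (r : R^o)) -sum_const_seq.
by rewrite big_seq [leRHS]big_seq; apply: ler_sum => x /wC.
Qed.

Lemma mem_ldel N i (w : seq 'rV[R]_N) x : x \in ldel i w -> x \in w.
Proof. by rewrite mem_cat => /orP [/mem_take|/mem_drop]. Qed.

Lemma nth_ldel N i (w : seq 'rV[R]_N) k : (i < size w)%N ->
  nth 0 (ldel i w) k = nth 0 w (bump i k).
Proof.
move=> iw; rewrite nth_cat size_take iw; case: ltnP => ki.
  by rewrite nth_take // /bump leqNgt ki.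
by rewrite nth_drop /bump ki addSn subnKC.
Qed.

Lemma sd_piece_bary N (C : set 'rV[R]_N) v w : bary_closed C ->
  sd_piece (@bary N) v w -> (forall x, x \in v -> C x) ->
  forall x, x \in w -> C x.
Proof.
move=> bC; elim => // i {}v {}w iv _ IH vC x; rewrite inE => /orP [/eqP ->|].
  by apply: bC => //; case: v iv {vC IH}.
by apply: IH => y /mem_ldel; exact: vC.
Qed.

Lemma sdh_piece_bary N (C : set 'rV[R]_N) v w : bary_closed C ->
  sdh_piece (@bary N) v w -> (forall x, x \in v -> C x) ->
  forall x, x \in w -> C x.
Proof.
move=> bC; elim => [{}v v0 vC x|i {}v {}w iv _ IH vC x]; rewrite inE => /orP [/eqP ->|].
- exact: bC.
- exact: vC.
- by apply: bC => //; case: v iv {vC IH}.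
by apply: IH => y /mem_ldel; exact: vC.
Qed.

Lemma size_sd_piece N (v w : seq 'rV[R]_N) : sd_piece (@bary N) v w -> size w = size v.
Proof.
elim=> // i {}v {}w iv _ /= ->.
by rewrite size_ldel // prednK //; case: v iv.
Qed.

Lemma size_sdh_piece N (v w : seq 'rV[R]_N) :
  sdh_piece (@bary N) v w -> size w = (size v).+1.
Proof.
elim=> // i {}v {}w iv _ /= ->.
by rewrite size_ldel // prednK //; case: v iv.
Qed.

Definition mesh N (r : R) (w : seq 'rV[R]_N) :=
  forall x y, x \in w -> y \in w -> `|x - y| <= r.

Lemma bary_dist N (w : seq 'rV[R]_N) r D x : (size w <= D)%N ->
  mesh r w -> x \in w -> `|bary w - x| <= (1 - D%:R^-1) * r.
Proof.
move=> wD wr xw.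
have w0 : (0 < size w)%N by case: w xw {wD wr}.
have r0 : 0 <= r by have := wr _ _ xw xw; rewrite subrr normr0.
have s0 : (size w)%:R != 0 :> R by rewrite pnatr_eq0 -lt0n.
have -> : bary w - x = (size w)%:R^-1 *: \sum_(y <- rem x w) (y - x).
  rewrite -[\sum_(y <- _) _]add0r -{1}(subrr x).
  rewrite -(big_cons _ _ _ _ xpredT (fun y => y - x)) -(perm_big _ (perm_to_rem xw)).
  rewrite big_split /= scalerDr; congr (_ + _).
  rewrite sum_const_seq scalerA mulVf //.
  by rewrite scale1r.
rewrite normrZ ger0_norm ?invr_ge0 //.
apply: (@le_trans _ _ ((size w)%:R^-1 * ((size w).-1%:R * r))).
  rewrite ler_wpM2l ?invr_ge0 //.
  apply: le_trans (ler_norm_sum _ _ _) _.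
  rewrite -(size_rem xw) mulr_natl -(scaler_nat _ (r : R^o)) -sum_const_seq.
  by rewrite big_seq [leRHS]big_seq; apply: ler_sum => y /mem_rem yw; exact: wr.
rewrite mulrA ler_wpM2r // -subn1 natrB // mulrBr mulVf // mulr1 lerD2l lerN2.
by rewrite lef_pV2 ?ler_nat // posrE ltr0n // (leq_trans w0).
Qed.

Lemma sd_piece_mesh N (v w : seq 'rV[R]_N) r D : (size v <= D)%N ->
  mesh r v -> sd_piece (@bary N) v w -> mesh ((1 - D%:R^-1) * r) w.
Proof.
move=> vD vr vw; elim: vw vD vr => {v w} [//|i v w iv vw IH] vD vr.
have v0 : (0 < size v)%N by case: v iv {vw IH vD vr}.
have mw : mesh ((1 - D%:R^-1) * r) w.
  apply: IH => [|x y /mem_ldel xv /mem_ldel yv]; last exact: vr.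
  by rewrite size_ldel // (leq_trans _ vD) // leq_pred.
have bw x : x \in w -> `|x - bary v| <= (1 - D%:R^-1) * r.
  have := sd_piece_bary (@ball_bary _ (bary v) ((1 - D%:R^-1) * r)) vw; apply.
  by move=> y /mem_ldel yv /=; rewrite distrC; apply: bary_dist.
have : 0 <= (1 - D%:R^-1) * r.
  have [x xv] : exists x, x \in v by case: (v) v0 => // x v' _; exists x; rewrite mem_head.
  exact: le_trans (bary_dist vD vr xv).
move=> r0 x y; rewrite !inE => /orP [/eqP ->|xw] /orP [/eqP ->|yw].
- by rewrite subrr normr0.
- by rewrite distrC bw.
- exact: bw.
- exact: mw.
Qed.

End Affine.

(** * Singular cochains *)

Section SingularChains.
Variables (R : realType) (X : topologicalType).

(* Augmented singular simplices: [None] is the empty simplex, of dimension -1. *)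
Definition simp : Type := option {d : nat & sing_simplex R X d}.

Definition ssize (x : simp) : nat := if x is Some y then (projT1 y).+1 else 0.

Definition simage (x : simp) : set X :=
  (if x is Some y then range (projT2 y) else set0)%classic.

Definition simp_of d (s : sing_simplex R X d) : simp := Some (existT _ d s).

Definition in_open (U : set X) : set simp := [set x | (simage x `<=` U)%classic]%classic.

Section Coboundary.
Variable K : comNzRingType.
Implicit Types c e : simp -> K.

Definition cob c (x : simp) : K :=
  match x with
  | None => 0
  | Some (existT d s) =>
      match d return sing_simplex R X d -> K with
      | 0 => fun=> c None
      | d'.+1 => fun s => \sum_(i < d'.+2) (-1) ^+ i * c (simp_of (face i s))
      end s
  end.

End Coboundary.

Definition is_face (x y : simp) : Prop :=
  match x with
  | None => False
  | Some (existT d s) =>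
      match d return sing_simplex R X d -> Prop with
      | 0 => fun=> y = None
      | d'.+1 => fun s => exists i : 'I_d'.+2, y = simp_of (face i s)
      end s
  end.

Lemma is_face_size x y : is_face x y -> ssize x = (ssize y).+1.
Proof. by case: x => // -[[|d] s] /= => [->|[i ->]]. Qed.

Lemma is_face_image x y : is_face x y -> (simage y `<=` simage x)%classic.
Proof.
case: x => // -[[|d] s] /= => [-> //|[i ->]] z /= [t _ <-].
by exists (coface i t).
Qed.

Lemma in_open_face U x y : is_face x y -> in_open U x -> in_open U y.
Proof. by move=> /is_face_image yx xU; apply: subset_trans yx xU. Qed.

Section CoboundaryTheory.
Variable K : comNzRingType.
Implicit Types c e : simp -> K.

Lemma cob_local c e x : (forall y, is_face x y -> c y = e y) -> cob c x = cob e x.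
Proof.
case: x => // -[[|d] s] /= ce; first exact: ce.
by apply: eq_bigr => i _; rewrite ce //; exists i.
Qed.

Lemma cobD c e x : cob (fun y => c y + e y) x = cob c x + cob e x.
Proof.
case: x => [[[|d] s]|] //=; last by rewrite addr0.
by rewrite -big_split; apply: eq_bigr => i _; rewrite mulrDr.
Qed.

Lemma cobZ a c x : cob (fun y => a * c y) x = a * cob c x.
Proof.
case: x => [[[|d] s]|] //=; last by rewrite mulr0.
by rewrite mulr_sumr; apply: eq_bigr => i _; rewrite mulrCA.
Qed.

Lemma cobN c x : cob (fun y => - c y) x = - cob c x.
Proof.
rewrite -mulN1r -cobZ; apply: cob_local => y _; exact: esym (mulN1r _).
Qed.

Lemma cobB c e x : cob (fun y => c y - e y) x = cob c x - cob e x.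
Proof. by rewrite cobD cobN. Qed.

Lemma cob0 x : cob (fun=> 0 : K) x = 0.
Proof.
case: x => [[[|d] s]|] //=.
by rewrite big1 // => i _; rewrite mulr0.
Qed.

Lemma cob_sum I (r : seq I) (P : pred I) (c : I -> simp -> K) x :
  cob (fun y => \sum_(i <- r | P i) c i y) x = \sum_(i <- r | P i) cob (c i) x.
Proof.
elim: r => [|i r IH].
  by rewrite big_nil -[RHS](cob0 x); apply: cob_local => y _; rewrite big_nil.
rewrite big_cons -IH.
case: ifP => Pi; last by apply: cob_local => y _; rewrite big_cons Pi.
by rewrite -cobD; apply: cob_local => y _; rewrite big_cons Pi.
Qed.

End CoboundaryTheory.

Section Realize.
Variable N : nat.
Implicit Types (F : continuousType 'rV[R]_N X) (w : seq 'rV[R]_N).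

Definition aff_sing F d w : sing_simplex R X d :=
  F \o (mulmxr (vmx d w) \o @sval_simplex R d).

Definition aff_simp F w : simp :=
  if size w is d.+1 then simp_of (aff_sing F d w) else None.

Lemma face_aff F d w (i : 'I_d.+2) : size w = d.+2 ->
  face i (aff_sing F d.+1 w) = aff_sing F d (ldel i w).
Proof.
move=> wd; apply/continuousEP => t; rewrite /= /face /=.
congr (F _); apply/rowP => j; rewrite !mxE (bigD1_ord i) //= !mxE unlift_none mul0r add0r.
apply: eq_bigr => k _; rewrite !mxE liftK /=.
by rewrite nth_ldel // wd.
Qed.

Lemma cob_aff (K : comNzRingType) (c : simp -> K) F w :
  cob c (aff_simp F w) = lcob (c \o aff_simp F) w.
Proof.
rewrite lcobE {1}/aff_simp.
have [d wd] : exists d, d = size w by exists (size w).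
rewrite -wd; case: d wd => [|[|d]] wd /=; first by rewrite big_ord0.
  rewrite big_ord1 expr0 mul1r /aff_simp size_ldel -?wd //=.
apply: eq_bigr => i _; congr (_ * c _).
by rewrite /aff_simp size_ldel -wd //= face_aff -?wd.
Qed.

Lemma eq_aff_simp F (F' : continuousType 'rV[R]_N X) w (C : set 'rV[R]_N) :
  (forall d (t : 'rV[R]_d.+1), stdsimplex R d t -> d.+1 = size w ->
     F (t *m vmx d w) = F' (t *m vmx d w)) ->
  aff_simp F w = aff_simp F' w.
Proof.
move=> FF'; rewrite /aff_simp.
have [d wd] : exists d, d = size w by exists (size w).
rewrite -wd; case: d wd => [|d] wd //; congr simp_of; apply/continuousEP => t.
by apply: FF' => //; case: t => t tP; exact: (set_mem tP).
Qed.

End Realize.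

Lemma aff_simp_map N N' (F : continuousType 'rV[R]_N' X) (A : 'M[R]_(N, N')) w :
  aff_simp F (map (mulmxr A) w) = aff_simp (F \o mulmxr A) w.
Proof.
rewrite /aff_simp size_map.
have [d wd] : exists d, d = size w by exists (size w).
rewrite -wd; case: d wd => [|d] wd //; congr simp_of; apply/continuousEP => t /=.
congr (F _); rewrite -mulmxA; congr (_ *m _); apply/row_matrixP => i.
by rewrite row_mul !rowK (nth_map 0) // -wd.
Qed.

Lemma aff_simp_std d (s : sing_simplex R X d) :
  aff_simp (s \o @ret R d) (std_vertices R d) = simp_of s.
Proof.
rewrite /aff_simp size_std_vertices; congr simp_of; apply/continuousEP => t /=.
by rewrite vmx_std mulmx1 ret_sval.
Qed.

Lemma stdsimplex_vmx N d (t : 'rV[R]_d.+1) (C : set 'rV[R]_N) w :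
  (forall (t : 'rV[R]_d.+1) (f : 'I_d.+1 -> 'rV[R]_N), stdsimplex R d t ->
     (forall i, C (f i)) -> C (\sum_i t 0 i *: f i)) ->
  stdsimplex R d t -> size w = d.+1 -> (forall x, x \in w -> C x) ->
  C (t *m vmx d w).
Proof.
move=> cC td wd wC; rewrite mulmx_sum_row; apply: cC => // i.
by rewrite rowK; apply: wC; rewrite mem_nth ?wd.
Qed.

Lemma convex_stdsimplex m d (t : 'rV[R]_d.+1) (f : 'I_d.+1 -> 'rV[R]_m.+1) :
  stdsimplex R d t -> (forall i, stdsimplex R m (f i)) ->
  stdsimplex R m (\sum_i t 0 i *: f i).
Proof.
move=> [t0 t1] fC; split=> [j|].
  rewrite summxE sumr_ge0 // => i _; rewrite mxE mulr_ge0 //.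
  by case: (fC i) => + _; apply.
under eq_bigr => j _ do rewrite summxE.
rewrite exchange_big -[RHS]t1; apply: eq_bigr => i _ /=.
under eq_bigr => j _ do rewrite mxE.
by rewrite -mulr_sumr (proj2 (fC i)) mulr1.
Qed.

Lemma convex_ball N (b : 'rV[R]_N) r d (t : 'rV[R]_d.+1) (f : 'I_d.+1 -> 'rV[R]_N) :
  stdsimplex R d t -> (forall i, `|f i - b| <= r) ->
  `|\sum_i t 0 i *: f i - b| <= r.
Proof.
move=> [t0 t1] fC.
have -> : \sum_i t 0 i *: f i - b = \sum_i t 0 i *: (f i - b).
  under [RHS]eq_bigr => i _ do rewrite scalerBr.
  by rewrite sumrB -scaler_suml t1 scale1r.
apply: le_trans (ler_norm_sum _ _ _) _.
rewrite -[leRHS]mul1r -t1 mulr_suml; apply: ler_sum => i _.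
by rewrite normrZ ger0_norm // ler_wpM2l.
Qed.

Lemma aff_ret N (F : continuousType 'rV[R]_N X) d w u :
  (forall x, x \in u -> stdsimplex R d x) ->
  aff_simp (aff_sing F d w \o @ret R d) u = aff_simp F (map (mulmxr (vmx d w)) u).
Proof.
move=> uC; rewrite aff_simp_map; apply: eq_aff_simp setT _ => m t tm mu /=.
congr (F (_ *m _)); rewrite /sval_simplex set_val_ret ret_row_id //.
by apply: stdsimplex_vmx => // t' f tS fS; exact: convex_stdsimplex.
Qed.

(* [O] is an operator on cochains on lists of points which is natural for
   linear maps and only involves points of the convex hull. *)
Section Lift.
Variable K : comNzRingType.
Variable O : forall N, (seq 'rV[R]_N -> K) -> seq 'rV[R]_N -> K.
Arguments O : clear implicits.

Definition lift_op (c : simp -> K) (x : simp) : K :=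
  match x with
  | None => O 0 (fun=> c None) [::]
  | Some (existT d s) => O d.+1 (c \o aff_simp (s \o @ret R d)) (std_vertices R d)
  end.

Hypothesis O_map : forall N N' (A : 'M[R]_(N, N')) c w,
  O N (c \o map (mulmxr A)) w = O N' c (map (mulmxr A) w).
Hypothesis O_local : forall N (C : set 'rV[R]_N) c e w, bary_closed C ->
  (forall x, x \in w -> C x) ->
  (forall u, (forall x, x \in u -> C x) -> c u = e u) -> O N c w = O N e w.

Lemma lift_op_aff (c : simp -> K) N (F : continuousType 'rV[R]_N X) w :
  lift_op c (aff_simp F w) = O N (c \o aff_simp F) w.
Proof.
have [d wd] : exists d, d = size w by exists (size w).
rewrite {1}/aff_simp -wd; case: d wd => [|d] wd /=.
  case: w wd => // _.
  have -> : [::] = map (mulmxr (0 : 'M[R]_(0, N))) [::] by [].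
  rewrite -O_map; apply: (O_local (C := set0)) => //.
    by move=> [|x u] // _ /(_ x); rewrite mem_head => /(_ isT).
  by case=> //= x u /(_ x); rewrite mem_head => /(_ isT).
transitivity (O d.+1 ((c \o aff_simp F) \o map (mulmxr (vmx d w))) (std_vertices R d)).
  apply: (O_local (C := stdsimplex R d)).
  - exact: stdsimplex_bary.
  - move=> x /mapP [i _ ->]; split=> [j|].
      by rewrite mxE /= ler0n.
    rewrite (bigD1 i) //= mxE !eqxx big1 ?addr0 // => j /negPf ji.
    by rewrite mxE ji andbF.
  - by move=> u uC /=; rewrite aff_ret.
rewrite O_map; congr (O N _ _).
apply: (@eq_from_nth _ 0); rewrite size_map size_std_vertices // => i id.
rewrite (nth_map 0) ?size_std_vertices //=.
by have /= -> := nth_std_vertices R (Ordinal id); rewrite -rowE rowK.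
Qed.

End Lift.

End SingularChains.

(** * Small simplices *)

Section Subdivision.
Variables (R : realType) (X : topologicalType) (K : comNzRingType).
Implicit Types c e : simp R X -> K.

Lemma cob_cob c x : cob (cob c) x = 0.
Proof.
case: x => [[d s]|] //; rewrite -[Some _]/(simp_of s) -(aff_simp_std s).
rewrite cob_aff (_ : cob c \o _ = lcob (c \o aff_simp (s \o @ret R d))).
  exact: lcob_lcob.
by apply/funext => w; rewrite /= cob_aff.
Qed.

Definition sdiv c := lift_op (fun N => @lsd K _ (@bary R N)) c.
Definition sdivh c := lift_op (fun N => @lsdh K _ (@bary R N)) c.

Lemma sdiv_aff c N (F : continuousType 'rV[R]_N X) w :
  sdiv c (aff_simp F w) = lsd (@bary R N) (c \o aff_simp F) w.
Proof.
apply: lift_op_aff => [m m' A e v|m C e e' v bC vC ee'].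
  by apply: lsd_map => u; exact: bary_map.
by apply: lsd_local => u vu; apply: ee'; exact: sd_piece_bary vu vC.
Qed.

Lemma sdivh_aff c N (F : continuousType 'rV[R]_N X) w :
  sdivh c (aff_simp F w) = lsdh (@bary R N) (c \o aff_simp F) w.
Proof.
apply: lift_op_aff => [m m' A e v|m C e e' v bC vC ee'].
  by apply: lsdh_map => u; exact: bary_map.
by apply: lsdh_local => u vu; apply: ee'; exact: sdh_piece_bary vu vC.
Qed.

Lemma cob_comp_aff c N (F : continuousType 'rV[R]_N X) :
  cob c \o aff_simp F = lcob (c \o aff_simp F).
Proof. by apply/funext => w; rewrite /= cob_aff. Qed.

Lemma sdiv_cob c x : sdiv (cob c) x = cob (sdiv c) x.
Proof.
case: x => [[d s]|] //; rewrite -[Some _]/(simp_of s) -(aff_simp_std s).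
rewrite sdiv_aff cob_aff cob_comp_aff lsd_lcob; congr (lcob _ _).
by apply/funext => w; rewrite /= sdiv_aff.
Qed.

Lemma sdivh_cob c x : sdivh (cob c) x = c x - sdiv c x - cob (sdivh c) x.
Proof.
case: x => [[d s]|]; last by rewrite /= /lsd /lsdh /= !subrr.
rewrite -[Some _]/(simp_of s) -(aff_simp_std s).
rewrite sdivh_aff cob_aff cob_comp_aff lsdh_lcob sdiv_aff; congr (_ - lcob _ _).
by apply/funext => w; rewrite /= sdivh_aff.
Qed.

Lemma lsd_eq0 W (b : seq W -> W) (c : seq W -> K) w :
  (forall u, sd_piece b w u -> c u = 0) -> lsd b c w = 0.
Proof.
by move=> c0; rewrite -[RHS](subrr (lsd b c w)) -lsdB; apply: lsd_local => u /c0 ->; rewrite subrr.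
Qed.

Lemma lsdh_eq0 W (b : seq W -> W) (c : seq W -> K) w :
  (forall u, sdh_piece b w u -> c u = 0) -> lsdh b c w = 0.
Proof.
by move=> c0; rewrite -[RHS](subrr (lsdh b c w)) -lsdhB; apply: lsdh_local => u /c0 ->; rewrite subrr.
Qed.

Lemma simage_aff_ret d (s : sing_simplex R X d) w :
  (simage (aff_simp (s \o @ret R d) w) `<=` range s)%classic.
Proof.
rewrite /aff_simp; case: (size w) => [|m] //= z [t _ <-] /=.
by exists (ret (sval_simplex t *m vmx m w)).
Qed.

Lemma sdiv_in_open c (U : set X) : (forall y, in_open U y -> c y = 0) ->
  forall x, in_open U x -> sdiv c x = 0.
Proof.
move=> c0 [[d s]|] xU; last by rewrite /= /lsd /=; apply: c0.
rewrite -[Some _]/(simp_of s) -(aff_simp_std s) sdiv_aff.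
apply: lsd_eq0 => u _ /=; apply: c0 => z zu; apply: xU.
exact: simage_aff_ret zu.
Qed.

Lemma sdivh_in_open c (U : set X) : (forall y, in_open U y -> c y = 0) ->
  forall x, in_open U x -> sdivh c x = 0.
Proof.
move=> c0 [[d s]|] xU; last by [].
rewrite -[Some _]/(simp_of s) -(aff_simp_std s) sdivh_aff.
apply: lsdh_eq0 => u _ /=; apply: c0 => z zu; apply: xU.
exact: simage_aff_ret zu.
Qed.

Lemma stdsimplex_le1 d t i : stdsimplex R d t -> 0 <= t 0 i <= 1.
Proof.
move=> [t0 t1]; rewrite t0 -t1 (bigD1 i) //= lerDl.
by apply: sumr_ge0 => j _.
Qed.

Lemma stdsimplex_norm d t : stdsimplex R d t -> `|t| <= 1.
Proof.
move=> tS; rewrite [leLHS]/Num.norm /= mx_normrE; apply/bigmax_leP => /=.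
split=> [|[i j] _ /=]; first exact: ler01.
by rewrite (ord1 i); have /andP[? ?] := stdsimplex_le1 j tS; rewrite ger0_norm.
Qed.

Lemma stdsimplex_mesh d w : (forall x, x \in w -> stdsimplex R d x) -> mesh 2 w.
Proof.
move=> wS x y /wS /stdsimplex_norm x1 /wS /stdsimplex_norm y1.
by apply: le_trans (ler_normB _ _) _; rewrite -[2]/(1 + 1) lerD.
Qed.

Lemma stdsimplex_compact d : compact (stdsimplex R d).
Proof.
apply: bounded_closed_compact.
  by exists 1; split=> [|M M1 t /stdsimplex_norm /le_trans]; [exact: num_real|apply; exact: ltW].
rewrite (_ : stdsimplex R d = (\bigcap_(i in [set: 'I_d.+1])
   ((fun t : 'rV[R]_d.+1 => t 0 i) @^-1` [set x | 0 <= x]) `&`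
   (fun t : 'rV[R]_d.+1 => \sum_i t 0 i) @^-1` [set 1])%classic).
  apply: closedI.
    apply: closed_bigI => i _; apply: preimage_closed; last exact: closed_ge.
    by move=> x _; exact: (@coord_continuous R).
  apply: preimage_closed; last exact: closed_eq.
  by move=> x _; apply: continuous_sum => i; exact: (@coord_continuous R).
by apply/seteqP; split => t [t0 t1]; split => // i; [move=> _; exact: t0|exact: t0].
Qed.

Lemma lebesgue_number (I : Type) N (F : continuousType 'rV[R]_N X)
    (C : set 'rV[R]_N) (U : I -> set X) :
  compact C -> (forall i, open (U i)) ->
  (forall x, C x -> exists i, U i (F x)) ->
  exists2 e : R, 0 < e & forall x, C x -> exists i, forall y, `|y - x| <= e -> U i (F y).
Proof.
move=> /compact_near_coveringP Cc Uo CU.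
have /Cc : forall x, C x -> \forall x' \near x & e \near at_right (0 : R),
    exists i, forall y, `|y - x'| <= e -> U i (F y).
  move=> x /CU [i Ui].
  have /nbhs_ballP [r /= r0 rU] : nbhs x (F @^-1` U i)%classic.
    by have Fc := @cts_fun _ _ F x; apply: Fc; exact: open_nbhs_nbhs.
  exists (ball x (r / 2), [set e | e < r / 2])%classic => /=.
    split; first by apply: nbhsx_ballx; rewrite divr_gt0.
    by near=> e; near: e; apply: nbhs_right_lt; rewrite divr_gt0.
  move=> [x' e] [/= xx' er]; exists i => y yx'; apply: rU.
  rewrite -ball_normE /= distrC.
  rewrite -ball_normE /= distrC in xx'.
  have -> : y - x = (y - x') + (x' - x) by rewrite addrA subrK.
  apply: le_lt_trans (ler_normD _ _) _.
  by rewrite [ltRHS](splitr r) ler_ltD // (le_trans yx') // ltW.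
move=> near0; near (at_right (0 : R)) => e; exists e => // x Cx.
by move: x Cx; near: e; exact: near0.
Unshelve. all: by end_near.
Qed.

Lemma iter_sdiv_mesh (I : Type) (i0 : I) (U : I -> set X) c d
    (s : sing_simplex R X d) D (e : R) :
  (forall i y, in_open (U i) y -> c y = 0) ->
  (forall x, stdsimplex R d x -> exists i, forall y, `|y - x| <= e ->
     U i ((s \o @ret R d) y)) ->
  forall j r w, (size w <= D)%N -> (forall x, x \in w -> stdsimplex R d x) ->
    mesh r w -> (1 - D%:R^-1) ^+ j * r <= e ->
    iter j sdiv c (aff_simp (s \o @ret R d) w) = 0.
Proof.
move=> c0 eU; elim=> [|j IH] r w wD wS wr re.
  case: w wD wS wr => [|x w] wD wS wr; first by apply: (c0 i0) => z [].
  have /eU [i iU] : stdsimplex R d x by apply: wS; rewrite mem_head.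
  apply: (c0 i) => z; rewrite /aff_simp /= => -[t _ <-].
  apply: iU; apply: (@stdsimplex_vmx R _ _ _ [set y | `|y - x| <= e]%classic) => //.
    by move=> t' f; exact: (@convex_ball _ _ x e).
    exact: set_valP.
  move=> y yw; rewrite expr0 mul1r in re.
  by apply: le_trans re; apply: wr => //; rewrite mem_head.
rewrite iterS sdiv_aff; apply: lsd_eq0 => u wu /=; apply: (IH ((1 - D%:R^-1) * r)).
- by rewrite (size_sd_piece wu).
- exact: sd_piece_bary (@stdsimplex_bary R d) wu wS.
- exact: sd_piece_mesh wD wr wu.
- by rewrite mulrA -exprSr.
Qed.

Lemma small_exponent (D : nat) (e : R) : (0 < D)%N -> 0 < e ->
  exists k, forall j, (k <= j)%N -> (1 - D%:R^-1) ^+ j * 2 <= e.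
Proof.
move=> D0 e0; set q := 1 - D%:R^-1.
have q0 : 0 <= q by rewrite subr_ge0 invf_le1 ?ltr0n // ler1n.
have q1 : `|q| < 1 by rewrite ger0_norm // ltrBlDr ltrDl invr_gt0 ltr0n.
have := cvg_expr q1.
move=> /cvgrPdist_le /(_ (e / 2)) [|k _ kP]; first by rewrite divr_gt0.
exists k => j kj; rewrite -ler_pdivlMr //.
by have := kP j kj; rewrite /= sub0r normrN ger0_norm // exprn_ge0.
Qed.

Lemma std_vertices_in d x : x \in std_vertices R d -> stdsimplex R d x.
Proof.
case/mapP => i _ ->; split=> [j|]; first by rewrite mxE /= ler0n.
rewrite (bigD1 i) //= mxE !eqxx big1 ?addr0 // => j /negPf ji.
by rewrite mxE ji andbF.
Qed.

Lemma iter_sdiv_eventually0 (I : Type) (i0 : I) (U : I -> set X) c :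
  (forall i, open (U i)) -> (forall i y, in_open (U i) y -> c y = 0) ->
  forall x, in_open (\bigcup_i U i)%classic x -> exists k, forall j, (k <= j)%N ->
    iter j sdiv c x = 0 /\ sdivh (iter j sdiv c) x = 0.
Proof.
move=> Uo c0 [[d s]|] xU; last first.
  exists 0 => j _; split; last by [].
  elim: j => [|j IH] //=; first by apply: (c0 i0) => z [].
have CU x : stdsimplex R d x -> exists i, U i ((s \o @ret R d) x).
  by move=> _; have [i _ iU] := xU (s (ret x)) (ex_intro2 _ _ (ret x) Logic.I erefl); exists i.
have [e e0 eU] := lebesgue_number (@stdsimplex_compact d) Uo CU.
have [k kP] := @small_exponent d.+2 e isT e0.
exists k => j /kP je; rewrite -[Some _]/(simp_of s) -(aff_simp_std s).
split.
  apply: (iter_sdiv_mesh (D := d.+2) i0 c0 eU (r := 2)) => //.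
  - by rewrite size_std_vertices.
  - exact: std_vertices_in.
  - by apply: stdsimplex_mesh; exact: std_vertices_in.
rewrite sdivh_aff; apply: lsdh_eq0 => u wu /=.
have uS : forall x, x \in u -> stdsimplex R d x.
  by apply: sdh_piece_bary (@stdsimplex_bary R d) wu _; exact: std_vertices_in.
apply: (iter_sdiv_mesh (D := d.+2) i0 c0 eU (r := 2)) => //.
- by rewrite (size_sdh_piece wu) size_std_vertices.
- exact: stdsimplex_mesh.
Qed.

Lemma face_bound (f : simp R X -> nat) x : exists k, forall y, is_face x y -> (f y <= k)%N.
Proof.
case: x => [[[|d] s]|] /=.
- by exists (f None) => y ->.
- exists (\max_(i < d.+2) f (simp_of (face i s))) => y [i ->].
  exact: (leq_bigmax i).
- by exists 0.
Qed.

(* The cochains vanishing on the simplices subordinate to an open cover form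
   an acyclic complex. *)
Lemma small_simplices (I : Type) (i0 : I) (U : I -> set X) c :
  (forall i, open (U i)) ->
  (forall x, in_open (\bigcup_i U i)%classic x -> cob c x = 0) ->
  (forall i x, in_open (U i) x -> c x = 0) ->
  exists b, (forall x, in_open (\bigcup_i U i)%classic x -> c x = cob b x) /\
    (forall i x, in_open (U i) x -> b x = 0).
Proof.
move=> Uo cc c0; set P := in_open _.
have ex0 (x : simp R X) : exists k, P x -> forall j, (k <= j)%N ->
    iter j sdiv c x = 0 /\ sdivh (iter j sdiv c) x = 0.
  have [Px|nPx] := pselect (P x); last by exists 0.
  by have [k kP] := iter_sdiv_eventually0 i0 Uo c0 Px; exists k.
have {ex0} [k kP] := choice ex0.
pose S n x := \sum_(j < n) sdivh (iter j sdiv c) x.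
have SE n x : P x -> (k x <= n)%N -> S n x = S (k x) x.
  move=> Px /subnKC <-; rewrite /S big_split_ord /= [X in _ + X]big1 ?addr0 // => i _.
  by case: (kP x Px (k x + i)%N (leq_addr _ _)).
exists (fun x => S (k x) x); split=> [x Px|i x xU]; last first.
  apply: big1 => j _; apply: sdivh_in_open xU => y yU.
  elim: (nat_of_ord j) y yU => [|m IH] y yU /=; first exact: c0 yU.
  exact: sdiv_in_open yU.
have [n0 n0P] := face_bound k x.
pose n := maxn n0 (k x).
transitivity (cob (S n) x); last first.
  apply: cob_local => y xy; apply: SE; first exact: in_open_face xy Px.
  by rewrite leq_max n0P.
rewrite cob_sum.
transitivity (\sum_(j < n) (iter j sdiv c x - iter j.+1 sdiv c x)).
  rewrite -(big_mkord xpredT (fun j => iter j sdiv c x - iter j.+1 sdiv c x)).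
  under eq_bigr => j _ do rewrite -opprB.
  rewrite sumrN telescope_sumr // opprB /=.
  by case: (kP x Px n (leq_maxr _ _)) => -> _; rewrite subr0.
apply: eq_bigr => j _; rewrite iterS.
have := sdivh_cob (iter j sdiv c) x.
rewrite (_ : sdivh (cob (iter j sdiv c)) x = 0).
  by move/esym/eqP; rewrite subr_eq0 => /eqP.
apply: sdivh_in_open Px => y Py.
elim: (nat_of_ord j) y Py => [|m IH] y Py; first exact: cc.
by rewrite iterS -sdiv_cob; apply: sdiv_in_open Py.
Qed.

End Subdivision.

(** * Homotopy invariance *)

Section PrismLists.
Variables (K : comNzRingType) (W W' : Type) (f0 f1 : W -> W').

Lemma lprism_local (C : W' -> Prop) (c e : seq W' -> K) w :
  (forall x, List.In x w -> C (f0 x) /\ C (f1 x)) ->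
  (forall u, List.Forall C u -> c u = e u) ->
  lprism f0 f1 c w = lprism f0 f1 e w.
Proof.
elim: w c e => [|x w IH] c e //= wC ce.
have [C0 C1] := wC x (or_introl erefl).
congr (_ - _).
  apply: ce; constructor => //; constructor => //.
  elim: w wC {IH} => [|y w IH] wC; constructor; first by case: (wC y) => //=; right; left.
  by apply: IH => z [<-|zw]; apply: wC; [left|right; right].
apply: IH => [y yw|u uC]; first by apply: wC; right.
by apply: ce; constructor.
Qed.

Lemma lprism_eq0 (C : W' -> Prop) (c : seq W' -> K) w :
  (forall x, List.In x w -> C (f0 x) /\ C (f1 x)) ->
  (forall u, List.Forall C u -> c u = 0) ->
  lprism f0 f1 c w = 0.
Proof.
move=> wC c0; rewrite -[RHS](subrr (lprism f0 f1 c w)) -lprismB.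
by apply: lprism_local wC _ => u /c0 ->; rewrite subrr.
Qed.

End PrismLists.

Lemma lprism_map (K : comNzRingType) (W W' Z Z' : Type) (f0 f1 : W -> W')
    (g0 g1 : Z -> Z') (h : W -> Z) (h' : W' -> Z') (c : seq Z' -> K) w :
  (forall x, h' (f0 x) = g0 (h x)) -> (forall x, h' (f1 x) = g1 (h x)) ->
  lprism f0 f1 (c \o map h') w = lprism g0 g1 c (map h w).
Proof.
move=> h0 h1; elim: w c => [|x w IH] c //=.
rewrite h0 h1 -!map_comp (eq_map (g := g1 \o h)) // -IH; congr (_ - _).
by congr lprism; apply/funext => u; rewrite /lcone /= h0.
Qed.

Lemma cts_pair (T U V : topologicalType) (f : T -> U) (g : T -> V) :
  continuous f -> continuous g -> continuous (fun x => (f x, g x)).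
Proof. by move=> cf cg x; exact: (cvg_pair (cf x) (cg x)). Qed.

Section Push.
Variables (R : realType) (X Y : topologicalType) (f : continuousType X Y).

Definition simp_push (x : simp R X) : simp R Y :=
  if x is Some (existT d s) then simp_of ((f \o s : continuousType _ _) : sing_simplex R Y d)
  else None.

Lemma ssize_push x : ssize (simp_push x) = ssize x.
Proof. by case: x => [[d s]|]. Qed.

Lemma cob_push (K : comNzRingType) (c : simp R Y -> K) x :
  cob (c \o simp_push) x = cob c (simp_push x).
Proof.
case: x => [[[|d] s]|] //=; apply: eq_bigr => i _; congr (_ * c (simp_of _)).
by apply/continuousEP.
Qed.

Lemma in_open_push (U : set X) (U' : set Y) : (forall z, U z -> U' (f z)) ->
  forall x, in_open U x -> in_open U' (simp_push x).
Proof.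
move=> UU' [[d s]|] xU //= z [t _ <-]; apply: UU'; apply: xU.
by exists t.
Qed.

Lemma simp_push_aff N (F : continuousType 'rV[R]_N X) w :
  simp_push (aff_simp F w) = aff_simp (f \o F) w.
Proof.
by rewrite /aff_simp; case: (size w) => [|d] //=; congr simp_of; apply/continuousEP.
Qed.

End Push.

Lemma simp_push_comp (R : realType) (X Y Z : topologicalType)
  (f : continuousType X Y) (g : continuousType Y Z) (x : simp R X) :
  simp_push g (simp_push f x) = simp_push (g \o f) x.
Proof. by case: x => [[d s]|] //=; congr simp_of; apply/continuousEP. Qed.

Lemma eq_simp_push (R : realType) (X Y : topologicalType)
  (f g : continuousType X Y) : f =1 g -> simp_push f =1 @simp_push R _ _ g.
Proof. by move=> /continuousEP ->. Qed.

Lemma simp_push_id (R : realType) (X : topologicalType)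
  (f : continuousType X X) : f =1 id -> @simp_push R _ _ f =1 id.
Proof.
move=> fid [[d s]|] //=; congr simp_of; apply/continuousEP => t /=; exact: fid.
Qed.

Section Homotopy.
Variables (R : realType) (X Y : topologicalType) (K : comNzRingType).
Variable G : continuousType (R * X)%type Y.

Definition prism_fun N (F : 'rV[R]_N -> X) (v : 'rV[R]_(1 + N)) : Y :=
  G (v 0 (lshift N 0), F (mulmxr (col_mx 0 1%:M) v)).

Lemma prism_fun_continuous N (F : continuousType 'rV[R]_N X) :
  continuous (prism_fun F).
Proof.
move=> v; apply: (@continuous_comp _ _ _ (fun v : 'rV[R]_(1 + N) =>
  (v 0 (lshift N 0), F (mulmxr (col_mx 0 1%:M) v))) G); last exact: cts_fun.
apply: cts_pair; first exact: (@coord_continuous R).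
move=> {}v; apply: (@continuous_comp _ _ _ (mulmxr (col_mx 0 1%:M) : 'rV[R]_(1 + N) -> 'rV[R]_N) F).
  exact: mulmxr_continuous.
exact: cts_fun.
Qed.

HB.instance Definition _ N (F : continuousType 'rV[R]_N X) :=
  isContinuous.Build _ _ (prism_fun F) (@prism_fun_continuous N F).

Definition liftr r N (p : 'rV[R]_N) : 'rV[R]_(1 + N) := row_mx (const_mx r) p.

Definition prism (c : simp R Y -> K) (x : simp R X) : K :=
  match x with
  | None => 0
  | Some (existT d s) =>
      lprism (@liftr 0 d.+1) (@liftr 1 d.+1)
        (c \o aff_simp (prism_fun (s \o @ret R d))) (std_vertices R d)
  end.

Lemma InP (T : eqType) (x : T) w : List.In x w -> x \in w.
Proof. by elim: w => //= y w IH [->|/IH]; rewrite inE ?eqxx // => ->; rewrite orbT. Qed.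

Lemma ForallP (T : eqType) (C : T -> Prop) w :
  List.Forall C w -> forall x, x \in w -> C x.
Proof. by elim => // y {}w Cy _ IH x; rewrite inE => /orP [/eqP ->|/IH]. Qed.

Lemma prism_fun_aff N (F : continuousType 'rV[R]_N X) d w (v : 'rV[R]_(1 + d.+1)) :
  stdsimplex R d (rsubmx v) ->
  prism_fun (aff_sing F d w \o @ret R d) v =
  prism_fun F (v *m block_mx 1%:M 0 0 (vmx d w)).
Proof.
move=> vS; rewrite /prism_fun /= -(hsubmxK v) mul_row_block !mulmx0 mulmx1 addr0 add0r !row_mxEl !mul_row_col.
rewrite !mulmx0 !add0r !mulmx1.
by rewrite /sval_simplex set_val_ret ret_row_id.
Qed.

Lemma prism_aff c N (F : continuousType 'rV[R]_N X) w :
  prism c (aff_simp F w) =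
  lprism (@liftr 0 N) (@liftr 1 N) (c \o aff_simp (prism_fun F)) w.
Proof.
have [d wd] : exists d, d = size w by exists (size w).
rewrite {1}/aff_simp -wd; case: d wd => [|d] wd /=; first by case: w wd.
pose B : 'M[R]_(1 + d.+1, 1 + N) := block_mx 1%:M 0 0 (vmx d w).
transitivity (lprism (@liftr 0 d.+1) (@liftr 1 d.+1)
   ((c \o aff_simp (prism_fun F)) \o map (mulmxr B)) (std_vertices R d)).
  apply: (@lprism_local _ _ _ _ _ (fun v => stdsimplex R d (rsubmx v))).
    by move=> x /InP /std_vertices_in xS; rewrite /liftr !row_mxKr.
  move=> u /ForallP uS /=; congr c; rewrite aff_simp_map.
  apply: eq_aff_simp setT _ => m t tm mu /=; apply: prism_fun_aff.
  apply: (@stdsimplex_vmx R _ _ _ [set v | stdsimplex R d (rsubmx v)]%classic) => //.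
  move=> t' f tS fS /=; rewrite linear_sum /=.
  under eq_bigr => i _ do rewrite linearZ /=.
  exact: convex_stdsimplex.
rewrite (lprism_map (g0 := @liftr 0 N) (g1 := @liftr 1 N) (h := mulmxr (vmx d w))).
- congr lprism; apply: (@eq_from_nth _ 0); rewrite size_map size_std_vertices // => i id.
  rewrite (nth_map 0) ?size_std_vertices //=.
  by have /= -> := nth_std_vertices R (Ordinal id); rewrite -rowE rowK.
- by move=> x; rewrite /= /liftr mul_row_block !mulmx0 mulmx1 addr0 add0r.
- by move=> x; rewrite /= /liftr mul_row_block !mulmx0 mulmx1 addr0 add0r.
Qed.

Definition slice (r : R) (x : X) : Y := G (r, x).

Lemma slice_continuous r : continuous (slice r).
Proof.
move=> x; apply: (@continuous_comp _ _ _ (fun x : X => (r, x)) G); last exact: cts_fun.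
by apply: cts_pair => // {}x; [exact: cst_continuous|exact: cvg_id].
Qed.

HB.instance Definition _ r := isContinuous.Build _ _ (slice r) (@slice_continuous r).

Lemma aff_simp_lift N (F : continuousType 'rV[R]_N X) r w :
  aff_simp (prism_fun F) (map (row_mx (const_mx r) : 'rV[R]_N -> 'rV[R]_(1 + N)) w) =
  simp_push (slice r) (aff_simp F w).
Proof.
rewrite simp_push_aff /aff_simp size_map.
have [d wd] : exists d, d = size w by exists (size w).
rewrite -wd; case: d wd => [|d] wd //; congr simp_of; apply/continuousEP => t /=.
have tS : stdsimplex R d (sval_simplex t) by exact: set_valP.
have E : sval_simplex t *m vmx d (map (row_mx (const_mx r) : 'rV[R]_N -> 'rV[R]_(1 + N)) w) =
    row_mx (const_mx r) (sval_simplex t *m vmx d w).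
  have -> : vmx d (map (row_mx (const_mx r) : 'rV[R]_N -> 'rV[R]_(1 + N)) w) =
      row_mx (const_mx r) (vmx d w).
    apply/row_matrixP => i; rewrite row_row_mx rowK (nth_map 0) -?wd //.
    by rewrite row_const rowK.
  rewrite mul_mx_row; congr row_mx; apply/rowP => i; rewrite !mxE.
  under eq_bigr => j _ do rewrite mxE.
  by rewrite -mulr_suml (proj2 tS) mul1r.
by rewrite /prism_fun /slice /= E row_mxEl mxE mul_row_col mulmx0 add0r mulmx1.
Qed.

Lemma prism_cob c x :
  prism (cob c) x = c (simp_push (slice 1) x) - c (simp_push (slice 0) x) - cob (prism c) x.
Proof.
case: x => [[d s]|]; last by rewrite /= !subrr.
rewrite -[Some _]/(simp_of s) -(aff_simp_std s).
rewrite prism_aff cob_comp_aff lprism_lcob cob_aff /= -!aff_simp_lift.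
by congr (_ - lcob _ _); apply/funext => w; rewrite /= prism_aff.
Qed.

Lemma prism_in_open c (U : set X) (U' : set Y) :
  (forall r x, 0 <= r <= 1 -> U x -> U' (G (r, x))) ->
  (forall y, in_open U' y -> c y = 0) ->
  forall x, in_open U x -> prism c x = 0.
Proof.
move=> GU c0 [[d s]|] xU //=.
apply: (@lprism_eq0 _ _ _ _ _ (fun v : 'rV[R]_(1 + d.+1) => is_true (0 <= v 0 (lshift d.+1 0) <= 1))).
  by move=> x _; rewrite /liftr !row_mxEl !mxE ler01 !lexx.
move=> u /ForallP uS /=; apply: c0; rewrite /aff_simp.
have [m wm] : exists m, m = size u by exists (size u).
rewrite -wm; case: m wm => [|m] wm //= z [t _ <-] /=.
apply: GU; last by apply: xU; eexists.
apply: (@stdsimplex_vmx R _ _ _ [set v : 'rV[R]_(1 + d.+1) | 0 <= v 0 (lshift d.+1 0) <= 1]%classic) => //.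
  move=> t' f [t0 t1] fS /=; rewrite summxE; apply/andP; split.
    by apply: sumr_ge0 => i _; rewrite mxE mulr_ge0 //; case/andP: (fS i).
  rewrite -t1; apply: ler_sum => i _; rewrite mxE ler_piMr //.
  by case/andP: (fS i).
exact: set_valP.
Qed.

Lemma homotopy_invariance c (U : set X) (U' : set Y) :
  (forall r x, 0 <= r <= 1 -> U x -> U' (G (r, x))) ->
  (forall y, in_open U' y -> cob c y = 0) ->
  forall x, in_open U x ->
    c (simp_push (slice 1) x) - c (simp_push (slice 0) x) = cob (prism c) x.
Proof.
move=> GU cc x xU; apply/eqP; rewrite -subr_eq0 -prism_cob; apply/eqP.
exact: prism_in_open GU cc x xU.
Qed.

End Homotopy.

Section Contractible.
Variables (R : realType) (X : topologicalType) (K : comNzRingType).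

Definition cst_simp (b : X) m : simp R X :=
  if m is d.+1 then simp_of (mkcts (@cst_continuous (stdsimplex R d) X b) : sing_simplex R X d) else None.

Lemma sum_signs n : \sum_(i < n) (-1) ^+ i = (odd n)%:R :> K.
Proof.
elim: n => [|n IH]; first by rewrite big_ord0.
rewrite big_ord_recr /= IH -signr_odd; case: (odd n) => /=.
  by rewrite expr1 subrr.
by rewrite expr0 add0r.
Qed.

Lemma cob_size (g : nat -> K) (x : simp R X) :
  cob (fun y => g (ssize y)) x = (odd (ssize x))%:R * g (ssize x).-1.
Proof.
case: x => [[[|d] s]|] /=; rewrite ?mul1r ?mul0r //.
rewrite -mulr_suml sum_signs /=.
done.
Qed.

Lemma cob_cst_simp (c : simp R X -> K) b m :
  cob c (cst_simp b m.+1) = (odd m.+1)%:R * c (cst_simp b m).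
Proof.
case: m => [|m]; first by rewrite /= mul1r.
rewrite -sum_signs mulr_suml; apply: eq_bigr => i _; congr (_ * c (simp_of _)).
by apply/continuousEP.
Qed.

Lemma contractible_acyclic (G : continuousType (R * X)%type X) (U : set X) b :
  U b -> (forall r x, 0 <= r <= 1 -> U x -> U (G (r, x))) ->
  (forall x, G (0, x) = b) -> (forall x, G (1, x) = x) ->
  forall c : simp R X -> K, (forall x, in_open U x -> cob c x = 0) ->
  exists e, forall x, in_open U x -> c x = cob e x.
Proof.
move=> Ub GU G0 G1 c cc.
have ceven m : ~~ odd m -> c (cst_simp b m) = 0.
  move=> om; rewrite -[LHS]mul1r -[1]/(true%:R) -om -/(odd m.+1) -cob_cst_simp.
  by apply: cc => z [t _ <-].
exists (fun x => c (cst_simp b (ssize x).+1) + prism G c x) => x xU.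
rewrite cobD -(homotopy_invariance (c := c) GU cc xU).
rewrite (cob_size (fun m => c (cst_simp b m.+1))).
have -> : simp_push (slice G 1) x = x by apply: simp_push_id => z; exact: G1.
have -> : simp_push (slice G 0) x = cst_simp b (ssize x).
  case: x {xU} => [[d s]|] //=; congr simp_of; apply/continuousEP => t /=; exact: G0.
case: (ssize x) => [|m] /=; first by have /= -> := ceven 0 isT; rewrite mul0r add0r subr0.
case om : (odd m) => /=; rewrite ?mul1r; last by rewrite addrCA subrr addr0.
by rewrite mul0r add0r [c (cst_simp b m.+1)]ceven ?subr0 //= om.
Qed.

End Contractible.

(** * Cohomology of spheres *)

Section Spherical.
Variables (R : realType) (X : topologicalType) (K : fieldType).
Implicit Types (P Q : set (simp R X)) (c e w : simp R X -> K).

Definition cocycle_on P c := forall x, P x -> cob c x = 0.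

Definition acyclic_on P := forall c, cocycle_on P c ->
  exists e, forall x, P x -> c x = cob e x.

(* The augmented cochain complex of [P] has one-dimensional cohomology, generated
   by the class of [w], which lives in size [k], i.e. in degree [k - 1]. *)
Definition spherical P k w := [/\ forall x, w x != 0 -> ssize x = k,
  cocycle_on P w,
  forall c, cocycle_on P c -> exists a e, forall x, P x -> c x = a * w x + cob e x
  & forall a e, (forall x, P x -> a * w x = cob e x) -> a = 0].

Definition face_closed P := forall x y, is_face x y -> P x -> P y.

Lemma face_closed_in_open U : face_closed (in_open U).
Proof. by move=> x y xy; apply: in_open_face. Qed.

Lemma spherical_empty : spherical (in_open set0) 0 (fun x => (ssize x == 0)%:R).
Proof.
have E x : in_open set0 x -> x = None.
  case: x => [[d s]|] // xU.
  by have [] : set0 (s (ret 0)) by apply: xU; exists (ret 0).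
split=> [x|x /E -> //|c cc|a e ae].
- by case: (ssize x =P 0%N) => // _; rewrite eqxx.
- by exists (c None), (fun=> 0) => x /E -> /=; rewrite mulr1 addr0.
by have := ae None; rewrite /= mulr1; apply => z.
Qed.

Lemma cob_eq_on P c e : face_closed P -> (forall x, P x -> c x = e x) ->
  forall x, P x -> cob c x = cob e x.
Proof. by move=> fP ce x Px; apply: cob_local => y xy; apply: ce; exact: fP xy Px. Qed.

Lemma mayer_vietoris P Q k w : face_closed P -> face_closed Q ->
  acyclic_on P -> acyclic_on Q -> spherical (P `&` Q)%classic k w ->
  exists w', spherical (P `|` Q)%classic k.+1 w'.
Proof.
move=> fP fQ aP aQ [wk wc wg w0].
have fPQ : face_closed (P `&` Q)%classic.
  by move=> x y xy [Px Qx]; split; [exact: fP xy _|exact: fQ xy _].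
pose w' x := if `[< Q x >] then 0 else cob w x.
have w'P x : P x -> w' x = cob w x.
  by move=> Px; rewrite /w'; case: asboolP => // Qx; rewrite wc.
have w'Q x : Q x -> w' x = 0 by move=> Qx; rewrite /w'; case: asboolP.
exists w'; split.
- move=> x; rewrite /w'; case: asboolP; rewrite ?eqxx // => _ wx.
  apply/eqP; apply: contra_neqT wx => xk; rewrite -(cob0 K x).
  apply: cob_local => y xy; apply/eqP; apply: contra_neqT xk => /wk.
  by rewrite (is_face_size xy) => ->.
- move=> x [Px|Qx]; first by rewrite (cob_eq_on fP w'P Px) cob_cob.
  by rewrite (cob_eq_on fQ w'Q Qx) cob0.
- move=> c cc.
  have [e1 ce1] : exists e, forall x, P x -> c x = cob e x by apply: aP => x Px; apply: cc; left.
  have [e2 ce2] : exists e, forall x, Q x -> c x = cob e x by apply: aQ => x Qx; apply: cc; right.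
  have [a [g ag]] : exists a g, forall x, (P `&` Q)%classic x ->
      (e1 x - e2 x) = a * w x + cob g x.
    by apply: wg => x [Px Qx]; rewrite cobB -ce1 // -ce2 // subrr.
  pose e x := if `[< Q x >] then e2 x else e1 x - a * w x - cob g x.
  have eQ x : Q x -> e x = e2 x by move=> Qx; rewrite /e; case: asboolP.
  have eP x : P x -> e x = e1 x - a * w x - cob g x.
    move=> Px; rewrite /e; case: asboolP => // Qx.
    by rewrite -addrA -opprD -ag // opprB addrC subrK.
  exists a, e => x [Px|Qx].
    rewrite (cob_eq_on fP eP Px) !cobB cobZ cob_cob subr0 w'P // -ce1 //.
    by rewrite addrC subrK.
  by rewrite (cob_eq_on fQ eQ Qx) -ce2 // w'Q // mulr0 add0r.
move=> a e ae.
have [g1 eg1] : exists g, forall x, P x -> a * w x - e x = cob g x.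
  apply: aP => x Px; rewrite cobB cobZ -w'P // -ae ?subrr //; by left.
have [g2 eg2] : exists g, forall x, Q x -> e x = cob g x.
  by apply: aQ => x Qx; rewrite -ae ?w'Q ?mulr0 //; right.
apply: (w0 a (fun x => g1 x + g2 x)) => x [Px Qx].
by rewrite cobD -eg1 // -eg2 // subrK.
Qed.

Section Small.
Variables (I : Type) (i0 : I) (U : I -> set X).
Hypothesis Uo : forall i, open (U i).

Definition small : set (simp R X) := [set x | exists i, in_open (U i) x]%classic.

Let big := in_open (\bigcup_i U i)%classic : set (simp R X).

Lemma small_big x : small x -> big x.
Proof. by case=> i xU z /xU; exists i. Qed.

Lemma small_acyclic c : cocycle_on big c -> (forall x, small x -> c x = 0) ->
  exists e, (forall x, big x -> c x = cob e x) /\ (forall x, small x -> e x = 0).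
Proof.
move=> cc c0; have [|e [ce e0]] := @small_simplices R X K I i0 U c Uo cc.
  by move=> i x xU; apply: c0; exists i.
by exists e; split=> // x [i ix]; exact: e0 ix.
Qed.

Lemma small_extend c : cocycle_on small c ->
  exists e, cocycle_on big e /\ (forall x, small x -> e x = c x).
Proof.
move=> cc; have [x _|e [ce e0]] := @small_acyclic (cob c) _ cc; first exact: cob_cob.
exists (fun x => c x - e x); split=> [x bx|x /e0 ->]; last by rewrite subr0.
by rewrite cobB ce // subrr.
Qed.

Lemma small_exact c e : cocycle_on big c -> (forall x, small x -> c x = cob e x) ->
  exists g, forall x, big x -> c x = cob g x.
Proof.
move=> cc ce; have [x bx|x sx|g [cg _]] := @small_acyclic (fun x => c x - cob e x).
- by rewrite cobB cc // cob_cob subrr.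
- by rewrite ce // subrr.
exists (fun x => g x + e x) => x bx; by rewrite cobD -cg // subrK.
Qed.

Lemma spherical_small k w : spherical big k w -> spherical small k w.
Proof.
case=> wk wc wg w0; split=> //.
- by move=> x /small_big; exact: wc.
- move=> c /small_extend [c' [cc' cE]]; have [a [e ae]] := wg _ cc'.
  by exists a, e => x sx; rewrite -cE // ae //; exact: small_big.
move=> a e ae; have [||g ag] := @small_exact (fun x => a * w x) e.
- by move=> x bx; rewrite cobZ wc // mulr0.
- exact: ae.
exact: w0 ag.
Qed.

Lemma spherical_big k w : spherical small k w -> exists w', spherical big k w'.
Proof.
case=> wk wc wg w0; have [w1 [w1c w1E]] := small_extend wc.
pose w' x := (ssize x == k)%:R * w1 x.
have w'E x : small x -> w' x = w x.
  move=> sx; rewrite /w' w1E //; case: eqP => [_|xk]; first by rewrite mul1r.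
  by rewrite mul0r; apply/esym/eqP; apply/negPn/negP => /wk.
have w'c : cocycle_on big w'.
  move=> x bx; transitivity ((ssize x == k.+1)%:R * cob w1 x); last by rewrite w1c // mulr0.
  rewrite -cobZ; apply: cob_local => y /is_face_size ->.
  by rewrite /w' eqSS.
exists w'; split=> //.
- move=> x; rewrite /w'; case: (ssize x =P k) => // _; by rewrite mul0r eqxx.
- move=> c cc; have [|a [e ae]] := wg c; first by move=> x /small_big; exact: cc.
  have [||g ag] := @small_exact (fun x => c x - a * w' x) e.
  - by move=> x bx; rewrite cobB cobZ cc // w'c // mulr0 subrr.
  - by move=> x sx; rewrite w'E // ae // addrC addKr.
  by exists a, g => x bx; rewrite -ag // addrC subrK.
move=> a e ae; apply: (w0 a e) => x sx; rewrite -w'E // ae //; exact: small_big.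
Qed.

End Small.

Section SphereForms.
Variables (f : nat -> X -> R) (b : bool -> nat -> X).
Variable seg : X -> continuousType (R * X)%type X.
Hypothesis fc : forall i, continuous (f i).
Hypothesis seg0 : forall y x, seg y (0, x) = y.
Hypothesis seg1 : forall y x, seg y (1, x) = x.
Hypothesis f_seg : forall i y r x, f i (seg y (r, x)) = r * f i x + (1 - r) * f i y.
Variable m : nat.
Hypothesis fb0 : forall s i j, (j < i < m)%N -> f j (b s i) = 0.
Hypothesis fb1 : forall s i, (i < m)%N -> f i (b s i) = (-1) ^+ s.

Let nz k : set X := [set x | exists2 i, (i < k)%N & f i x != 0]%classic.
Let half k (s : bool) : set X := [set x | nz k x \/ 0 < (-1) ^+ s * f k x]%classic.

Lemma nz_open k : open (nz k).
Proof.
have -> : nz k = (\bigcup_(i in [set i | (i < k)%N]) (f i @^-1` [set r | r != 0]))%classic.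
  by apply/seteqP; split => x [i ik fx]; exists i.
apply: bigcup_open => i _; apply: open_comp; first by move=> x _; exact: fc.
exact: open_neq.
Qed.

Lemma half_open k s : open (half k s).
Proof.
have -> : half k s = (nz k `|` (fun x => (-1) ^+ s * f k x) @^-1` [set r | 0 < r])%classic by [].
apply: openU; first exact: nz_open.
apply: open_comp; last exact: open_gt.
move=> x _; apply: ctsM => //; exact: cts_cst.
Qed.

Lemma half_acyclic k s : (k < m)%N -> acyclic_on (in_open (half k s)).
Proof.
move=> km.
apply: (@contractible_acyclic _ _ _ (seg (b s k)) _ (b s k)) => //.
  by right; rewrite fb1 // -expr2 sqrr_sign.
move=> r x /andP [r0 r1] xU.
have [->|rn0] := eqVneq r 0.
  by rewrite seg0; right; rewrite fb1 // -expr2 sqrr_sign.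
have rp : 0 < r by rewrite lt_def rn0.
case: xU => [[i ik fx]|fx].
  by left; exists i => //; rewrite f_seg fb0 ?ik // mulr0 addr0 mulf_neq0.
right; rewrite f_seg fb1 // mulrDr mulrCA [_ * (_ * _ ^+ _)]mulrCA -expr2 sqrr_sign mulr1.
by apply: ltr_wpDr; rewrite ?subr_ge0 // mulr_gt0.
Qed.

Lemma halfI k : (in_open (half k false) `&` in_open (half k true))%classic =
  in_open (nz k) :> set (simp R X).
Proof.
apply/seteqP; split => [x [x1 x2] z xz|x xn]; last by split=> z /xn; left.
case: (x1 z xz) => // p; case: (x2 z xz) => // q; exfalso.
move: p q; rewrite expr0 expr1 mul1r mulN1r oppr_gt0 => p q.
by have := lt_trans p q; rewrite ltxx.
Qed.

Lemma halfU k : (\bigcup_s half k s)%classic = nz k.+1.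
Proof.
apply/seteqP; split => [x [s _ [[i ik fx]|fx]]|x [i ik fx]].
- by exists i => //; exact: ltnW.
- exists k => //; apply: contraTneq fx => ->; by rewrite mulr0 ltxx.
have [kx|] := eqVneq i k; last first.
  move=> nik; exists true => //; left; exists i => //.
  by rewrite ltn_neqAle nik -ltnS.
subst i; exists (f k x < 0) => //; right.
by move: fx; rewrite neq_lt; case: ltP => [fx _|_ /= fx]; rewrite ?expr1 ?mulN1r ?oppr_gt0 // expr0 mul1r.
Qed.

Lemma sphere_forms k : (k <= m)%N -> exists w, spherical (in_open (nz k)) k w.
Proof.
elim: k => [_|k IH km].
  rewrite (_ : nz 0 = set0); last by apply/seteqP; split => x // [].
  by eexists; exact: spherical_empty.
have [w] := IH (ltnW km); rewrite -halfI => sw.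
have [w' sw'] := mayer_vietoris (@face_closed_in_open _) (@face_closed_in_open _)
  (@half_acyclic k false km) (@half_acyclic k true km) sw.
rewrite -halfU; apply: (spherical_big true (half_open k)).
rewrite (_ : small _ = (in_open (half k false) `|` in_open (half k true))%classic).
  exact: sw'.
apply/seteqP; split => x; first by case=> -[] xs; [right|left].
by case=> xs; [exists false|exists true].
Qed.

End SphereForms.
End Spherical.

(** * Complements of complex flats *)

Section ComplexTop.
Variable R : realType.
Local Open Scope complex_scope.

Lemma normc_ge_Im (x : R[i]) : `|complex.Im x|%:C <= `|x|.
Proof. by case: x => a b; rewrite normc_def lecR /= -sqrtr_sqr ler_wsqrtr // lerDr sqr_ge0. Qed.

Lemma Re_continuous : continuous (fun z : R[i]^o => complex.Re z : R).
Proof.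
move=> z A /nbhs_ballP [e /= e0 eA].
apply/(@nbhs_ballP R[i] (R[i]^o)); exists e%:C => /=; first by rewrite ltcR.
move=> y zy; apply: eA; move: zy; rewrite -!ball_normE /= => zy; rewrite -ltcR.
apply: le_lt_trans zy; rewrite -raddfB; exact: normc_ge_Re.
Qed.

Lemma Im_continuous : continuous (fun z : R[i]^o => complex.Im z : R).
Proof.
move=> z A /nbhs_ballP [e /= e0 eA].
apply/(@nbhs_ballP R[i] (R[i]^o)); exists e%:C => /=; first by rewrite ltcR.
move=> y zy; apply: eA; move: zy; rewrite -!ball_normE /= => zy; rewrite -ltcR.
apply: le_lt_trans zy; rewrite -raddfB; exact: normc_ge_Im.
Qed.

Lemma real_complex_continuous : continuous (fun r : R => r%:C : R[i]^o).
Proof.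
move=> r; apply/(@cvgrPdist_lt _ (R[i]^o)) => e e0.
have [/eqP ei er] : complex.Im e == 0 /\ 0 < complex.Re e.
  by move: e0; rewrite ltcE /= => /andP [] /eqP ->.
apply/nbhs_ballP; exists (complex.Re e) => //= y ry.
rewrite -raddfB /= normc_def /= expr0n addr0 sqrtr_sqr ltcE /= ei eqxx /=.
exact: ry.
Qed.

Lemma ctsDc (T : topologicalType) (f g : T -> R[i]^o) :
  continuous f -> continuous g -> continuous (fun x => f x + g x : R[i]^o).
Proof. exact: (@ctsD (R[i])). Qed.

Lemma ctsMc (T : topologicalType) (f g : T -> R[i]^o) :
  continuous f -> continuous g -> continuous (fun x => f x * g x : R[i]^o).
Proof. exact: (@ctsM (R[i])). Qed.

Lemma cts_sumc (T : topologicalType) (I : finType) (f : I -> T -> R[i]^o) :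
  (forall i, continuous (f i)) -> continuous (fun x => \sum_i f i x : R[i]^o).
Proof. exact: (@continuous_sum (R[i])). Qed.

Lemma cts_comp (S T U : topologicalType) (f : S -> T) (g : T -> U) :
  continuous f -> continuous g -> continuous (fun x => g (f x)).
Proof. by move=> cf cg x; exact: (continuous_comp (cf x) (cg (f x))). Qed.

Lemma cts_fst (S T : topologicalType) : continuous (fst : S * T -> S).
Proof. by move=> p; exact: cvg_fst. Qed.

Lemma cts_snd (S T : topologicalType) : continuous (snd : S * T -> T).
Proof. by move=> p; exact: cvg_snd. Qed.

Section Maps.
Variable n : nat.
Local Notation V := 'rV[R[i]^o]_n.

Lemma coord_ctsc i j : continuous (fun z : V => z i j).
Proof. exact: (@coord_continuous (R[i])). Qed.

Definition segment (b : V) (p : R * V) : V := p.1%:C *: p.2 + (1 - p.1)%:C *: b.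

Lemma segment_continuous b : continuous (segment b).
Proof.
apply: mx_continuous => i j.
rewrite (_ : (fun x => _) = fun p : R * V =>
  (p.1%:C * p.2 i j + (1 - p.1)%:C * b i j : R[i]^o)); last first.
  by apply/funext => p; rewrite !mxE.
have c1 : continuous (fun p : R * V => (1 - p.1)).
  by apply: ctsB; [exact: cts_cst|exact: cts_fst].
apply: ctsDc; apply: ctsMc.
- exact: cts_comp (@cts_fst _ _) real_complex_continuous.
- exact: cts_comp (@cts_snd _ _) (@coord_ctsc i j).
- exact: cts_comp c1 real_complex_continuous.
- by move=> p; exact: cst_continuous.
Qed.

HB.instance Definition _ b := isContinuous.Build _ _ (segment b) (@segment_continuous b).

Lemma mulmxr_continuousc m (A : 'M[R[i]^o]_(n, m)) :
  continuous (mulmxr A : V -> 'rV[R[i]^o]_m).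
Proof.
apply: mx_continuous => i j.
rewrite (_ : (fun x => _) = fun z : V => (\sum_k z i k * A k j : R[i]^o)); last first.
  by apply/funext => x; rewrite /= mxE.
apply: cts_sumc => k; apply: ctsMc; first exact: coord_ctsc.
by move=> p; exact: cst_continuous.
Qed.

Definition linc m (A : 'M[R[i]^o]_(n, m)) (z : V) : 'rV[R[i]^o]_m := z *m A.

HB.instance Definition _ m (A : 'M[R[i]^o]_(n, m)) :=
  isContinuous.Build _ _ (linc A) (@mulmxr_continuousc m A).

Definition punctured : set V := [set z | z != 0]%classic.

Definition realcoord (i : nat) (z : V) : R :=
  if insub i./2 is Some j then
    (if odd i then complex.Im (z 0 j) else complex.Re (z 0 j)) else 0.

Lemma realcoord_continuous i : continuous (realcoord i).
Proof.
rewrite /realcoord; case: insubP => [j _ _|_]; last exact: cts_cst.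
case: (odd i); apply: cts_comp (@coord_ctsc 0 j) _.
  exact: Im_continuous.
exact: Re_continuous.
Qed.

Definition realdual (s : bool) (i : nat) : V :=
  \row_j if (j : nat) == i./2 then
    if odd i then (0 +i* (-1) ^+ s)%C else ((-1) ^+ s +i* 0)%C else 0.

Lemma realcoord_segment i y r x :
  realcoord i (segment y (r, x)) = r * realcoord i x + (1 - r) * realcoord i y.
Proof.
rewrite /realcoord /segment /=; case: insubP => [j _ _|_]; last by rewrite !mulr0 addr0.
rewrite !mxE; case: (x 0 j) => a b; case: (y 0 j) => c d.
by case: (odd i); rewrite /= ?mul0r ?subr0 ?addr0.
Qed.

Lemma realcoord_dual s i j : (j <= i < n.*2)%N ->
  realcoord j (realdual s i) = if j == i then (-1) ^+ s else 0.
Proof.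
case/andP=> ji im; rewrite /realcoord.
have jn : (j./2 < n)%N by rewrite ltn_half_double (leq_ltn_trans ji).
rewrite (insubT (fun k => k < n)%N jn) mxE /=.
have [->|nji] := eqVneq j i; first by rewrite eqxx; case: (odd i).
case: eqP => [E|_]; last by case: ifP.
have : odd j != odd i.
  by apply: contra_neq nji => o; rewrite -(odd_double_half j) -(odd_double_half i) o E.
by case: (odd i); case: (odd j).
Qed.

Lemma realcoord_even (j : 'I_n) z : realcoord j.*2 z = complex.Re (z 0 j).
Proof.
rewrite /realcoord odd_double; case: insubP => [k _|]; rewrite doubleK ?ltn_ord //.
by move=> kj; congr (complex.Re (z 0 _)); exact: val_inj.
Qed.

Lemma realcoord_odd (j : 'I_n) z : realcoord j.*2.+1 z = complex.Im (z 0 j).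
Proof.
rewrite /realcoord /= odd_double /=; case: insubP => [k _|]; rewrite uphalf_double ?ltn_ord //.
by move=> kj; congr (complex.Im (z 0 _)); exact: val_inj.
Qed.

Lemma punctured_realcoord :
  punctured = [set x | exists2 i, (i < n.*2)%N & realcoord i x != 0]%classic.
Proof.
apply/seteqP; split => z /=; last first.
  move=> [i _]; apply: contra_neq => ->; rewrite /realcoord.
  by case: insubP => // j _ _; rewrite mxE; case: (odd i).
move=> /eqP z0; apply: contrapT => nex; apply: z0; apply/rowP => j; rewrite mxE.
have re0 : complex.Re (z 0 j) = 0.
  apply/eqP/negPn/negP => re0; apply: nex; exists j.*2; rewrite ?ltn_double //.
  by rewrite realcoord_even.
have im0 : complex.Im (z 0 j) = 0.
  apply/eqP/negPn/negP => im0; apply: nex; exists j.*2.+1; rewrite ?ltn_Sdouble //.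
  by rewrite realcoord_odd.
by case: (z 0 j) re0 im0 => a b /= -> ->.
Qed.

Lemma segment0 b x : segment b (0, x) = b.
Proof. by rewrite /segment /= -[0%:C]/(0 : R[i]) subr0 scale0r add0r scale1r. Qed.

Lemma segment1 b x : segment b (1, x) = x.
Proof. by rewrite /segment /= subrr -[0%:C]/(0 : R[i]) scale0r addr0 scale1r. Qed.

End Maps.

Lemma linc_comp m n k (A : 'M[R[i]^o]_(m, n)) (B : 'M[R[i]^o]_(n, k)) (x : simp R 'rV[R[i]^o]_m) :
  simp_push (linc B) (simp_push (linc A) x) = simp_push (linc (A *m B)) x.
Proof.
by rewrite simp_push_comp; apply: eq_simp_push => z; rewrite /= /linc mulmxA.
Qed.

Section PuncturedClass.
Variable K : fieldType.

Lemma nonzero_spherical m n (A : 'M[R[i]^o]_(n, m)) (B : 'M[R[i]^o]_(m, n)) :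
  B *m A = 1%:M ->
  exists w : simp R 'rV[R[i]^o]_n -> K,
    spherical (in_open [set z | z *m A != 0]%classic) m.*2 w.
Proof.
move=> BA.
have [||||s i j ji|s i im|w sw] := @sphere_forms R _ K
    (fun i z => realcoord i (linc A z)) (fun s i => linc B (realdual m s i))
    (fun b => segment b : continuousType _ _) _ _ _ _ m.*2 _ _ m.*2 (leqnn _).
- move=> i; exact: cts_comp (@mulmxr_continuousc _ _ A) (@realcoord_continuous _ i).
- by move=> y x; rewrite /= segment0.
- by move=> y x; rewrite /= segment1.
- move=> i y r x /=; rewrite -realcoord_segment; congr realcoord.
  by rewrite /linc /segment /= mulmxDl !scalemxAl.
- rewrite /linc -mulmxA BA mulmx1 realcoord_dual.
    by case/andP: ji => /ltn_eqF ->.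
  by case/andP: ji => /ltnW -> ->.
- by rewrite /linc -mulmxA BA mulmx1 realcoord_dual ?leqnn // eqxx.
exists w; rewrite (_ : [set z | z *m A != 0]%classic = [set x | exists2 i, (i < m.*2)%N & realcoord i (linc A x) != 0]%classic) //.
apply/seteqP; split => z zA.
  by have : punctured (z *m A) by []; rewrite punctured_realcoord.
by suff : punctured (z *m A) by []; rewrite punctured_realcoord.
Qed.

Lemma punctured_spherical n : exists w : simp R 'rV[R[i]^o]_n -> K,
  spherical (in_open (@punctured n)) n.*2 w.
Proof.
have [w sw] := nonzero_spherical (mulmx1 (1%:M : 'M[R[i]^o]_n)).
exists w; rewrite (_ : @punctured n = [set z | z *m 1%:M != 0]%classic) //.
by apply/seteqP; split => z /=; rewrite mulmx1.
Qed.

Definition sphere_class n : simp R 'rV[R[i]^o]_n -> K :=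
  projT1 (cid (@punctured_spherical n)).

Lemma sphere_classP n : spherical (in_open (@punctured n)) n.*2 (@sphere_class n).
Proof. exact: projT2 (cid (@punctured_spherical n)). Qed.

Lemma in_open_linc n m (A : 'M[R[i]^o]_(n, m)) (x : simp R 'rV[R[i]^o]_n) :
  in_open [set z | z *m A != 0]%classic x -> in_open (@punctured m) (simp_push (linc A) x).
Proof. exact: in_open_push. Qed.

Lemma pullback_spherical m n (A : 'M[R[i]^o]_(n, m)) (B : 'M[R[i]^o]_(m, n)) :
  B *m A = 1%:M ->
  spherical (in_open [set z | z *m A != 0]%classic) m.*2
    (fun x => sphere_class (simp_push (linc A) x)).
Proof.
move=> BA; have [w [wk wc wg w0]] := nonzero_spherical BA.
have [sk sc sg s0] := @sphere_classP m.
pose wA x := sphere_class (simp_push (linc A) x).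
have wAc : cocycle_on (in_open [set z | z *m A != 0]%classic) wA.
  move=> x xA; rewrite -[wA]/(@sphere_class m \o simp_push (linc A)) cob_push.
  by apply: sc; exact: in_open_linc.
have [a [e ae]] := wg _ wAc.
have a0 : a != 0.
  apply/eqP => a0; have /eqP := oner_neq0 K; apply.
  apply: (s0 1 (e \o simp_push (linc B))) => x xP.
  rewrite cob_push mul1r.
  have xB : in_open [set z | z *m A != 0]%classic (simp_push (linc B) x).
    apply: in_open_push xP => z /=; by rewrite /linc -mulmxA BA mulmx1.
  have := ae _ xB; rewrite a0 mul0r add0r => <-.
  rewrite /wA linc_comp BA; congr sphere_class; apply/esym.
  by apply: simp_push_id => z; rewrite /= /linc mulmx1.
split=> //.
- by move=> x /sk; rewrite ssize_push.
- move=> c /wg [a' [e' ae']]; exists (a' / a), (fun x => e' x - a' / a * e x) => x xA.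
  rewrite cobB cobZ ae' // -[sphere_class _]/(wA x) ae //.
  by rewrite mulrDr mulrA divfK // -addrA; congr (_ + _); rewrite addrC subrK.
move=> a' e' ae'.
have /eqP : a' * a = 0.
  apply: (w0 _ (fun x => e' x - a' * e x)) => x xA.
  rewrite cobB cobZ -ae' // -[sphere_class _]/(wA x) ae // mulrDr mulrA.
  by rewrite addrK.
by rewrite mulf_eq0 (negPf a0) orbF => /eqP.
Qed.

Lemma avoid_seq (l : seq R) : exists s, s \notin l.
Proof.
exists (1 + \sum_(b <- l) `|b|); apply/negP => sl.
have : `|1 + \sum_(b <- l) `|b| | <= \sum_(b <- l) `|b|.
  rewrite [leRHS](big_rem _ sl) /= lerDl; exact: sumr_ge0.
rewrite ger0_norm; last by rewrite addr_ge0 // sumr_ge0.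
by rewrite gerDr ler10.
Qed.

(* Paths from 0 to 1, disjoint outside of the end points. *)
Definition arc (s r : R) : R[i] := (r +i* (s * (r * (1 - r))))%C.

Lemma avoiding_arc (P : {poly R[i]}) : P.[0] != 0 -> P.[1] != 0 ->
  exists s, forall r, 0 <= r <= 1 -> P.[arc s r] != 0.
Proof.
move=> P0 P1; have [l Pl] := closed_field_poly_normal P.
have [s sl] := avoid_seq [seq complex.Im z / (complex.Re z * (1 - complex.Re z)) | z <- l].
exists s => r /andP [r0 r1].
have [->|rn0] := eqVneq r 0.
  by rewrite /arc subr0 mulr1 mulr0 -[(0 +i* 0)%C]/(0 : R[i]).
have [->|rn1] := eqVneq r 1.
  by rewrite /arc subrr !mulr0 -[(1 +i* 0)%C]/(1 : R[i]).
have lc0 : lead_coef P != 0 by apply: contraNneq P0 => /eqP; rewrite lead_coef_eq0 => /eqP ->; rewrite horner0.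
apply: contra sl => /eqP Ps; apply/mapP; exists (arc s r).
  have : root P (arc s r) by apply/rootP.
  by rewrite Pl rootZ // root_prod_XsubC.
by rewrite /arc /= mulfK // mulf_neq0 // subr_eq0 eq_sym.
Qed.

Lemma arc_continuous s : continuous (fun r => arc s r : R[i]^o).
Proof.
have -> : (fun r => arc s r : R[i]^o) = fun r => (r%:C + 'i%C * (s * (r * (1 - r)))%:C : R[i]^o).
  by apply/funext => r; rewrite /arc; simpc.
have cid : continuous (fun r : R => r) by move=> r; exact: cvg_id.
apply: ctsDc; first exact: real_complex_continuous.
apply: ctsMc; first by move=> r; exact: cst_continuous.
apply: cts_comp real_complex_continuous.
apply: ctsM; first exact: cts_cst.
by apply: ctsM => //; apply: ctsB => //; exact: cts_cst.
Qed.

Lemma unit_path n (M : 'M[R[i]]_n) : M \in unitmx ->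
  exists s, forall r, 0 <= r <= 1 -> 1%:M + arc s r *: (M - 1%:M) \in unitmx.
Proof.
move=> Mu; pose P : {poly R[i]} :=
  \det (map_mx polyC (1%:M : 'M[R[i]]_n) + 'X *: map_mx polyC (M - 1%:M)).
have PE t : P.[t] = \det (1%:M + t *: (M - 1%:M)).
  rewrite -[P.[t]]/(horner_eval t P) /P -det_map_mx; congr (\det _).
  by apply/matrixP => i j; rewrite !mxE /= /horner_eval !hornerE.
have [||s sP] := @avoiding_arc P.
- by rewrite PE scale0r addr0 det1 oner_neq0.
- by rewrite PE scale1r addrC subrK -unitfE -unitmxE.
by exists s => r /sP; rewrite PE unitmxE unitfE.
Qed.

Definition arc_map n (M : 'M[R[i]^o]_n) s (p : R * 'rV[R[i]^o]_n) : 'rV[R[i]^o]_n :=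
  p.2 *m (1%:M + arc s p.1 *: (M - 1%:M)).

Lemma arc_map_continuous n (M : 'M[R[i]^o]_n) s : continuous (arc_map M s).
Proof.
apply: mx_continuous => i j.
rewrite (_ : (fun x => _) = fun p : R * 'rV[R[i]^o]_n =>
  (\sum_k p.2 i k * ((k == j)%:R + arc s p.1 * (M - 1%:M) k j) : R[i]^o)); last first.
  apply/funext => p; rewrite /arc_map mxE; apply: eq_bigr => k _.
  by congr (_ * _); rewrite !mxE.
apply: cts_sumc => k; apply: ctsMc; first exact: cts_comp (@cts_snd _ _) (@coord_ctsc n i k).
apply: ctsDc; first by move=> p; exact: cst_continuous.
apply: ctsMc; last by move=> p; exact: cst_continuous.
exact: cts_comp (@cts_fst _ _) (@arc_continuous s).
Qed.

HB.instance Definition _ n (M : 'M[R[i]^o]_n) s :=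
  isContinuous.Build _ _ (arc_map M s) (@arc_map_continuous n M s).

Lemma sphere_class_unit n (M : 'M[R[i]^o]_n) : M \in unitmx ->
  exists e, forall x, in_open (@punctured n) x ->
    sphere_class (simp_push (linc M) x) - sphere_class x = cob e x.
Proof.
move=> Mu; have [s sP] := unit_path Mu.
have [_ sc _ _] := @sphere_classP n.
have H r (x : 'rV[R[i]^o]_n) : 0 <= r <= 1 -> punctured x -> punctured (arc_map M s (r, x)).
  move=> /sP r01; apply: contra_neq => E.
  by rewrite -[x](mulmxK r01) -[x *m _]/(arc_map M s (r, x)) E mul0mx.
exists (prism (arc_map M s) (@sphere_class n)) => x xP.
rewrite -(homotopy_invariance H sc xP); congr (_ - _).
  congr (@sphere_class n _); apply: eq_simp_push => z; rewrite /= /slice /= /arc_map /= /linc.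
  by rewrite /arc subrr !mulr0 -[(1 +i* 0)%C]/(1 : R[i]) scale1r addrC subrK.
congr (@sphere_class n _); apply/esym/simp_push_id => z; rewrite /slice /= /arc_map /=.
by rewrite /arc mul0r mulr0 -[(0 +i* 0)%C]/(0 : R[i]) scale0r addr0 mulmx1.
Qed.

Definition flat_class n (B : 'M[R[i]^o]_n) (x : simp R 'rV[R[i]^o]_n) : K :=
  sphere_class (simp_push (linc (row_base B)^T) x).

Lemma flat_class_spherical n (B : 'M[R[i]^o]_n) :
  spherical (in_open [set z | z *m B^T != 0]%classic) (\rank B).*2 (flat_class B).
Proof.
have /row_freeP [A BA] := row_base_free B.
have /pullback_spherical : A^T *m (row_base B)^T = 1%:M by rewrite -trmx_mul BA trmx1.
rewrite (_ : [set z | z *m B^T != 0]%classic = [set z | z *m (row_base B)^T != 0]%classic) //.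
apply/seteqP; split => z /=; apply: contra_neq => zB.
  have /submxP [D ->] : (B <= row_base B)%MS by rewrite eq_row_base.
  by rewrite trmx_mul mulmxA zB mul0mx.
have /submxP [D ->] : (row_base B <= B)%MS by rewrite eq_row_base.
by rewrite trmx_mul mulmxA zB mul0mx.
Qed.

Lemma flat_class_unique n m (B : 'M[R[i]^o]_n) (A : 'M[R[i]^o]_(m, n)) :
  row_free A -> (A :=: B)%MS ->
  exists e, forall x, in_open [set z | z *m B^T != 0]%classic x ->
    sphere_class (simp_push (linc A^T) x) - flat_class B x = cob e x.
Proof.
move=> fA AB; have rm : m = \rank B by rewrite -AB; apply/esym/eqP.
subst m; have /submxP [M AM] : (A <= row_base B)%MS by rewrite eq_row_base AB.
have Mu : M^T \in unitmx.
  rewrite unitmx_tr -row_free_unit; apply/row_freeP.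
  have /row_freeP [C AC] := fA; exists (row_base B *m C).
  by rewrite mulmxA -AM.
have [e eP] := sphere_class_unit Mu.
exists (e \o simp_push (linc (row_base B)^T)) => x xB.
rewrite cob_push -eP.
  by rewrite linc_comp -trmx_mul -AM.
apply: in_open_push xB => z /=; apply: contra_neq; rewrite /linc => zB.
have /submxP [D ->] : (B <= row_base B)%MS by rewrite eq_row_base.
by rewrite trmx_mul mulmxA zB mul0mx.
Qed.

End PuncturedClass.

End ComplexTop.

(** * The total complex of an arrangement *)

Section Total.
Variables (R : realType) (X : topologicalType) (K : numFieldType) (I : finType).
Variable A : I -> set (simp R X).
Hypothesis A_face : forall h, face_closed (A h).
Local Notation cochains := ({set I} -> simp R X -> K).
Implicit Types (J : {set I}) (phi psi : cochains) (x : simp R X).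

(* The simplices avoiding some hyperplane of [J]; for [J] empty, those avoiding
   all hyperplanes. *)
Definition avoid J : set (simp R X) :=
  [set x | if J == finset.set0 then forall h, A h x else exists2 h, h \in J & A h x]%classic.

Lemma avoid_face J : face_closed (avoid J).
Proof.
move=> x y xy; rewrite /avoid /=; case: ifP => _; first by move=> Ax h; exact: A_face xy _.
by case=> h hJ Ax; exists h => //; exact: A_face xy _.
Qed.

Lemma avoidU h J x : avoid J x -> avoid (h |: J) x.
Proof.
have -> : avoid (h |: J) x = exists2 k, k \in h |: J & A k x.
  by rewrite /avoid /= (_ : (_ == _) = false) //; apply/negbTE/finset.set0Pn; exists h; rewrite finset.setU11.
rewrite /avoid /=.
case: ifP => _; first by move=> /(_ h) Ax; exists h; rewrite // finset.setU11.
by case=> k kJ Ak; exists k; rewrite // finset.setU1r.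
Qed.

Definition tdiff phi : cochains :=
  fun J x => (-1) ^+ #|J| * cob (phi J) x + dK (phi^~ x) J.

Lemma tdiffD phi psi J x :
  tdiff (fun L y => phi L y + psi L y) J x = tdiff phi J x + tdiff psi J x.
Proof. by rewrite /tdiff cobD dKD mulrDr addrACA. Qed.

Lemma tdiffZ a phi J x : tdiff (fun L y => a * phi L y) J x = a * tdiff phi J x.
Proof. by rewrite /tdiff cobZ dKZ mulrDr mulrCA. Qed.

Lemma tdiffB phi psi J x :
  tdiff (fun L y => phi L y - psi L y) J x = tdiff phi J x - tdiff psi J x.
Proof.
rewrite -[in RHS]mulN1r -tdiffZ -tdiffD; congr (tdiff _ J x).
by apply/funext => L; apply/funext => y; rewrite mulN1r.
Qed.

Lemma tdiff0 J x : tdiff (fun _ _ => 0) J x = 0.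
Proof. by rewrite /tdiff cob0 mulr0 add0r /dK big1 // => h _; rewrite mulr0. Qed.

Lemma cob_dK phi J x : cob (fun y => dK (phi^~ y) J) x = dK (fun L => cob (phi L) x) J.
Proof. by rewrite /dK cob_sum; apply: eq_bigr => h _; rewrite cobZ. Qed.

Lemma tdiff_tdiff phi J x : tdiff (tdiff phi) J x = 0.
Proof.
rewrite {1}/tdiff.
have -> : cob (tdiff phi J) x = dK (fun L => cob (phi L) x) J.
  by rewrite /tdiff cobD cobZ cob_cob mulr0 add0r cob_dK.
have -> : dK ((tdiff phi)^~ x) J = - (-1) ^+ #|J| * dK (fun L => cob (phi L) x) J.
  rewrite /tdiff dKD dK_dK addr0 -dKZ; apply: dK_local => h hJ.
  by rewrite cardsU1 hJ exprS mulN1r.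
by rewrite mulNr subrr.
Qed.

Definition graded (d : int) phi := forall J x, phi J x != 0 -> (ssize x)%:Z = #|J|%:Z + d.

Definition grade (d : int) phi : cochains :=
  fun J x => if (ssize x)%:Z == #|J|%:Z + d then phi J x else 0.

Lemma graded_grade d phi : graded d (grade d phi).
Proof. by move=> J x; rewrite /grade; case: (_ =P _ :> int) => //; rewrite eqxx. Qed.

Lemma grade_id d phi J x : graded d phi -> grade d phi J x = phi J x.
Proof.
move=> gd; rewrite /grade; case: eqP => // nd.
by apply/esym/eqP/negPn/negP => /gd.
Qed.

Lemma tdiff_grade d phi J x : tdiff (grade d phi) J x = grade (d + 1) (tdiff phi) J x.
Proof.
have -> : grade (d + 1) (tdiff phi) J x = ((ssize x)%:Z == #|J|%:Z + (d + 1))%:R * tdiff phi J x.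
  by rewrite /grade; case: ifP; rewrite ?mul1r ?mul0r.
rewrite /tdiff mulrDr mulrCA; congr (_ * _ + _).
  rewrite -cobZ; apply: cob_local => y /is_face_size ->.
  rewrite /grade -[(ssize y).+1]addn1 PoszD addrA (inj_eq (addIr _)).
  by case: ifP; rewrite ?mul1r ?mul0r.
rewrite -dKZ; apply: dK_local => h hJ; rewrite /grade (_ : #|h |: J|%:Z + d = #|J|%:Z + (d + 1)); last first.
  by rewrite cardsU1 hJ; lia.
by case: ifP; rewrite ?mul1r ?mul0r.
Qed.

Lemma graded_tdiff d phi : graded d phi -> graded (d + 1) (tdiff phi).
Proof.
move=> gd; have -> : tdiff phi = grade (d + 1) (tdiff phi); last exact: graded_grade.
apply/funext => J; apply/funext => x; rewrite -tdiff_grade.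
by congr (tdiff _ J x); apply/funext => L; apply/funext => y; rewrite grade_id.
Qed.

Lemma gradedB d phi psi : graded d phi -> graded d psi ->
  graded d (fun J x => phi J x - psi J x).
Proof.
move=> g1 g2 J x; have [p0|/g1 //] := eqVneq (phi J x) 0.
by rewrite p0 sub0r oppr_eq0 => /g2.
Qed.

Lemma gradeB d phi psi J x : grade d (fun J x => phi J x - psi J x) J x =
  grade d phi J x - grade d psi J x.
Proof. by rewrite /grade; case: ifP => _; rewrite ?subr0. Qed.

Section Acyclic.
Variable i0 : I.

Definition met x : I := xget i0 [set h | ~ A h x]%classic.

Definition tkap phi : cochains := fun J x => kap (met x) (phi^~ x) J.

Lemma avoid_met J x : avoid J x -> avoid (J :\ met x) x.
Proof.
rewrite /avoid /=; case: (J =P finset.set0) => [->|_ [h hJ Ah]].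
  by rewrite finset.set0D eqxx.
have [Am|nAm] := pselect (A (met x) x).
  have all h' : A h' x.
    by apply: contrapT => nA; have := @xgetPex _ i0 [set h | ~ A h x]%classic (ex_intro _ h' nA).
  case: ifP => [//|/negbT /finset.set0Pn [k kJ]]; by exists k.
have hm : h != met x by apply: contra_notN nAm => /eqP <-.
case: ifP => [/eqP E|_]; last by exists h => //; rewrite !inE hm.
by have := finset.in_set0 h; rewrite -E !inE hm hJ.
Qed.

Lemma tkap_local phi psi J x : avoid J x ->
  (forall J' y, avoid J' y -> phi J' y = psi J' y) -> tkap phi J x = tkap psi J x.
Proof.
by move=> Px pp; rewrite /tkap /kap; case: ifP => // _; rewrite pp //; exact: avoid_met.
Qed.

Lemma total_acyclic phi : (forall J x, avoid J x -> tdiff phi J x = 0) ->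
  exists psi, forall J x, avoid J x -> phi J x = tdiff psi J x.
Proof.
have [m] := ubnP #|I|.+1; move: (m) => k.
suff H p : forall phi, (forall J x, avoid J x -> tdiff phi J x = 0) ->
    (forall J x, avoid J x -> (#|J| < #|I|.+1 - p)%N -> phi J x = 0) ->
    exists psi, forall J x, avoid J x -> phi J x = tdiff psi J x.
  by move=> _ c; apply: (H #|I|.+1) => // J x _; rewrite subnn.
elim: p => [|p IH] {}phi c v.
  exists (fun _ _ => 0) => J x Px; rewrite tdiff0 v // subn0 ltnS; exact: max_card.
pose N : cochains := fun J x => phi J x - tdiff (tkap phi) J x.
have NE J x : N J x = tkap (tdiff phi) J x - (tkap (fun J x => (-1) ^+ #|J| * cob (phi J) x) J x
     + (-1) ^+ #|J| * cob (tkap phi J) x).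
  rewrite /N {1}/tdiff -[phi J x in LHS](dK_kap (met x) (phi^~ x) J) -/(tkap phi _ _).
  have -> : tkap (tdiff phi) J x = tkap (fun J x => (-1) ^+ #|J| * cob (phi J) x) J x + kap (met x) (dK (phi^~ x)) J.
    by rewrite /tkap /kap /tdiff; case: ifP; rewrite ?addr0 ?mulrDr.
  have -> : dK ((tkap phi)^~ x) J = dK (kap (met x) (phi^~ x)) J by [].
  ring.
have [||psi psiP] := IH N.
- by move=> J x Px; rewrite tdiffB c // tdiff_tdiff subrr.
- move=> J x Px Jp; rewrite NE (tkap_local (psi := fun _ _ => 0)) //.
  have k0 L y : avoid L y -> (#|L| < #|I|.+1 - p)%N -> tkap phi L y = 0.
    move=> Ly Lp; rewrite /tkap /kap; case: ifP => // mL.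
    rewrite v ?mulr0 //; first exact: avoid_met.
    by move: Lp; rewrite (cardsD1 (met y)) mL; lia.
  rewrite {1 2}/tkap /kap; case: ifP => mJ; last first.
    rewrite (cob_local (e := fun=> 0)) ?cob0 ?mulr0 ?addr0 ?subr0 // => y xy.
    by apply: k0 => //; exact: avoid_face xy Px.
  rewrite (cob_local (e := fun=> 0)) ?cob0; last first.
    move=> y xy; apply: v; first exact: avoid_face xy (avoid_met Px).
    by move: Jp; rewrite (cardsD1 (met x)) mJ; lia.
  rewrite (cob_local (e := fun=> 0) (x := x)) ?cob0 ?mulr0 ?addr0 ?subr0 // => y xy.
  by apply: k0 => //; exact: avoid_face xy Px.
exists (fun J x => psi J x + tkap phi J x) => J x Px.
by rewrite tdiffD -psiP // /N subrK.
Qed.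

End Acyclic.
End Total.

(** * The rank filtration *)

Section Filtration.
Variables (R : realType) (X : topologicalType) (K : numFieldType) (I : finType).
Variables (i0 : I) (A : I -> set (simp R X)).
Hypothesis A_face : forall h, face_closed (A h).
Variable rk : {set I} -> nat.
Hypothesis rk_mono : forall h J, (rk J <= rk (h |: J))%N.
Hypothesis rk_unit : forall h J, (rk (h |: J) <= (rk J).+1)%N.
Hypothesis rk_loop : forall h (L L' : {set I}), L \subset L' ->
  rk (h |: L) = rk L -> rk (h |: L') = rk L'.
Hypothesis rk0 : rk finset.set0 = 0%N.
Hypothesis rk_gt0 : forall J, J != finset.set0 -> (0 < rk J)%N.
Variable om : {set I} -> simp R X -> K.
Hypothesis om_spherical : forall J, J != finset.set0 ->
  spherical (avoid A J) (rk J).*2 (om J).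
Hypothesis om_flat : forall h J, rk (h |: J) = rk J -> om (h |: J) = om J.

Local Notation cochains := ({set I} -> simp R X -> K).
Implicit Types (J : {set I}) (phi psi : cochains) (x : simp R X).
Implicit Types (a b : {set I} -> K).
Local Notation P := (avoid A).
Local Notation D := (@tdiff R X K I).

Definition filt c phi := forall J x, P J x -> (c < rk J)%N -> phi J x = 0.

Definition supp (Q : pred {set I}) a := forall J, ~~ Q J -> a J = 0.

Definition suppc c psi := forall J, rk J != c -> psi J = (fun=> 0).

Definition tens a : cochains := fun J x => a J * om J x.

Definition level c : pred {set I} := fun J => rk J == c.
Definition indep c : pred {set I} := fun J => (rk J == c) && (#|J| == c).

Lemma rk_le_card J : (rk J <= #|J|)%N.
Proof.
by have := rk_card rk_unit J finset.set0; rewrite finset.setU0 rk0 addn0.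
Qed.

Lemma level_neq0 c J : (0 < c)%N -> rk J = c -> J != finset.set0.
Proof. by move=> c0 Jc; apply: contraTneq c0 => J0; rewrite -Jc J0 rk0. Qed.

Lemma tens_diff c a J x : (0 < c)%N -> supp (level c) a -> rk J = c -> P J x ->
  D (tens a) J x = dK a J * om J x.
Proof.
move=> c0 sa Jc Px; rewrite /tdiff /tens.
have [_ oc _ _] := om_spherical (level_neq0 c0 Jc).
rewrite cobZ oc // !mulr0 add0r /dK mulr_suml; apply: eq_bigr => h hJ.
case: (eqVneq (rk (h |: J)) c) => [hc|hc]; first by rewrite om_flat ?hc ?Jc // mulrA.
by rewrite sa // !(mul0r, mulr0).
Qed.

Lemma supp_indep c a : supp (indep c) a -> supp (level c) a.
Proof. by move=> sa J JL; apply: sa; rewrite /indep negb_and JL. Qed.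

Lemma suppc_diff c psi J x : suppc c psi -> (c < rk J)%N -> D psi J x = 0.
Proof.
move=> sp cJ; rewrite /tdiff sp ?gtn_eqF // cob0 mulr0 add0r /dK big1 // => h _.
by rewrite sp ?mulr0 // gtn_eqF // (leq_trans cJ).
Qed.

Lemma tdiff_near phi psi J x : P J x ->
  (forall y, P J y -> phi J y = psi J y) ->
  (forall h, h \notin J -> P (h |: J) x -> phi (h |: J) x = psi (h |: J) x) ->
  D phi J x = D psi J x.
Proof.
move=> Px e1 e2; rewrite /tdiff; congr (_ * _ + _).
  by apply: cob_local => y xy; apply: e1; exact: avoid_face xy Px.
by apply: dK_local => h hJ; apply: e2 => //; exact: avoidU.
Qed.

Lemma filt_diff c phi : filt c phi -> filt c (D phi).
Proof.
move=> fp J x Px cJ; rewrite -[RHS](@tdiff0 R X K I J x).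
apply: tdiff_near => // [y Py|h hJ hx]; apply: fp => //.
exact: leq_trans cJ (rk_mono _ _).
Qed.

Lemma filtB c phi psi : filt c phi -> filt c psi -> filt c (fun J x => phi J x - psi J x).
Proof. by move=> f1 f2 J x Px cJ; rewrite f1 // f2 // subrr. Qed.

Lemma suppc_filt c psi : suppc c psi -> filt c psi.
Proof. by move=> sp J x _ cJ; rewrite sp // gtn_eqF. Qed.

Lemma supp_tens c a : supp (level c) a -> suppc c (tens a).
Proof. by move=> sa J JL; apply/funext => x; rewrite /tens sa ?mul0r. Qed.

Lemma suppc_grade c d psi : suppc c psi -> suppc c (grade d psi).
Proof. by move=> sp J JL; apply/funext => x; rewrite /grade sp // if_same. Qed.

Lemma graded_tens c m a : (0 < c)%N ->
  (forall J, a J != 0 -> rk J = c /\ #|J| = m) -> graded (c.*2%:Z - m%:Z) (tens a).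
Proof.
move=> c0 sa J x; rewrite /tens mulf_eq0 negb_or => /andP [/sa [rJ cJ] oJ].
have [/(_ x oJ) -> _ _ _] := om_spherical (level_neq0 c0 rJ).
by rewrite rJ cJ; lia.
Qed.

Lemma om_cancel c s J : (0 < c)%N -> rk J = c -> (forall x, P J x -> s * om J x = 0) -> s = 0.
Proof.
move=> c0 rJ s0; have [_ _ _ inj] := om_spherical (level_neq0 c0 rJ).
by apply: (inj s (fun=> 0)) => x Px; rewrite s0 // cob0.
Qed.

Lemma level_analysis_rec c p phi a' : (0 < c)%N -> filt c phi ->
  (forall J x, rk J = c -> P J x -> D phi J x = a' J * om J x) ->
  (forall J x, rk J = c -> P J x -> (p < #|J|)%N -> phi J x = 0) ->
  exists a psi, [/\ supp (level c) a, suppc c psi &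
    forall J x, rk J = c -> P J x -> phi J x = a J * om J x + D psi J x].
Proof.
move=> c0; elim: p phi a' => [|p IH] phi a' fp Dp vp.
  exists (fun=> 0), (fun _ _ => 0); split=> // J x rJ Px.
  rewrite mul0r add0r tdiff0 vp // lt0n cards_eq0; exact: level_neq0 rJ.
have nextvp J x h : rk J = c -> #|J| = p.+1 -> h \notin J -> P J x -> phi (h |: J) x = 0.
  move=> rJ cJ hJ Px; have Phx : P (h |: J) x by exact: avoidU.
  have [hc|hc] := eqVneq (rk (h |: J)) c; first by apply: vp => //; rewrite cardsU1 hJ cJ.
  by apply: fp => //; rewrite ltn_neqAle eq_sym hc -rJ rk_mono.
have ex J : exists ab : K * (simp R X -> K), rk J = c -> #|J| = p.+1 ->
    forall x, P J x -> phi J x = ab.1 * om J x + cob ab.2 x.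
  have [rJ|] := eqVneq (rk J) c; last by move=> n; exists (0, fun=> 0) => E; rewrite E eqxx in n.
  have [cJ|] := eqVneq #|J| p.+1; last by move=> n; exists (0, fun=> 0) => _ E; rewrite E eqxx in n.
  have [_ oc og oi] := om_spherical (level_neq0 c0 rJ).
  have E x : P J x -> D phi J x = (-1) ^+ #|J| * cob (phi J) x.
    move=> Px; rewrite /tdiff /dK big1 ?addr0 // => h hJ.
    by rewrite (nextvp _ _ h rJ cJ) ?mulr0.
  have a'0 : a' J = 0.
    apply: (oi _ (fun y => (-1) ^+ #|J| * phi J y)) => x Px.
    by rewrite -Dp // E // cobZ.
  have [|a [b ab]] := og (phi J).
    move=> x Px; have /eqP := E x Px; rewrite Dp // a'0 mul0r eq_sym mulf_eq0 signr_eq0.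
    by move=> /eqP.
  by exists (a, b).
have {ex} [ab abP] := choice ex.
pose top J := (rk J == c) && (#|J| == p.+1).
pose a0 J : K := if top J then (ab J).1 else 0.
pose b0 : cochains := fun J x => if top J then (-1) ^+ #|J| * (ab J).2 x else 0.
have sa0 : supp (level c) a0 by move=> J; rewrite /a0 /level /top => /negPf ->.
have sb0 : suppc c b0 by move=> J; rewrite /b0 /top => /negPf ->.
pose phi1 : cochains := fun J x => phi J x - tens a0 J x - D b0 J x.
have fphi1 : filt c phi1.
  by apply: filtB; [apply: filtB => //; exact: suppc_filt (supp_tens sa0)|exact: filt_diff (suppc_filt sb0)].
pose a1 J : K := if rk J == c then a' J - dK a0 J else 0.
have [||a [psi [sa sp E]]] := IH phi1 a1 fphi1.
- move=> J x rJ Px; rewrite !tdiffB tdiff_tdiff subr0 Dp // (tens_diff c0 sa0) //.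
  by rewrite /a1 rJ eqxx mulrBl.
- move=> J x rJ Px pJ; rewrite /phi1.
  have [cJ|ncJ] := eqVneq #|J| p.+1.
    have tJ : top J by rewrite /top rJ cJ !eqxx.
    rewrite /tens /a0 tJ (abP J rJ cJ x Px) [_ + cob _ _]addrC addrK /tdiff.
    rewrite /dK big1 ?addr0; last first.
      by move=> h hJ; rewrite /b0 /top cardsU1 hJ cJ add1n eqSS (gtn_eqF (ltnSn _)) andbF mulr0.
    rewrite [cob (b0 J) x](_ : _ = (-1) ^+ #|J| * cob (ab J).2 x).
      by rewrite mulrA -expr2 sqrr_sign mul1r subrr.
    by rewrite -cobZ; apply: cob_local => y _; rewrite /b0 tJ.
  have pJ' : (p.+1 < #|J|)%N by rewrite ltn_neqAle eq_sym ncJ.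
  rewrite vp // /tens /a0 /top (negPf ncJ) andbF mul0r subr0 sub0r.
  have -> : D b0 J x = D (fun _ _ => 0) J x.
    apply: tdiff_near => // [y _|h hJ _]; rewrite /b0 /top ?(negPf ncJ) ?andbF //.
    by rewrite cardsU1 hJ (gtn_eqF (leq_trans pJ' _)) ?andbF // leq_addl.
  by rewrite tdiff0 oppr0.
exists (fun J => a J + a0 J), (fun J x => psi J x + b0 J x); split.
- by move=> J JL; rewrite sa // sa0 // addr0.
- by move=> J JL; apply/funext => x; rewrite sp // sb0 // addr0.
move=> J x rJ Px; rewrite tdiffD mulrDl addrACA -E // /phi1 /tens; ring.
Qed.

Lemma level_analysis c phi a' : (0 < c)%N -> filt c phi ->
  (forall J x, rk J = c -> P J x -> D phi J x = a' J * om J x) ->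
  exists a psi, [/\ supp (level c) a, suppc c psi &
    forall J x, rk J = c -> P J x -> phi J x = a J * om J x + D psi J x].
Proof.
move=> c0 fp Dp; apply: (@level_analysis_rec c #|I| phi a') => // J x _ _.
by rewrite ltnNge max_card.
Qed.

Lemma level_diff c phi a psi : (0 < c)%N -> filt c phi ->
  supp (level c) a -> suppc c psi ->
  (forall J x, rk J = c -> P J x -> phi J x = a J * om J x + D psi J x) ->
  forall J x, rk J = c -> P J x -> D phi J x = dK a J * om J x.
Proof.
move=> c0 fp sa sp E J x rJ Px.
rewrite -(tens_diff c0 sa rJ Px) -[RHS]addr0 -(tdiff_tdiff psi J x) -tdiffD.
apply: tdiff_near => // [y Py|h hJ hx]; first exact: E.
have [hc|hc] := eqVneq (rk (h |: J)) c; first exact: E.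
have ch : (c < rk (h |: J))%N by rewrite ltn_neqAle eq_sym hc -rJ rk_mono.
by rewrite fp // (suppc_diff _ sp) // (supp_tens sa) // addr0.
Qed.

Lemma level_cocycle c phi : (0 < c)%N -> filt c phi ->
  (forall J x, rk J = c -> P J x -> D phi J x = 0) ->
  exists a psi, [/\ supp (indep c) a, suppc c psi &
    forall J x, rk J = c -> P J x -> phi J x = a J * om J x + D psi J x].
Proof.
move=> c0 fp Dp.
have [|a [psi [sa sp E]]] := @level_analysis c phi (fun=> 0) c0 fp.
  by move=> J x rJ Px; rewrite mul0r Dp.
have da J : rk J = c -> dK a J = 0.
  move=> rJ; apply: (om_cancel c0 rJ) => x Px.
  by rewrite -(level_diff c0 fp sa sp E rJ Px) Dp.
have famE J : fam rk finset.setT finset.set0 c J = (rk J == c).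
  by rewrite /fam finset.subsetT finset.setU0.
have [||b [sb ab]] := @matroid_exact K I rk rk_mono rk_unit rk_loop finset.setT finset.set0 c a.
- by move=> J; rewrite famE; exact: sa.
- by move=> J; rewrite famE => /eqP; exact: da.
have sb' : supp (level c) b by move=> J JL; apply: sb; rewrite famE.
exists (fun J => if indep c J then a J - dK b J else 0), (fun J x => psi J x + tens b J x).
split.
- by move=> J /negPf ->.
- by move=> J JL; apply/funext => x; rewrite sp // (supp_tens sb') // addr0.
move=> J x rJ Px; rewrite tdiffD (tens_diff c0 sb' rJ Px) E //.
set S := D psi J x; set i := (if _ then _ else _).
suff -> : a J * om J x = i * om J x + dK b J * om J x by clearbody S i; ring.
rewrite {}/i.
rewrite /indep rJ eqxx /=; case: eqP => cJ; first by rewrite mulrBl subrK.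
rewrite mul0r add0r (ab J) ?famE ?rJ //.
by rewrite rk0 addn0; apply/eqP.
Qed.

Lemma level_cocycle_graded c d phi : (0 < c)%N -> filt c phi -> graded d phi ->
  (forall J x, rk J = c -> P J x -> D phi J x = 0) ->
  exists a psi, [/\ supp (indep c) a, suppc c psi, graded (d - 1) psi,
    (d != c%:Z -> forall J, a J = 0) &
    forall J x, rk J = c -> P J x -> phi J x = a J * om J x + D psi J x].
Proof.
move=> c0 fp gp Dp; have [a [psi [sa sp E]]] := level_cocycle c0 fp Dp.
exists (fun J => if d == c%:Z then a J else 0), (grade (d - 1) psi); split.
- by move=> J /sa ->; rewrite if_same.
- exact: suppc_grade.
- exact: graded_grade.
- by move=> /negPf ->.
move=> J x rJ Px; rewrite tdiff_grade subrK.
have gt : graded c%:Z (tens a).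
  have := @graded_tens c c a c0; rewrite (_ : c.*2%:Z - c%:Z = c%:Z); last by lia.
  by apply=> L aL; have /andP [/eqP -> /eqP ->] : indep c L by apply: contraNT aL => /sa ->.
rewrite -(grade_id J x gp).
have -> : grade d phi J x = grade d (fun L y => tens a L y + D psi L y) J x.
  by rewrite /grade E.
rewrite /grade; case: eqP => dJ; last first.
  case: eqP => dc; rewrite ?mul0r ?addr0 //.
  apply/esym/eqP; rewrite -/(tens a J x); apply/negPn/negP => /gt; by rewrite -dc.
congr (_ + _); case: eqP => dc //; rewrite mul0r.
by apply/eqP/negPn/negP => /gt E'; apply: dc; move: dJ; rewrite E'; lia.
Qed.

Lemma push_down c0 c d phi : filt c phi -> graded d phi ->
  (forall J x, (c0 < rk J)%N -> P J x -> D phi J x = 0) ->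
  (forall j, (c0 < j <= c)%N -> d != j%:Z) ->
  exists psi, [/\ graded (d - 1) psi, forall J, (c < rk J)%N -> psi J = (fun=> 0) &
    filt c0 (fun J x => phi J x - D psi J x)].
Proof.
elim: c phi => [|c IH] phi fp gp Dp dj.
  exists (fun _ _ => 0); split=> // [J x|J x Px cJ]; first by rewrite eqxx.
  by rewrite tdiff0 subr0 fp // (leq_ltn_trans _ cJ).
have [cc|cc] := leqP c.+1 c0.
  exists (fun _ _ => 0); split=> // [J x|J x Px cJ]; first by rewrite eqxx.
  by rewrite tdiff0 subr0 fp // (leq_ltn_trans cc cJ).
have [|a [psi [sa sp gpsi a0 E]]] := level_cocycle_graded (ltn0Sn c) fp gp.
  by move=> J x rJ Px; apply: Dp => //; rewrite rJ.
have {}a0 := a0 (dj c.+1 _); rewrite cc leqnn in a0; have {}a0 := a0 isT.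
have [||||psi' [gpsi' sp' fpsi']] := IH (fun J x => phi J x - D psi J x).
- move=> J x Px; rewrite leq_eqVlt => /orP [/eqP rJ|rJ].
    by rewrite E // a0 mul0r add0r subrr.
  by rewrite fp // (suppc_diff _ sp) // subr0.
- by apply: gradedB => //; rewrite -[d](subrK 1); exact: graded_tdiff.
- by move=> J x rJ Px; rewrite tdiffB tdiff_tdiff subr0 Dp.
- by move=> j /andP [j0 jc]; apply: dj; rewrite j0 (leq_trans jc).
exists (fun J x => psi J x + psi' J x); split.
- move=> J x; have [p0|/gpsi //] := eqVneq (psi J x) 0.
  by rewrite p0 add0r => /gpsi'.
- move=> J cJ; apply/funext => x; rewrite sp ?gtn_eqF // sp' ?addr0 //.
  exact: ltnW.
move=> J x Px cJ; rewrite tdiffD opprD addrA; exact: fpsi'.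
Qed.

Lemma gradedBD d phi psi : graded d phi -> graded (d - 1) psi ->
  graded d (fun J x => phi J x - D psi J x).
Proof.
by move=> gp gs; apply: gradedB => //; rewrite -[d](subrK 1); exact: graded_tdiff.
Qed.

(* [eta] is the class of the complement attached to [a] in the spectral sequence of
   the rank filtration; a relation, since [phi] is not determined by [a]. *)
Definition repr d a (eta : simp R X -> K) := exists phi,
  [/\ filt d phi, graded d%:Z phi,
      forall J x, rk J = d -> P J x -> phi J x = a J * om J x,
      forall J x, J != finset.set0 -> P J x -> D phi J x = 0
    & forall x, P finset.set0 x -> eta x = D phi finset.set0 x].

Lemma rk_eq0 J : (0 < rk J)%N = (J != finset.set0).
Proof. by have [->|/rk_gt0 //] := eqVneq J finset.set0; rewrite rk0. Qed.

Lemma dK_set0 (f : {set I} -> K) : (forall h, f [set h]%SET = 0) -> dK f finset.set0 = 0.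
Proof. by move=> f0; rewrite /dK big1 // => h _; rewrite finset.setU0 f0 mulr0. Qed.

Lemma set1_neq0 h : [set h]%SET != finset.set0 :> {set I}.
Proof. by apply/finset.set0Pn; exists h; rewrite finset.set11. Qed.

Lemma repr_cocycle d a eta : repr d a eta -> cocycle_on (P finset.set0) eta.
Proof.
move=> [phi [_ _ _ Dp ep]] x Px.
rewrite (cob_eq_on (@avoid_face _ _ _ _ A_face finset.set0) ep Px).
have := tdiff_tdiff phi finset.set0 x.
rewrite {1}/tdiff cards0 expr0 mul1r dK_set0 ?addr0 // => h.
rewrite Dp ?set1_neq0 //; by rewrite -[[set h]%SET]finset.setU0; apply: avoidU.
Qed.

Lemma repr_lin d a a' eta eta' s : repr d a eta -> repr d a' eta' ->
  repr d (fun J => s * a J + a' J) (fun x => s * eta x + eta' x).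
Proof.
move=> [p [f1 g1 t1 D1 e1]] [p' [f2 g2 t2 D2 e2]].
exists (fun J x => s * p J x + p' J x); split.
- by move=> J x Px rJ; rewrite f1 // f2 // mulr0 addr0.
- move=> J x; have [p0|/g1 //] := eqVneq (p J x) 0.
  by rewrite p0 mulr0 add0r => /g2.
- by move=> J x rJ Px; rewrite t1 // t2 // mulrDl mulrA.
- by move=> J x J0 Px; rewrite tdiffD tdiffZ D1 // D2 // mulr0 addr0.
- by move=> x Px; rewrite tdiffD tdiffZ -e1 // -e2.
Qed.

Lemma indep_tens_graded d a : (0 < d)%N -> supp (indep d) a -> graded d%:Z (tens a).
Proof.
move=> d0 sa; have := @graded_tens d d a d0.
rewrite (_ : d.*2%:Z - d%:Z = d%:Z); last by lia.
by apply=> L aL; have /andP [/eqP -> /eqP ->] : indep d L by apply: contraNT aL => /sa ->.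
Qed.

Lemma indep_dK d a J : supp (indep d) a -> rk J = d -> dK a J = 0.
Proof.
move=> sa rJ; rewrite /dK big1 // => h hJ; rewrite sa ?mulr0 //.
rewrite /indep cardsU1 hJ negb_and orbC neq_ltn add1n ltnS.
by rewrite -rJ rk_le_card orbT.
Qed.

Lemma repr_total d a : (0 < d)%N -> supp (indep d) a ->
  exists2 eta, repr d a eta & forall x, eta x != 0 -> ssize x = d.+1.
Proof.
move=> d0 sa; have sa' := supp_indep sa.
have st := supp_tens sa'.
have [||||psi [gpsi sp fp]] := @push_down 0 d.-1 (d%:Z + 1) (D (tens a)).
- move=> J x Px; rewrite prednK // leq_eqVlt => /orP [/eqP rJ|rJ].
    by rewrite (tens_diff d0 sa' (esym rJ) Px) (indep_dK sa (esym rJ)) mul0r.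
  exact: suppc_diff st rJ.
- exact: graded_tdiff (indep_tens_graded d0 sa).
- by move=> J x _ _; rewrite tdiff_tdiff.
- by move=> j /andP [_ jd]; lia.
have gpsi' : graded d%:Z psi by rewrite (_ : d%:Z = d%:Z + 1 - 1) // addrK.
have gphi := gradedB (indep_tens_graded d0 sa) gpsi'.
exists (D (fun J x => tens a J x - psi J x) finset.set0); last first.
  by move=> x /(graded_tdiff gphi); rewrite cards0; lia.
exists (fun J x => tens a J x - psi J x); split=> //.
- by move=> J x Px rJ; rewrite st ?gtn_eqF // sp ?subr0 //; lia.
- by move=> J x rJ Px; rewrite sp ?subr0 //; lia.
- by move=> J x J0 Px; rewrite tdiffB -[RHS](fp J x Px) // rk_eq0.
Qed.

Lemma avoid_base_diff (f : simp R X -> K) J x :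
  D (fun L y => if L == finset.set0 then f y else 0) J x =
  if J == finset.set0 then cob f x else 0.
Proof.
rewrite /tdiff; case: (J =P finset.set0) => [->|nJ].
  rewrite cards0 expr0 mul1r dK_set0; last by move=> h; rewrite (negPf (set1_neq0 h)).
  by rewrite addr0.
rewrite cob0 mulr0 add0r /dK big1 // => h hJ; rewrite (_ : (_ == _) = false) ?mulr0 //.
by apply/negbTE/finset.set0Pn; exists h; rewrite finset.setU11.
Qed.

Lemma filt_top phi : filt #|I| phi.
Proof. by move=> J x _; rewrite ltnNge (leq_trans (rk_le_card J)) // max_card. Qed.

Lemma total_acyclic_graded d phi : graded d phi ->
  (forall J x, P J x -> D phi J x = 0) ->
  exists2 psi, graded (d - 1) psi & forall J x, P J x -> phi J x = D psi J x.
Proof.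
move=> gp Dp; have [psi E] := total_acyclic A_face i0 Dp.
exists (grade (d - 1) psi); first exact: graded_grade.
move=> J x Px; rewrite tdiff_grade subrK -(grade_id J x gp).
by rewrite /grade E.
Qed.

Lemma graded_base (f : simp R X -> K) d : (forall x, f x != 0 -> ssize x = d) ->
  graded d%:Z ((fun L y => if L == finset.set0 then f y else 0) : cochains).
Proof.
move=> fd J x; case: (J =P finset.set0) => [->|_]; last by rewrite eqxx.
by move=> /fd ->; rewrite cards0; lia.
Qed.

Lemma repr_surj d eta : (0 < d)%N -> cocycle_on (P finset.set0) eta ->
  (forall x, eta x != 0 -> ssize x = d.+1) ->
  exists2 a, supp (indep d) a & repr d a eta.
Proof.
move=> d0 ce ge.
pose phe : cochains := fun L y => if L == finset.set0 then eta y else 0.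
have [||phi gphi E] := @total_acyclic_graded d.+1%:Z phe.
- exact: graded_base.
- by move=> J x Px; rewrite avoid_base_diff; case: eqP => // J0; rewrite ce // -J0.
rewrite (_ : d.+1%:Z - 1 = d%:Z) in gphi; last by lia.
have E0 J x : J != finset.set0 -> P J x -> D phi J x = 0.
  by move=> J0 Px; rewrite -E // /phe (negPf J0).
have [||||psi [gpsi sp fp]] := @push_down d #|I| d%:Z phi.
- exact: filt_top.
- exact: gphi.
- by move=> J x rJ Px; apply: E0 => //; rewrite -rk_eq0 (leq_ltn_trans _ rJ).
- by move=> j /andP [dj _]; lia.
pose phi1 : cochains := fun J x => phi J x - D psi J x.
have gphi1 : graded d%:Z phi1.
  exact: gradedBD.
have D1 J x : P J x -> D phi1 J x = D phi J x by move=> Px; rewrite tdiffB tdiff_tdiff subr0.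
have [|a [psi1 [sa sp1 gpsi1 _ E1]]] := level_cocycle_graded d0 fp gphi1.
  by move=> J x rJ Px; rewrite D1 // E0 // -rk_eq0 rJ.
exists a => //; exists (fun J x => phi1 J x - D psi1 J x); split.
- by move=> J x Px rJ; rewrite [phi1 J x]fp // (suppc_diff _ sp1) // subr0.
- exact: gradedBD.
- by move=> J x rJ Px; rewrite [phi1 J x]E1 // addrK.
- by move=> J x J0 Px; rewrite tdiffB tdiff_tdiff subr0 D1 // E0.
- by move=> x Px; rewrite tdiffB tdiff_tdiff subr0 D1 // -E // /phe eqxx.
Qed.

Lemma repr_exact d a b eta : (0 < d)%N -> supp (level d) b ->
  (forall J, indep d J -> a J = dK b J) -> supp (indep d) a -> repr d a eta ->
  exists e, forall x, P finset.set0 x -> eta x = cob e x.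
Proof.
move=> d0 sb ab sa [phi [fp gp tp Dp ep]].
pose b' J : K := if #|J| == d.+1 then b J else 0.
have sb' : supp (level d) b' by move=> J JL; rewrite /b' sb // if_same.
have gb' : graded (d%:Z - 1) (tens b').
  rewrite (_ : d%:Z - 1 = d.*2%:Z - d.+1%:Z); last by lia.
  apply: graded_tens => // J; rewrite /b'; case: (#|J| =P d.+1) => [->|_]; last by rewrite eqxx.
  move=> bJ; split=> //; apply/eqP; apply: contraNT bJ => JL.
  by rewrite sb.
have db' J : rk J = d -> dK b' J = a J.
  move=> rJ; have [cJ|cJ] := eqVneq #|J| d.
    rewrite ab ?/indep ?rJ ?cJ ?eqxx //.
    by apply: dK_local => h hJ; rewrite /b' cardsU1 hJ cJ add1n eqxx.
  rewrite sa ?/indep ?(negPf cJ) ?andbF //.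
  rewrite /dK big1 // => h hJ; rewrite /b' cardsU1 hJ add1n eqSS (negPf cJ) mulr0 //.
pose phi1 : cochains := fun J x => phi J x - D (tens b') J x.
have gphi1 : graded d%:Z phi1.
  exact: gradedBD.
have D1 J x : D phi1 J x = D phi J x by rewrite tdiffB tdiff_tdiff subr0.
have [||||psi [gpsi sp fpsi]] := @push_down 0 d.-1 d%:Z phi1.
- move=> J x Px; rewrite prednK // leq_eqVlt => /orP [/eqP rJ|rJ].
    by rewrite /phi1 tp // (tens_diff d0 sb' (esym rJ) Px) db' // subrr.
  by rewrite /phi1 fp // (suppc_diff _ (supp_tens sb') rJ) subr0.
- exact: gphi1.
- by move=> J x rJ Px; rewrite D1 Dp // -rk_eq0.
- by move=> j /andP [_ jd]; lia.
pose phi2 : cochains := fun J x => phi1 J x - D psi J x.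
exists (phi2 finset.set0) => x Px.
have -> : eta x = D phi2 finset.set0 x by rewrite tdiffB tdiff_tdiff subr0 D1 ep.
rewrite /tdiff cards0 expr0 mul1r /dK big1 ?addr0 // => h hJ.
rewrite [phi2 _ x]fpsi ?mulr0 //; first exact: avoidU.
by rewrite rk_eq0; apply/finset.set0Pn; exists h; rewrite finset.setU11.
Qed.

Lemma repr_bounded d a eta e : (0 < d)%N -> supp (indep d) a -> repr d a eta ->
  (forall x, eta x != 0 -> ssize x = d.+1) ->
  (forall x, P finset.set0 x -> eta x = cob e x) ->
  exists2 b, supp (level d) b & forall J, indep d J -> a J = dK b J.
Proof.
move=> d0 sa [phi [fp gp tp Dp ep]] ge ee.
pose e' x := if ssize x == d then e x else 0.
have ee' x : P finset.set0 x -> eta x = cob e' x.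
  move=> Px; transitivity ((ssize x == d.+1)%:R * cob e x).
    rewrite -ee //; case: eqP; rewrite ?mul1r // mul0r => nd.
    by apply/eqP/negPn/negP => /ge.
  rewrite -cobZ; apply: cob_local => y /is_face_size ->.
  by rewrite eqSS /e'; case: eqP; rewrite ?mul1r ?mul0r.
pose phe : cochains := fun L y => if L == finset.set0 then e' y else 0.
have [||psi gpsi E] := @total_acyclic_graded d%:Z (fun J x => phi J x - phe J x).
- apply: gradedB => //; apply: graded_base => x; rewrite /e'.
  by case: (ssize x =P d) => // _; rewrite eqxx.
- move=> J x Px; rewrite tdiffB avoid_base_diff; case: (J =P finset.set0) => [J0|/eqP J0].
    by subst J; rewrite -ep // ee' // subrr.
  by rewrite Dp // subrr.
have [||||chi [gchi sp fchi]] := @push_down d #|I| (d%:Z - 1) psi.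
- exact: filt_top.
- exact: gpsi.
- move=> J x rJ Px; rewrite -E // fp // /phe (_ : (_ == _) = false) ?subrr //.
  by apply/negbTE; rewrite -rk_eq0 (leq_ltn_trans _ rJ).
- by move=> j /andP [dj _]; lia.
pose psi1 : cochains := fun J x => psi J x - D chi J x.
have D1 J x : rk J = d -> P J x -> D psi1 J x = a J * om J x.
  move=> rJ Px; rewrite tdiffB tdiff_tdiff subr0 -E // tp // /phe (_ : (_ == _) = false) ?subr0 //.
  by apply/negbTE; rewrite -rk_eq0 rJ.
have [b [chi1 [sb sp1 E1]]] := level_analysis d0 fchi D1.
exists b => // J /andP [/eqP rJ _]; apply/eqP; rewrite -subr_eq0; apply/eqP.
apply: (om_cancel d0 rJ) => x Px.
by rewrite mulrBl -(level_diff d0 fchi sb sp1 E1 rJ Px) D1 // subrr.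
Qed.

Section Action.
Variables (g : simp R X -> simp R X) (p : {perm I}) (th : {set I} -> simp R X -> K).
Hypothesis g_size : forall x, ssize (g x) = ssize x.
Hypothesis g_cob : forall (c : simp R X -> K) x, cob (c \o g) x = cob c (g x).
Hypothesis g_A : forall h x, A h x -> A (p h) (g x).
Hypothesis p_rk : forall J, rk (p @: J) = rk J.
Hypothesis om_g : forall J x, J != finset.set0 -> P J x ->
  om (p @: J)%SET (g x) = om J x + cob (th J) x.

Definition gact phi : cochains := fun J x => psgn K p J * phi (p @: J)%SET (g x).

Definition gact0 a J : K := psgn K p J * a (p @: J)%SET.

Lemma avoid_act J x : P J x -> P (p @: J)%SET (g x).
Proof.
rewrite /avoid /= imset_eq0; case: ifP => _.
  by move=> Ax h; rewrite -[h](permKV p); apply: g_A.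
by case=> h hJ Ah; exists (p h); [exact: imset_f|exact: g_A].
Qed.

Lemma gact_diff phi J x : D (gact phi) J x = gact (D phi) J x.
Proof.
rewrite /tdiff /gact mulrDr; congr (_ + _).
  rewrite cobZ (card_imset _ (@perm_inj _ p)) -(g_cob (phi (p @: J)%SET)).
  by rewrite mulrCA.
by rewrite -[RHS](dK_psgn p (phi^~ (g x)) J).
Qed.

Lemma repr_act d a eta : (0 < d)%N -> supp (indep d) a -> repr d a eta ->
  repr d (gact0 a) (eta \o g).
Proof.
move=> d0 sa [phi [fp gp tp Dp ep]].
have sga : supp (indep d) (gact0 a).
  move=> J JL; rewrite /gact0 sa ?mulr0 //; apply: contra JL.
  by rewrite /indep p_rk card_imset //; exact: perm_inj.
have ggp : graded d%:Z (gact phi).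
  move=> J x; rewrite /gact mulf_eq0 negb_or => /andP [_ /gp].
  by rewrite g_size card_imset //; exact: perm_inj.
pose psi : cochains := fun J x => (-1) ^+ #|J| * (gact0 a J * th J x).
have spsi : suppc d psi.
  move=> J JL; apply/funext => x; rewrite /psi sga ?mul0r ?mulr0 //.
  by rewrite /indep (negPf JL).
have sps := suppc_grade (d%:Z - 1) spsi.
have top J x : rk J = d -> P J x -> D psi J x = gact phi J x - tens (gact0 a) J x.
  move=> rJ Px; have J0 := level_neq0 d0 rJ.
  rewrite /tdiff /dK big1 ?addr0.
    rewrite cobZ mulrA -expr2 sqrr_sign mul1r cobZ.
    rewrite /gact tp ?p_rk //; last exact: avoid_act.
    by rewrite om_g // /tens /gact0; ring.
  move=> h hJ; rewrite /psi sga ?mul0r ?mulr0 //.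
  rewrite /indep cardsU1 hJ negb_and orbC neq_ltn add1n ltnS.
  by rewrite -rJ rk_le_card orbT.
exists (fun J x => gact phi J x - D (grade (d%:Z - 1) psi) J x); split.
- move=> J x Px rJ; rewrite (suppc_diff _ sps) // subr0 /gact fp ?mulr0 ?p_rk //.
  exact: avoid_act.
- apply: gradedBD => //; exact: graded_grade.
- move=> J x rJ Px; rewrite tdiff_grade subrK.
  rewrite -[RHS](grade_id J x (indep_tens_graded d0 sga)) -(grade_id J x ggp) -gradeB.
  by rewrite /grade top // subKr.
- move=> J x J0 Px; rewrite tdiffB tdiff_tdiff subr0 gact_diff /gact Dp ?mulr0 ?imset_eq0 //.
  exact: avoid_act.
- move=> x Px; rewrite tdiffB tdiff_tdiff subr0 gact_diff /gact imset0 -ep.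
    by rewrite psgn0 mul1r.
  by have := avoid_act Px; rewrite imset0.
Qed.

Lemma repr_comb d m (e : 'I_m -> {set I} -> K) (eta : 'I_m -> simp R X -> K) a xi (r : 'I_m -> K) :
  (forall i, repr d (e i) (eta i)) -> repr d a xi ->
  repr d (fun J => a J - \sum_i r i * e i J) (fun x => xi x - \sum_i r i * eta i x).
Proof.
move=> re ra; elim: (index_enum _) => [|i s IH].
  suff [-> ->] : ((fun J => a J - \sum_(i <- [::]) r i * e i J) = a) /\
      ((fun x => xi x - \sum_(i <- [::]) r i * eta i x) = xi) by [].
  by split; apply/funext => J; rewrite big_nil subr0.
have := repr_lin (- r i) (re i) IH.
suff [-> ->] : ((fun J => a J - \sum_(j <- i :: s) r j * e j J) =
    (fun J => - r i * e i J + (a J - \sum_(j <- s) r j * e j J))) /\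
  ((fun x => xi x - \sum_(j <- i :: s) r j * eta j x) =
    (fun x => - r i * eta i x + (xi x - \sum_(j <- s) r j * eta j x))) by [].
by split; apply/funext => J; rewrite big_cons; ring.
Qed.

Lemma supp_comb Q m (e : 'I_m -> {set I} -> K) a (r : 'I_m -> K) :
  (forall i, supp Q (e i)) -> supp Q a -> supp Q (fun J => a J - \sum_i r i * e i J).
Proof.
by move=> se sa J JQ; rewrite sa // big1 ?subr0 // => i _; rewrite se ?mulr0.
Qed.

Lemma repr_trace d : (0 < d)%N ->
  exists m (eta : 'I_m -> simp R X -> K) (B : 'M[K]_m),
  [/\ forall i, cocycle_on (P finset.set0) (eta i) /\ forall x, eta i x != 0 -> ssize x = d.+1,
      forall c, cocycle_on (P finset.set0) c -> (forall x, c x != 0 -> ssize x = d.+1) ->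
        exists r : 'rV[K]_m,
          (exists e, forall x, P finset.set0 x -> c x - \sum_i r 0 i * eta i x = cob e x) /\
          forall r' : 'rV[K]_m,
          (exists e, forall x, P finset.set0 x -> c x - \sum_i r' 0 i * eta i x = cob e x) -> r' = r,
      forall j, exists e, forall x, P finset.set0 x ->
        eta j (g x) - \sum_i B i j * eta i x = cob e x
    & \tr B = (-1) ^+ d * \sum_(J | (rk J == d) && (p @: J == J)) (-1) ^+ #|J| * psgn K p J].
Proof.
move=> d0; pose S := [set J | rk J == d]%SET.
have iS J : (J \in [set L in S | #|L| == d]%SET) = indep d J by rewrite !inE.
have SE J : (J \in S) = level d J by rewrite inE.
have Sp J : (p @: J \in S)%SET = (J \in S) by rewrite !inE p_rk.
have [|||m [e [B [se ebas eact trB]]]] := @bottom_trace K I S p Sp d.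
- move=> J h k; rewrite !inE => /eqP rJ /eqP rkJ; rewrite eqn_leq -{1}rkJ rk_mono.
  by rewrite -rJ rk_mono.
- move=> a J sa; rewrite inE => /eqP; apply: indep_dK => L; rewrite -iS; exact: sa.
- move=> a sa da; have [||b [sb ab]] := matroid_exact rk_mono rk_unit rk_loop (A := finset.setTfor I) (L := finset.set0) (c := d) (a := a).
  + by move=> J; rewrite /fam finset.subsetT finset.setU0 /= => rJ; apply: sa; rewrite inE.
  + by move=> J; rewrite /fam finset.subsetT finset.setU0 /= => rJ; apply: da; rewrite inE.
  exists b; split=> [J|J].
    by rewrite inE => rJ; apply: sb; rewrite /fam finset.subsetT finset.setU0.
  rewrite inE => rJ cJ; apply: ab; rewrite ?rk0 ?addn0 //.
  by rewrite /fam finset.subsetT finset.setU0.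
have sI i : supp (indep d) (e i) by move=> J; rewrite -iS; exact: se.
have bimE (a : {set I} -> K) : bim S d a <-> exists2 b, supp (level d) b & forall J, indep d J -> a J = dK b J.
  split=> [[b [sb ab]]|[b sb ab]]; exists b.
  - by move=> J; rewrite -SE; exact: sb.
  - by move=> J; rewrite -iS; exact: ab.
  - split=> J; first by rewrite SE; exact: sb.
    by rewrite iS; exact: ab.
have [eta etaP] := choice (fun i => let: ex_intro2 t rt gt := repr_total d0 (sI i) in ex_intro _ t (conj rt gt)).
have sc (r : 'I_m -> K) c : (forall x, c x != 0 -> ssize x = d.+1) ->
    forall x, c x - \sum_i r i * eta i x != 0 -> ssize x = d.+1.
  move=> gc x; have [sx //|nx] := eqVneq (ssize x) d.+1; rewrite big1 => [|i _].
    by rewrite subr0; exact: gc.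
  apply/eqP; rewrite mulf_eq0 orbC; apply/orP; left; apply: contraNT nx => /(proj2 (etaP i)) ->.
  by rewrite eqxx.
exists m, eta, B; split=> //.
- move=> i; split; last exact: (proj2 (etaP i)).
  exact: repr_cocycle (proj1 (etaP i)).
- move=> c cc gc; have [a sa ra] := repr_surj d0 cc gc.
  have [r [br ur]] := ebas a (fun J => ltac:(rewrite iS; exact: sa)).
  have rc (r' : 'rV[K]_m) := repr_comb (fun i => r' 0 i) (fun i => proj1 (etaP i)) ra.
  have sr (r' : 'rV[K]_m) := supp_comb (fun i => r' 0 i) sI sa.
  exists r; split.
    by move/bimE: br => [b sb ab]; exact: (repr_exact d0 sb ab (sr r) (rc r)).
  move=> r' [f fE]; apply: ur; apply/bimE.
  exact: (repr_bounded d0 (sr r') (rc r') (sc _ _ gc) fE).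
- move=> j; move/bimE: (eact j) => [b sb ab].
  apply: (repr_exact d0 sb ab).
    apply: supp_comb => // J; rewrite /pact => nJ.
    rewrite sI ?mulr0 //; apply: contra nJ.
    by rewrite /indep p_rk card_imset //; exact: perm_inj.
  by apply: repr_comb (fun i => proj1 (etaP i)) _; apply: repr_act => //; exact: (proj1 (etaP j)).
by rewrite trB; congr (_ * _); apply: eq_bigl => J; rewrite inE.
Qed.

End Action.

End Filtration.

(** * Traces on subquotients *)

Section TraceMod.
Variables (K : fieldType) (V : lmodType K) (Z B : set V).
Hypothesis B_comb : forall (s : K) u v, B u -> B v -> B (s *: u + v).
Hypothesis B0 : B 0.

Lemma B_sum (I : finType) (c : I -> K) (u : I -> V) : (forall i, B (u i)) ->
  B (\sum_i c i *: u i).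
Proof.
move=> uB; elim: (index_enum _) => [|i r IH]; first by rewrite big_nil.
by rewrite big_cons; exact: B_comb.
Qed.

Lemma BD u v : B u -> B v -> B (u + v).
Proof. by move=> uB vB; rewrite -[u]scale1r; exact: B_comb. Qed.

Lemma basis_mod_comp m m' (e : 'I_m -> V) (e' : 'I_m' -> V) (P : 'M[K]_(m, m')) v (a : 'cV[K]_m') :
  (forall j, B (e' j - \sum_i P i j *: e i)) -> B (v - \sum_j a j 0 *: e' j) ->
  B (v - \sum_i (P *m a) i 0 *: e i).
Proof.
move=> eP va; have := BD va (B_sum (a^~ 0) eP).
have -> : \sum_j a j 0 *: (e' j - \sum_i P i j *: e i) =
    \sum_j a j 0 *: e' j - \sum_i (P *m a) i 0 *: e i.
  under eq_bigr => j _ do rewrite scalerBr scaler_sumr.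
  rewrite sumrB exchange_big; congr (_ - _); apply: eq_bigr => i _.
  by rewrite !mxE scaler_suml; apply: eq_bigr => j _; rewrite scalerA mulrC.
by rewrite addrA subrK.
Qed.

Lemma basis_mod_uniq m (e : 'I_m -> V) v (a b : 'cV[K]_m) : basis_mod Z B e -> Z v ->
  B (v - \sum_i a i 0 *: e i) -> B (v - \sum_i b i 0 *: e i) -> a = b.
Proof.
move=> [_ eb] /eb [c [_ cu]] va vb.
have E (a' : 'cV[K]_m) : B (v - \sum_i a' i 0 *: e i) -> a' = c^T.
  move=> va'; rewrite (cu a'^T) ?trmxK //.
  by under eq_bigr => i _ do rewrite mxE.
by rewrite (E a) // (E b).
Qed.

Lemma basis_mod_coord m (e : 'I_m -> V) v : basis_mod Z B e -> Z v ->
  exists a : 'cV[K]_m, B (v - \sum_i a i 0 *: e i).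
Proof.
move=> [_ eb] /eb [c [cB _]]; exists c^T.
by under eq_bigr => i _ do rewrite mxE.
Qed.

Lemma basis_mod_change m m' (e : 'I_m -> V) (e' : 'I_m' -> V) :
  basis_mod Z B e -> basis_mod Z B e' ->
  exists P : 'M[K]_(m, m'), forall j, B (e' j - \sum_i P i j *: e i).
Proof.
move=> be [e'Z _]; have [P PB] := choice (fun j => basis_mod_coord be (e'Z j)).
exists (\matrix_(i, j) P j i 0) => j.
by under eq_bigr => i _ do rewrite mxE.
Qed.

Lemma basis_mod_self m (e : 'I_m -> V) j :
  B (e j - \sum_i (1%:M : 'M[K]_m) i j *: e i).
Proof.
rewrite (bigD1 j) //= big1 ?addr0 => [|i ij]; last by rewrite !mxE (negPf ij) scale0r.
by rewrite mxE eqxx scale1r subrr.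
Qed.

Lemma basis_mod_colP m m' (e : 'I_m -> V) (v : 'I_m' -> V) (P P' : 'M[K]_(m, m')) :
  basis_mod Z B e -> (forall j, Z (v j)) ->
  (forall j, B (v j - \sum_i P i j *: e i)) -> (forall j, B (v j - \sum_i P' i j *: e i)) -> P = P'.
Proof.
move=> be vZ vP vP'; apply/matrixP => i j.
have /colP /(_ i) : col j P = col j P'.
  apply: (basis_mod_uniq be (vZ j)).
    by under eq_bigr => k _ do rewrite mxE.
  by under eq_bigr => k _ do rewrite mxE.
by rewrite !mxE.
Qed.

Lemma basis_mod_mulmx m m' m'' (e : 'I_m -> V) (e' : 'I_m' -> V) (v : 'I_m'' -> V)
  (P : 'M[K]_(m, m')) (A : 'M[K]_(m', m'')) :
  (forall j, B (e' j - \sum_i P i j *: e i)) -> (forall j, B (v j - \sum_i A i j *: e' i)) ->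
  forall j, B (v j - \sum_i (P *m A) i j *: e i).
Proof.
move=> eP vA j; have := @basis_mod_comp _ _ e e' P (v j) (col j A) eP.
under eq_bigr => k _ do rewrite mxE.
move=> /(_ (vA j)); rewrite colE mulmxA -colE.
by under eq_bigr => k _ do rewrite mxE.
Qed.

Variable f : V -> V.
Hypothesis f_lin : forall (s : K) u v, f (s *: u + v) = s *: f u + f v.
Hypothesis f_Z : forall u, Z u -> Z (f u).
Hypothesis f_B : forall u, B u -> B (f u).

Lemma f_comb m (c : 'I_m -> K) (e : 'I_m -> V) u :
  f (u - \sum_i c i *: e i) = f u - \sum_i c i *: f (e i).
Proof.
have f0 : f 0 = 0.
  by have := f_lin (-1) 0 0; rewrite scaler0 addr0 scaleN1r addNr.
rewrite addrC -[- _]scaleN1r f_lin scaleN1r addrC; congr (_ - _).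
elim: (index_enum _) => [|i r IH]; first by rewrite !big_nil.
by rewrite !big_cons f_lin IH.
Qed.

Lemma is_trace_mod_unique t t' : is_trace_mod Z B f t -> is_trace_mod Z B f t' -> t = t'.
Proof.
move=> [m [e [A [be eA ->]]]] [m' [e' [A' [be' eA' ->]]]].
have [P PB] := basis_mod_change be be'; have [Q QB] := basis_mod_change be' be.
have eZ i : Z (e i) by case: be.
have e'Z i : Z (e' i) by case: be'.
have PQ : P *m Q = 1%:M.
  apply: (basis_mod_colP be eZ); last exact: basis_mod_self.
  exact: basis_mod_mulmx PB QB.
have AP : A *m P = P *m A'.
  apply: (basis_mod_colP be (fun j => f_Z (e'Z j))); last exact: basis_mod_mulmx PB eA'.
  apply: (@basis_mod_mulmx _ _ _ _ (f \o e)) => // j /=.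
  by have := f_B (PB j); rewrite f_comb.
by rewrite -[A]mulmx1 -PQ mulmxA AP -mulmxA mxtrace_mulC -mulmxA (_ : Q *m P = 1%:M) ?mulmx1 //;
  apply: (basis_mod_colP be' e'Z); [exact: basis_mod_mulmx QB PB|exact: basis_mod_self].
Qed.

Lemma trace_mod_eq t : is_trace_mod Z B f t -> trace_mod Z B f = t.
Proof.
move=> ft; rewrite /trace_mod; case: xgetP => [t' _ /= ft'|/(_ t) //].
exact: is_trace_mod_unique.
Qed.

End TraceMod.

Section Cochains.
Variables (R : realType) (K : fieldType) (X : topologicalType) (U : set X).

Definition incl (z : U) : X := set_val z.

Lemma incl_continuous : continuous incl.
Proof. exact: initial_continuous. Qed.

HB.instance Definition _ := isContinuous.Build _ _ incl incl_continuous.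

Definition restr d (f : simp R X -> K) : cochain R K U d :=
  fun s => f (simp_push incl (simp_of s)).
Arguments restr d f : clear implicits.

Lemma incl_push_inj d (s s' : sing_simplex R U d) :
  simp_push incl (simp_of s) = simp_push incl (simp_of s') -> s = s'.
Proof.
move=> [] /(@Eqdep_dec.inj_pair2_eq_dec _ PeanoNat.Nat.eq_dec (fun d => stdsimplex R d -> X)) E.
apply/continuousEP => t; apply: val_inj.
exact: (congr1 (fun c : stdsimplex R d -> X => c t) E).
Qed.

Lemma incl_push_surj x : in_open U x -> exists y : simp R U, simp_push incl y = x.
Proof.
case: x => [[d s]|]; last by exists None.
move=> sU; have st t : s t \in U by apply/mem_set/sU; exists t.
pose s0 t : U := exist _ (s t) (st t).
have cs : continuous s0.
  apply: continuous_comp_initial; rewrite (_ : _ \o _ = s) //.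
  exact: cts_fun.
pose s' : sing_simplex R U d := HB.pack_for (sing_simplex R U d) s0 (isContinuous.Build _ _ s0 cs).
by exists (simp_of s'); congr simp_of; apply/continuousEP.
Qed.

Definition ext d (c : cochain R K U d) (x : simp R X) : K :=
  if pselect (exists s : sing_simplex R U d, simp_push incl (simp_of s) = x) is left e
  then c (sval (cid e)) else 0.

Lemma ext_push d (c : cochain R K U d) s : ext c (simp_push incl (simp_of s)) = c s.
Proof.
rewrite /ext; case: pselect => [e|[]]; last by exists s.
by congr c; case: cid => s' /= /incl_push_inj.
Qed.

Lemma extK d (c : cochain R K U d) : restr d (ext c) = c.
Proof. by apply/funext => s; rewrite /restr ext_push. Qed.

Lemma ext_size d (c : cochain R K U d) x : ext c x != 0 -> ssize x = d.+1.
Proof.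
rewrite /ext; case: pselect => [e _|_]; last by rewrite eqxx.
by case: e => s <-; rewrite ssize_push.
Qed.

Lemma restr_cob d f : coboundary (restr d f) = restr d.+1 (cob f).
Proof. by apply/funext => s; rewrite /restr -cob_push. Qed.

Lemma restr_local d f f' : (forall x, in_open U x -> f x = f' x) -> restr d f = restr d f'.
Proof.
move=> ff'; apply/funext => s; apply: ff'.
by move=> z [t _ <-]; apply: set_mem; exact: valP.
Qed.

Lemma cob_size_eq0 d (f : simp R X -> K) x : (forall y, f y != 0 -> ssize y = d) ->
  cob f x != 0 -> ssize x = d.+1.
Proof.
move=> fd; apply: contraNeq => xd; rewrite -[X in _ == X](cob0 K x); apply/eqP.
apply: cob_local => y /is_face_size xy.
by apply/eqP; apply: contraNT xd => /fd <-; apply/eqP.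
Qed.

Lemma restr_inj d f : (forall x, f x != 0 -> ssize x = d.+1) -> restr d f = 0 ->
  forall x, in_open U x -> f x = 0.
Proof.
move=> fd f0 x /incl_push_surj [y yx]; have [//|/fd] := eqVneq (f x) 0.
rewrite -yx ssize_push; case: y yx => [[d' s]|] //= yx [] dd.
move: s yx; rewrite dd => s yx.
by have := congr1 (fun c : cochain R K U d => c s) f0.
Qed.

Lemma cocycle_restr d f : cocycle_on (in_open U) f -> cocycles R K U d (restr d f).
Proof.
move=> cf; rewrite /cocycles /= restr_cob (@restr_local _ _ (fun=> 0)) //.
Qed.

Lemma cocycle_ext d (c : cochain R K U d) : cocycles R K U d c -> cocycle_on (in_open U) (ext c).
Proof.
move=> cc; apply: (@restr_inj d.+1); last by rewrite -restr_cob extK.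
by move=> x; apply: cob_size_eq0; exact: ext_size.
Qed.

Lemma coboundary_restr d f e : (0 < d)%N -> (forall x, in_open U x -> f x = cob e x) ->
  coboundaries R K U d (restr d f).
Proof.
case: d => // d _ fe; exists (restr d e) => //.
by rewrite restr_cob; apply: restr_local => x /fe ->.
Qed.

Lemma coboundary_ext d f : (0 < d)%N -> (forall x, f x != 0 -> ssize x = d.+1) ->
  coboundaries R K U d (restr d f) -> exists e, forall x, in_open U x -> f x = cob e x.
Proof.
case: d => // d _ fd [e _ eE]; exists (ext e) => x xU; apply/eqP; rewrite -subr_eq0; apply/eqP.
apply: (@restr_inj d.+1 (fun x => f x - cob (ext e) x)) xU => [y|].
  have [//|ny] := eqVneq (ssize y) d.+2.
  have -> : f y = 0 by apply/eqP; apply: contraNT ny => /fd ->.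
  rewrite sub0r oppr_eq0 => /cob_size_eq0; apply; exact: ext_size.
apply/funext => s; have := congr1 (fun c : cochain R K U d.+1 => c s) eE.
by rewrite -[in coboundary _](extK e) restr_cob /restr => ->; rewrite subrr.
Qed.

End Cochains.
Arguments restr {R K X} U d f.

(** * The character of the cohomology *)

Section CochainMaps.
Variables (R : realType) (K : fieldType) (X : topologicalType).

Lemma coboundary_lin d s (u v : cochain R K X d) :
  coboundary (s *: u + v) = s *: coboundary u + coboundary v.
Proof.
apply/funext => x; rewrite /coboundary /=.
rewrite -[RHS]/(s * (\sum_(i < d.+2) (-1) ^+ i * u (face i x)) + \sum_(i < d.+2) (-1) ^+ i * v (face i x)).
rewrite mulr_sumr -big_split; apply: eq_bigr => i _.
by rewrite -[(s *: u + v) _]/(s * u (face i x) + v (face i x)) /= mulrDr mulrCA.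
Qed.

Lemma coboundaries_lin d s (u v : cochain R K X d) :
  coboundaries R K X d u -> coboundaries R K X d v -> coboundaries R K X d (s *: u + v).
Proof.
case: d u v => [|d] u v; first by move=> /= -> ->; rewrite scaler0 addr0.
by move=> [a _ <-] [b _ <-]; exists (s *: a + b) => //; exact: coboundary_lin.
Qed.

Lemma coboundaries0 d : coboundaries R K X d 0.
Proof.
case: d => [|d] //; exists 0 => //; apply/funext => x.
by rewrite /coboundary big1 // => i _; rewrite mulr0.
Qed.

Variable f : continuousType X X.

Lemma coboundary_pullback d (c : cochain R K X d) :
  coboundary (pullback f c) = pullback f (coboundary c).
Proof.
apply/funext => x; apply: eq_bigr => i _; congr (_ * c _).
exact/continuousEP.
Qed.

Lemma pullback_cocycle d (c : cochain R K X d) :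
  cocycles R K X d c -> cocycles R K X d (pullback f c).
Proof. by rewrite /cocycles /= coboundary_pullback => ->. Qed.

Lemma pullback_coboundary d (c : cochain R K X d) :
  coboundaries R K X d c -> coboundaries R K X d (pullback f c).
Proof.
case: d c => [|d] c; first by move=> /= ->.
by move=> [b _ <-]; exists (pullback f b) => //; exact: coboundary_pullback.
Qed.

Lemma cohomology_trace_eq d t :
  is_trace_mod (cocycles R K X d) (coboundaries R K X d) (pullback f (d := d)) t ->
  @cohomology_trace R K X f d = t.
Proof.
apply: trace_mod_eq => //.
- exact: coboundaries_lin.
- exact: coboundaries0.
- exact: pullback_cocycle.
- exact: pullback_coboundary.
Qed.

End CochainMaps.

Section ArrangementTrace.
Variables (R : realType) (n : nat).
Hypothesis n_gt0 : (0 < n)%N.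
Local Notation C := (R[i]^o).
Local Notation V := 'rV[C]_n.
Local Notation I := (pair_idx n).
Local Notation span := (@span C n).
Local Notation pform := (@pform C n).
Local Notation rk := (@rkf C n).
Local Notation hmx := (@hmx n C).

Definition locus (h : I) : set V := [set z | scoord z (val h).1 != scoord z (val h).2]%classic.

Lemma MBC_locus z : MBC z <-> forall h, locus h z.
Proof.
split=> [/MBCP zi h|zl].
  by apply/negP => /eqP /zi E; have := valP h; rewrite E eqxx.
apply/MBCP => a b E; apply/eqP/negPn/negP => ab.
by have := zl (Sub (a, b) ab : I); rewrite /locus /= E eqxx.
Qed.

Lemma locus_open h : open (locus h).
Proof.
have -> : locus h = ((fun z : V => linc (pform h)^T z 0 0) @^-1` (~` [set 0]))%classic.
  apply/seteqP; split => z /=; rewrite /linc /locus /= -pform_scoord.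
    by move=> /eqP zh E; apply: zh; apply/rowP => i; rewrite ord1 E mxE.
  by move=> zh; apply/negP => /eqP E; apply: zh; rewrite E mxE.
have cl : continuous (fun z : V => linc (pform h)^T z 0 0).
  by apply: (cts_comp (g := fun w : 'rV[C]_1 => w 0 0)); [exact: cts_fun|exact: coord_ctsc].
apply: open_comp => [z _|]; first exact: cl.
rewrite openC; apply: accessible_closed_set1; apply: hausdorff_accessible.
exact: norm_hausdorff.
Qed.

Definition clear_of (h : I) : set (simp R V) := in_open (locus h).

Definition flat_form (J : {set I}) : simp R V -> R[i] := flat_class R[i] <<span J>>%MS.

Lemma clear_of_face h : face_closed (clear_of h).
Proof. exact: face_closed_in_open. Qed.

Lemma avoid0 x : avoid clear_of finset.set0 x <-> in_open (@MBC R n) x.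
Proof.
rewrite /avoid /= eqxx; split=> [xA z xz|xM h z xz].
  by apply/MBC_locus => h; exact: (xA h).
by have /MBC_locus := xM _ xz.
Qed.

Lemma flat_form_spherical J : J != finset.set0 ->
  spherical (avoid clear_of J) (rk J).*2 (flat_form J).
Proof.
move=> J0; have [h0 h0J] : {h | h \in J}.
  by case/finset.set0Pn/sigW: J0 => h hJ; exists h.
pose U (h : {h | h \in J}) := locus (val h).
have -> : avoid clear_of J = small U.
  apply/seteqP; split => x; rewrite /avoid /= (negPf J0) /small /=.
    by case=> h hJ xh; exists (exist _ h hJ).
  by case=> [[h hJ] xh]; exists h.
apply: (spherical_small (exist _ h0 h0J)); first by move=> h; exact: locus_open.
have -> : (\bigcup_i U i)%classic = [set z | z *m (<<span J>>%MS : 'M[C]_n)^T != 0]%classic.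
  apply/seteqP; split => z /=.
    case=> [[h hJ] _] /=; rewrite /U /locus /=; apply: contra_neq; exact: genspan_scoord.
  rewrite genspan_vanishes negb_forall_in => /existsP [h /andP [hJ zh]].
  by exists (exist _ h hJ).
rewrite -[rk J]/(\rank (span J)) -[\rank (span J)]mxrank_gen.
exact: flat_class_spherical.
Qed.

Lemma flat_form_flat h J : rk (h |: J) = rk J -> flat_form (h |: J) = flat_form J.
Proof.
move=> rJ; by rewrite /flat_form genspan_flat.
Qed.

Lemma C_neq2 : 2%:R != 0 :> C.
Proof. by rewrite pnatr_eq0. Qed.

Variable s : 'B_n.
Let u : {perm (signed_idx n)} := sgval s.
Let g := @simp_push R _ _ (linc (hmx u)^T).
Let p := pair_perm u^-1%g.

Lemma u_hyp : u \in hyperoct n.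
Proof. exact: subgP. Qed.

Lemma flat_form_act J : exists e, forall x, J != finset.set0 -> avoid clear_of J x ->
  flat_form (p @: J)%SET (g x) = flat_form J x + cob e x.
Proof.
pose A := row_base (<<span (p @: J)%SET>>%MS : 'M[C]_n) *m hmx u.
have fA : row_free A.
  by rewrite /A /row_free mxrankMfree ?row_free_unit ?hmx_unit ?u_hyp //; exact: row_base_free.
have AJ : (A :=: <<span J>>)%MS.
  apply: eqmx_trans (eqmx_sym (genmxE _)).
  apply: eqmx_trans (eqmxMr _ (eq_row_base _)) _.
  apply: eqmx_trans (eqmxMr _ (genmxE _)) _.
  apply: eqmx_trans (eqmxMr _ (span_perm _ _ (groupVr u_hyp))) _.
  by rewrite -mulmxA -{2}[u]invgK hmx_mulV ?groupV ?u_hyp // mulmx1.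
have [e eE] := flat_class_unique R[i] fA AJ; exists e => x J0 xJ.
rewrite -eE.
  by rewrite addrC subrK /flat_form /flat_class linc_comp -trmx_mul.
move: xJ; rewrite /avoid /= (negPf J0) => -[h hJ xh] z /xh /=.
by rewrite /locus /=; apply: contra_neq; exact: genspan_scoord.
Qed.

Lemma act_incl x : simp_push (@incl V (@MBC R n)) (simp_push (Defs.act s^-1%g) x) = g (simp_push (@incl V (@MBC R n)) x).
Proof.
rewrite /g !simp_push_comp; apply: eq_simp_push => z /=.
apply/rowP => j; rewrite /linc /incl /= /act_row !mxE.
have := scoord_hmx (set_val z) (j, false) u_hyp.
by rewrite {1}/scoord /= mxE => ->; rewrite invgK.
Qed.

Lemma cohomology_char_pos d : (0 < d)%N -> cohomology_char R d s =
  (-1) ^+ d * \sum_(J : {set I} | (rk J == d) && (p @: J == J)%SET) (-1) ^+ #|J| * psgn R[i] p J.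
Proof.
move=> d0; pose i0 : I := Sub ((Ordinal n_gt0, false), (Ordinal n_gt0, true)) isT.
have [th thE] := choice flat_form_act.
have gA h x : clear_of h x -> clear_of (p h) (g x).
  apply: in_open_push => z; rewrite /locus /= /linc pair_permE /= !scoord_hmx ?u_hyp //.
  by rewrite !permKV.
have := @repr_trace R V R[i] I i0 clear_of clear_of_face rk (@rkf_mono _ _) (@rkf_unit _ _) (@rkf_loop _ _)
    (rkf0 _ _) (rkf_gt0 C_neq2) flat_form flat_form_spherical flat_form_flat g p th
    (ssize_push _) (fun c x => cob_push _ c x) gA (fun J => rkf_perm C J (groupVr u_hyp))
    (fun J x => @thE J x) d d0.
rewrite (_ : avoid clear_of finset.set0 = in_open (@MBC R n)); last first.
  by apply/seteqP; split => x /avoid0.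
move=> [m [eta [B [eP espan eact trB]]]].
apply: cohomology_trace_eq; exists m, (fun i => restr (@MBC R n) d (eta i)), B.
have restr_comb (f : simp R V -> R[i]) (r : 'I_m -> R[i]) :
    restr (@MBC R n) d f - \sum_i r i *: restr (@MBC R n) d (eta i) =
    restr (@MBC R n) d (fun x => f x - \sum_i r i * eta i x).
  apply/funext => x.
  rewrite -[LHS]/(restr (@MBC R n) d f x - (\sum_i r i *: restr (@MBC R n) d (eta i)) x).
  congr (_ - _); rewrite /restr; elim: (index_enum _) => [|i l IH]; first by rewrite !big_nil.
  by rewrite !big_cons -IH.
split=> //.
- split=> [i|c cc]; first by apply: cocycle_restr; exact: (proj1 (eP i)).
  have [||r [[e re] ru]] := espan (ext c).
  + exact: cocycle_ext.
  + exact: ext_size.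
  exists r; split.
    rewrite -{1}(extK c) restr_comb; exact: coboundary_restr d0 re.
  move=> r'; rewrite -{1}(extK c) restr_comb => /coboundary_ext [//||e' eE].
    move=> x; have [//|nx] := eqVneq (ssize x) d.+1.
    rewrite big1 => [|i _]; first by rewrite subr0; exact: ext_size.
    apply/eqP; rewrite mulf_eq0 orbC; apply/orP; left.
    by apply: contraNT nx => /(proj2 (eP i)) ->.
  by apply/esym/ru; exists e'.
move=> j; have [e eE] := eact j.
have -> : pullback (Defs.act s^-1%g) (restr (@MBC R n) d (eta j)) = restr (@MBC R n) d (eta j \o g).
  by apply/funext => x; exact: (congr1 (eta j) (act_incl (simp_of x))).
rewrite restr_comb; exact: coboundary_restr d0 eE.
Qed.

End ArrangementTrace.

Section Connected.
Variables (R : realType) (n : nat).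
Hypothesis n_gt0 : (0 < n)%N.
Local Notation C := (R[i]^o).
Local Notation V := 'rV[C]_n.
Local Notation M := (@MBC R n).

Definition base_pt : V := \row_j (j.+1)%:R.

Lemma MBC_base : M base_pt.
Proof.
split=> [i j ij|i]; rewrite !mxE; last by rewrite pnatr_eq0.
split; first by rewrite eqr_nat eqSS.
by rewrite -subr_eq0 opprK -natrD pnatr_eq0.
Qed.

Lemma MBC_path (z w : M) : exists s, forall r, 0 <= r <= 1 ->
  M (set_val z + arc s r *: (set_val w - set_val z)).
Proof.
pose zeta (h : pair_idx n) (v : V) : R[i] := scoord v (val h).1 - scoord v (val h).2.
pose P : {poly R[i]} := \prod_(h : pair_idx n)
  ((zeta h (set_val z))%:P + (zeta h (set_val w) - zeta h (set_val z)) *: 'X).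
have PE t : P.[t] = \prod_(h : pair_idx n)
    (zeta h (set_val z) + (zeta h (set_val w) - zeta h (set_val z)) * t).
  by rewrite horner_prod; apply: eq_bigr => h _; rewrite !hornerE.
have zn (v : M) h : zeta h (set_val v) != 0.
  by rewrite subr_eq0; exact: (proj1 (MBC_locus _) (set_valP v)).
have [||s sP] := @avoiding_arc R P.
- by rewrite PE; apply/prodf_neq0 => h _; rewrite mulr0 addr0.
- by rewrite PE; apply/prodf_neq0 => h _; rewrite mulr1 addrC subrK.
exists s => r /sP; rewrite PE => /prodf_neq0 nz; apply/MBC_locus => h.
have := nz h isT; rewrite /locus /= -subr_eq0; apply: contra_neq => E.
have lin (v v' : V) (t : R[i]) a : scoord (v + t *: (v' - v)) a = scoord v a + t * (scoord v' a - scoord v a).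
  by rewrite /scoord; case: a.2; rewrite !mxE //; ring.
by rewrite -{}E /zeta !lin; ring.
Qed.

Lemma stdsimplex0 (t : stdsimplex R 0) : set_val t = const_mx 1.
Proof.
have [_] := set_valP t; rewrite big_ord1 => t1.
by apply/rowP => i; rewrite ord1 mxE.
Qed.

Lemma vertex_subproof : (const_mx 1 : 'rV[R]_1) \in stdsimplex R 0.
Proof. by apply/mem_set; split=> [i|]; rewrite ?big_ord1 !mxE. Qed.

Definition vertex : stdsimplex R 0 := exist (fun t => t \in stdsimplex R 0) _ vertex_subproof.

Lemma eq_vertex t : t = vertex.
Proof. by apply: val_inj; exact: stdsimplex0. Qed.

Lemma cocycle0_const (c : cochain R R[i] M 0) (s s' : sing_simplex R M 0) :
  cocycles R R[i] M 0 c -> c s = c s'.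
Proof.
move=> cc; pose z := s vertex; pose w := s' vertex; have [a aP] := MBC_path z w.
have t01 (t : stdsimplex R 1) : 0 <= set_val t 0 1 <= 1.
  have [t0] := set_valP t; rewrite big_ord_recl big_ord1 => t1.
  have -> : 1 = lift ord0 ord0 :> 'I_2 by apply: val_inj.
  by rewrite t0 /= -t1 lerDr t0.
pose path (t : stdsimplex R 1) : M := exist (fun v => v \in M)
  (set_val z + arc a (set_val t 0 1) *: (set_val w - set_val z)) (mem_set (aP _ (t01 t))).
have path_cts : continuous path.
  apply: continuous_comp_initial; apply: mx_continuous => i j.
  rewrite (_ : (fun t => _) = (fun t : stdsimplex R 1 =>
      set_val z i j + arc a (set_val t 0 1) * (set_val w - set_val z) i j : C)); last first.
    by apply/funext => t; rewrite /= !mxE.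
  apply: ctsDc; first by move=> t; exact: cst_continuous.
  apply: ctsMc; last by move=> t; exact: cst_continuous.
  apply: (cts_comp (g := fun r => arc a r : C)); last exact: arc_continuous.
  exact: set_val_coord_continuous.
pose g : sing_simplex R M 1 := HB.pack_for (sing_simplex R M 1) path (isContinuous.Build _ _ path path_cts).
have := congr1 (fun f : cochain R R[i] M 1 => f g) cc.
rewrite /coboundary big_ord_recl big_ord1 expr0 mul1r expr1 mulN1r => /eqP.
rewrite subr_eq0 => /eqP.
have -> : face ord0 g = s'.
  apply/continuousEP => t; rewrite (eq_vertex t); apply: val_inj => /=.
  rewrite mxE (_ : 1 = lift ord0 ord0 :> 'I_2); last exact: val_inj.
  rewrite liftK /= mxE /arc subrr !mulr0 -[(1 +i* 0)%C]/(1 : R[i]) scale1r addrC subrK.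
  by [].
have -> : face (lift ord0 ord0) g = s.
  apply/continuousEP => t; rewrite (eq_vertex t); apply: val_inj => /=.
  rewrite mxE (_ : 1 = lift ord0 ord0 :> 'I_2); last exact: val_inj.
  rewrite unlift_none /= /arc subr0 mulr1 mulr0 -[(0 +i* 0)%C]/(0 : R[i]) scale0r addr0.
  by [].
by move->.
Qed.

Lemma cohomology_char0 (s : 'B_n) : cohomology_char R 0 s = 1.
Proof.
pose one : cochain R R[i] M 0 := fun=> 1.
have oneP : cocycles R R[i] M 0 one.
  apply/funext => x; rewrite /coboundary big_ord_recl big_ord1 expr0 expr1.
  by rewrite mul1r mulN1r subrr.
pose z0 : M := exist (fun t => t \in M) _ (mem_set MBC_base).
have cz : continuous (fun _ : stdsimplex R 0 => z0) by move=> x; exact: cst_continuous.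
pose s0 : sing_simplex R M 0 := HB.pack_for (sing_simplex R M 0) (fun _ : stdsimplex R 0 => z0)
  (isContinuous.Build _ _ _ cz).
apply: cohomology_trace_eq; exists 1%N, (fun=> one), 1%:M; split.
- split=> // c cc; exists (const_mx (c s0)); split.
    rewrite /coboundaries /= big_ord1 mxE; apply/funext => x.
    rewrite -[LHS]/(c x - c s0 * 1) mulr1 (cocycle0_const x s0 cc).
    by rewrite subrr.
  move=> r; rewrite /coboundaries /= big_ord1 => /(congr1 (fun f : cochain R R[i] M 0 => f s0)).
  rewrite -[LHS]/(c s0 - r 0 0 * 1) mulr1 => /eqP; rewrite subr_eq0 => /eqP E.
  by apply/rowP => i; rewrite ord1 mxE E.
- move=> j; rewrite ord1 big_ord1 mxE eqxx scale1r /coboundaries /=.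
  by apply/funext => x; rewrite -[LHS]/((1 : R[i]) - 1) subrr.
by rewrite mxtrace1.
Qed.

Lemma cohomology_charE d (s : 'B_n) : cohomology_char R d s =
  (-1) ^+ d * \sum_(J : {set pair_idx n} | (rkf (R[i]^o) J == d) &&
     ((pair_perm (sgval s)^-1%g @: J)%SET == J)) (-1) ^+ #|J| * psgn R[i] (pair_perm (sgval s)^-1%g) J.
Proof.
case: d => [|d]; last exact: cohomology_char_pos.
rewrite cohomology_char0 expr0 mul1r (bigD1 finset.set0) /=; last first.
  by rewrite rkf0 eqxx imset0 eqxx.
rewrite psgn0 cards0 expr0 mul1r big1 ?addr0 // => J /andP [/andP [/eqP rJ _] J0].
by have := rkf_gt0 (C_neq2 R) J0; rewrite rJ.
Qed.

Lemma conj_cohomology_char d (s : 'B_n) : (cohomology_char R d s)^* = cohomology_char R d s.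
Proof.
rewrite cohomology_charE rmorphM rmorphXn rmorphN1 rmorph_sum; congr (_ * _).
apply: eq_bigr => J _; rewrite rmorphM rmorphXn rmorphN1 /psgn; congr (_ * _).
rewrite rmorph_prod; apply: eq_bigr => i _; rewrite rmorph_prod; apply: eq_bigr => j _.
by rewrite /inv_sign rmorphXn rmorphN1.
Qed.

End Connected.

(** * The theorem *)

Section FrobeniusClass.
Variables (F : finFieldType) (L : closedFieldType) (iota : {rmorphism F -> L}).
Local Notation q := #|F|.
Variable n : nat.

Lemma SQ_label (f : {poly F}) (x : 'rV[L]_n) : is_label iota f x -> SQ iota f = range (scoord x).
Proof.
move=> fx; apply/seteqP; split => z.
  by move=> /(label_root _ fx) [a ->]; exists a.
by move=> [a _ <-]; apply/(label_root _ fx); exists a.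
Qed.

Lemma frob_perm_label (f : {poly F}) (x : 'rV[L]_n) (s : 'B_n) :
  is_label iota f x -> (forall a, scoord x a ^+ q = scoord x (sgval s a)) ->
  exists b : 'B_n, s = (frob_perm iota n f ^ b)%g.
Proof.
move=> fx xs; have /andP [/injectiveP xi _] := fx.
have fs : is_frob_perm iota f s by exists x; split=> //; exact: SQ_label.
rewrite /frob_perm; case: xgetP => [s' _ [y [yi ySQ ys']]|/(_ s) //].
have [a|b bE] := relabel xi yi.
  have : range (scoord y) (scoord y a) by exists a.
  by rewrite -ySQ (SQ_label fx) => -[b _ <-]; exists b.
exists b; apply: (mulgI b); rewrite -conjgC; apply: val_inj; apply/permP => a.
apply: xi; rewrite /= !permM.
by rewrite -bE -ys' bE xs.
Qed.

End FrobeniusClass.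

Section LabelSum.
Variables (F : finFieldType) (L : closedFieldType) (iota : {rmorphism F -> L}).
Local Notation q := #|F|.
Variables (p k : nat).
Hypotheses (p_prime : prime p) (p_gt2 : (2 < p)%N) (k_gt0 : (0 < k)%N) (card_F : q = (p ^ k)%N).
Variable n : nat.
Variables (N : nat) (rs : seq L).
Hypothesis rsP : forall x, (x \in rs) = (x ^+ (q ^ N) == x).
Hypothesis iterN : forall (s : 'B_n) w, iter N (sgval s) w = w.
Local Notation E := (seq_sub rs).

Lemma pchar_F : p \in [pchar F].
Proof. exact: card_finPcharP card_F p_prime. Qed.

Lemma q_pchar : [pchar L].-nat q.
Proof. by rewrite card_F pnatX pnatE // (rmorph_pchar iota pchar_F). Qed.

Lemma F_two_neq0 : 2%:R != 0 :> F.
Proof. by rewrite -(dvdn_pcharf pchar_F); apply/negP => /(dvdn_leq (isT : (0 < 2)%N)); rewrite leqNgt p_gt2. Qed.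

Variables (K : numFieldType) (chi : 'B_n -> K).
Hypothesis chi_class : is_class_fun chi.

Lemma sum_chi_poly :
  #|{: 'B_n}|%:R * (\sum_(f : {poly_n.+1 F} | (f : {poly F}) \in Y F n) chi_poly iota chi f) =
  \sum_(s : 'B_n) chi s * #|labels F rs (sgval s)|%:R.
Proof.
transitivity (\sum_(f : {poly_n.+1 F} | (f : {poly F}) \in Y F n)
   \sum_(x : {ffun 'I_n -> E} | is_label iota f (pt x))
   \sum_(s : 'B_n | x \in labels F rs (sgval s)) chi s).
  rewrite mulr_sumr; apply: eq_bigr => f /set_mem [fm fs fsq f0].
  have fsep : separable_poly (f : {poly F}).
    apply: (squarefree_separable p_prime k_gt0 card_F) => //.
    by rewrite -size_poly_eq0 fs.
  have [x0 fx0] := label_exists iota F_two_neq0 fm fs fsep f0.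
  rewrite -(card_relabel q_pchar rsP iterN fx0) mulr_natl -sumr_const.
  apply: eq_big => [x|x]; rewrite inE // => fx.
  have [s sE] := label_frob q_pchar fx.
  have /andP [/injectiveP xi _] := fx.
  rewrite (big_pred1 s) => [|t].
    by have [b ->] := frob_perm_label fx sE; rewrite chi_class.
  rewrite !inE; apply/andP/eqP => [[/forallP xt _]|->].
    apply: val_inj; apply/permP => a; apply: xi.
    by rewrite -sE (eqP (xt a)).
  by split; [apply/forallP => a; rewrite sE|apply/injectiveP].
rewrite (exchange_big_dep xpredT) //=.
under eq_bigr => x _ do rewrite exchange_big /=.
rewrite (exchange_big_dep xpredT) //=; apply: eq_bigr => s _.
rewrite mulr_natr -sumr_const; apply: eq_bigr => x.
rewrite !inE => /andP [/forallP xs /injectiveP xi].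
have [f [fx fm fs fsep f0]] := label_poly iota q_pchar (subgP s) xi (fun a => eqP (xs a)).
have fS : (size f <= n.+1)%N by rewrite fs.
rewrite (big_pred1 (NPoly fS)) // => g; apply/andP/eqP => [[_ gx]|->].
  apply: val_inj; apply: (map_poly_inj iota) => /=.
  by move: gx fx => /andP [_ /eqP ->] /andP [_ /eqP ->].
split=> //; apply/mem_set; split=> // h hf.
rewrite leqNgt; apply/negP => h1.
by have := separable_nosquare fsep (isT : (1 < 2)%N) (_ : size h != 1%N);
  rewrite hf => /(_ ltac:(by rewrite gtn_eqF)).
Qed.

End LabelSum.

Theorem theorem4p1 (R : realType) (p k q : nat)
    (p_prime : prime p) (p_gt2 : (2 < p)%N) (k_gt0 : (0 < k)%N)
    (q_def : q = (p ^ k)%N)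
    (F : finFieldType) (card_F : #|F| = q)
    (L : closedFieldType) (iota : {rmorphism F -> L})
    (L_algebraic : integralRange iota)
    (n : nat) (n_gt0 : (0 < n)%N)
    (chi : 'B_n -> R[i]) (chi_class : is_class_fun chi) :
  \sum_(f : {poly_n.+1 F} | (f : {poly F}) \in Y F n) chi_poly iota chi f =
  \sum_(0 <= d < n.+1)
    (-1) ^+ d * q%:R ^+ (n - d) * class_inner chi (cohomology_char R d).
Proof.
have cF : #|F| = (p ^ k)%N by rewrite card_F.
have qL := q_pchar iota p_prime cF.
pose N := #|{: 'B_n}|.
have N0 : (0 < N)%N by apply/card_gt0P; exists 1%g.
have iterN (s : 'B_n) w : iter N (sgval s) w = w.
  have sX m : sgval (s ^+ m)%g = (sgval s ^+ m)%g by elim: m => // m IH; rewrite !expgS /= IH.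
  have sN : (s ^+ N)%g = 1%g by rewrite /N -finset.cardsT; exact: cyclic.expg_cardG (finset.in_setT s).
  by rewrite -permX -sX sN perm1.
have [rs [_ _ rsP]] := frob_rootsP (finNzRing_gt1 F) qL N0.
have F2 := F_two_neq0 p_prime p_gt2 cF.
apply: (mulfI (_ : N%:R != 0 :> R[i])); first by rewrite pnatr_eq0 -lt0n.
rewrite (sum_chi_poly iota p_prime p_gt2 k_gt0 cF rsP iterN chi_class).
rewrite mulr_sumr big_mkord.
transitivity (\sum_(d < n.+1) \sum_(s : 'B_n)
  chi s * (q%:R ^+ (n - d) * \sum_(J : {set pair_idx n} | (rkf (R[i]^o) J == d) &&
     ((pair_perm (sgval s)^-1%g @: J)%SET == J)) (-1) ^+ #|J| * psgn R[i] (pair_perm (sgval s)^-1%g) J)).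
  rewrite exchange_big; apply: eq_bigr => s _; rewrite -mulr_sumr; congr (_ * _).
  rewrite (card_labels iota qL F2 N0 rsP _ (subgP s) (iterN s)).
  rewrite [LHS](partition_big (fun J => inord (rkf (R[i]^o) J) : 'I_n.+1) xpredT) //=.
  apply: eq_bigr => d _; rewrite mulr_sumr; apply: eq_big => [J|J /andP [_ /eqP dJ]].
    by rewrite andbC; congr (_ && _); rewrite -val_eqE /= inordK // ltnS rkf_leq.
  by rewrite mulrC card_F (rkf_field J F2 (C_neq2 R)) -dJ inordK // ltnS rkf_leq.
apply: eq_bigr => d _; rewrite /class_inner mulrCA mulVKf; last by rewrite pnatr_eq0 -lt0n.
rewrite mulr_sumr; apply: eq_bigr => s _.
rewrite (conj_cohomology_char R n_gt0) (cohomology_charE R n_gt0).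
have sg : (-1) ^+ d * (-1) ^+ d = 1 :> R[i] by rewrite -expr2 sqrr_sign.
move: sg; set e := (-1) ^+ d; move: e (q%:R ^+ (n - d)) (\sum_(J | _) _) (chi s) => e Q S c sg.
by rewrite -[LHS]mul1r -sg; ring.
Qed.
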